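(* Let $f(t)=1-H(t)$ on $[0,1]$ and $f^{(2)}=f\circ f$. Suppose that $(\mu^1_+,\mu^1_-)$ is a two-cycle of $f$, i.e. $\mu^1_+,\mu^1_-\in[0,1]$ satisfy $f(\mu^1_+)=\mu^1_-$ and $f(\mu^1_-)=\mu^1_+$. Consider the iterated RDE $$X=1-\prod_{i=1}^{N_\emptyset}\Big(1-\prod_{j=1}^{N_i}X_{ij}\Big).$$ There are at most two solutions (invariant distributions on $[0,1]$) of this iterated RDE with mean $\mu^1_+$. There is a unique endogenous solution $C^+$ (with mean $\mu^1_+$), and a (possibly distinct) discrete solution $S^+$ (with mean $\mu^1_+$) taking values in $\{0,1\}$. The endogenous solution $C^+$ is given by the conditional probability of $S^+=1$ given the family sizes on the tree, i.e. $C^+_u=\mathbb P(S^+_u=1\mid N_v;v\in\mathbf T)$. The solutions $C^+$ and $S^+$ are distinct if and only if $H'(\mu^1_-)H'(\mu^1_+)>1$, i.e. if and only if $\mu^1_+$ (or $\mu^1_-$) is an unstable fixed point of $f^{(2)}$.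
   Context: $N$ is a random variable with values in $\{1,2,\dots\}\cup\{\infty\}$, and $H(s)=\mathbb E[s^N]$ for $s\in[0,1]$, with conventions $s^\infty=0$ for $0\le s<1$ and $1^\infty=1$; in particular $H(0)=0$. $H'$ is the derivative of $H$ (one-sided at an endpoint of $[0,1]$). Standing assumption: $H$ is strictly convex, so that $\mathbb P(2\le N<\infty)>0$. $\mathbf T=\bigcup_{n\ge0}\mathbb N^n$ is the tree of finite sequences of positive integers, $\emptyset$ its root, $|u|$ the length of $u$, and $u1,u2,\dots$ the daughters of $u$; $(N_u;u\in\mathbf T)$ are i.i.d. copies of $N$. An infinite product of numbers in $[0,1]$ is the limit of its partial products. A probability measure $\nu$ on $[0,1]$ is invariant for the iterated RDE if, when the $X_{ij}$ are i.i.d. with law $\nu$ and independent of $(N_u;u\in\mathbf T)$, the right-hand side of the iterated RDE has law $\nu$. A tree-indexed solution of the iterated RDE is a family $(X_u;|u|\text{ even})$ of $[0,1]$-valued random variables, all with the same law, such that for every $n$ the $(X_u;|u|=2n)$ are mutually independent and independent of $(N_v;|v|\le 2n-1)$, and $X_u=1-\prod_{i=1}^{N_u}\big(1-\prod_{j=1}^{N_{ui}}X_{uij}\big)$ for every $u$ with $|u|$ even. It is endogenous if it is measurable with respect to (the completion of) $\sigma(N_u;u\in\mathbf T)$; uniqueness of the endogenous solution is up to almost sure equality. The discrete solution $S^+$ is the tree-indexed solution with values in $\{0,1\}$ and $\mathbb P(S^+_u=1)=\mu^1_+=1-\mathbb P(S^+_u=0)$; $C^+$ and $S^+$ are distinct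 when their laws differ. A fixed point $p$ of $f^{(2)}$ is called unstable when $(f^{(2)})'(p)=H'(p)H'(f(p))>1$.
   Formalization: ''H'(μ−)H'(μ+)>1 (or μ± unstable) implies C+ and S+ distinct'' is stated only for 0<μ+<1; for the two-cycles (0,1),(1,0) both are a.s. constant and equal, though H'(0)H'(1) may exceed 1 (e.g. P(N=1)=P(N=4)=1/2). The converse is stated for all two-cycles. *)

(* Defs.v *)
From HB Require Import structures.
From mathcomp Require Import all_boot all_order all_algebra.
From mathcomp Require Import all_classical all_reals all_analysis.

Set Implicit Arguments.
Unset Strict Implicit.
Unset Printing Implicit Defensive.

Import Order.TTheory GRing.Theory Num.Theory.
Import numFieldNormedType.Exports.

Local Open Scope classical_set_scope.
Local Open Scope ring_scope.

(* Naturals together with infinity ([None]), with the discrete sigma-algebra. *)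
Definition xnat : Type := option nat.

HB.instance Definition _ := Pointed.on xnat.
HB.instance Definition _ := @isMeasurable.Build default_measure_display
  xnat discrete_measurable discrete_measurable0
  discrete_measurableC discrete_measurableU.

(* Only used for 0 <= s <= 1. *)
Definition xpow {R : realType} (s : R) (n : xnat) : R :=
  match n with
  | Some k => s ^+ k
  | None => if s == 1 then 1 else 0
  end.

Definition xprod {R : realType} (n : xnat) (x : nat -> R) : R :=
  match n with
  | Some k => \prod_(i < k) x i
  | None => limn (fun k => \prod_(i < k) x i)
  end.

Definition pgf {R : realType} d0 {T0 : measurableType d0}
    {P0 : probability T0 R} (N : {RV P0 >-> xnat}) (s : R) : R :=
  fine 'E_P0[fun w => xpow s (N w)].

Definition strictly_convex01 {R : realType} (g : R -> R) : Prop :=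
  forall x y t : R, x \in `[0, 1] -> y \in `[0, 1] -> x != y ->
    t \in `]0, 1[ -> g (t * x + (1 - t) * y) < t * g x + (1 - t) * g y.

(* Derivative at [p] of a function on [0, 1]: one-sided at the endpoints, and
   possibly infinite there. *)
Definition deriv01 {R : realType} (g : R -> R) (p : R) : \bar R :=
  lim (((g x - g p) / (x - p))%:E @[x --> within [set` `[0, 1]] p^']).

Definition two_cycle {R : realType} (f : R -> R) (a b : R) : Prop :=
  [/\ a \in `[0, 1], b \in `[0, 1], f a = b & f b = a].

Definition unstable_fixpoint {R : realType} (g : R -> R) (p : R) : Prop :=
  g p = p /\ (1%:E < deriv01 g p)%E.

Definition same_law {R : realType} d1 d2 d'
    {T1 : measurableType d1} {T2 : measurableType d2} {T' : measurableType d'}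
    {P1 : probability T1 R} {P2 : probability T2 R}
    (X : {RV P1 >-> T'}) (Y : {RV P2 >-> T'}) : Prop :=
  forall A : set T', measurable A -> distribution P1 X A = distribution P2 Y A.

Definition mutually_indep {R : realType} d d' {T : measurableType d}
    {T' : measurableType d'} {P : probability T R} {I : eqType} (D : set I)
    (X : I -> {RV P >-> T'}) : Prop :=
  forall (s : seq I) (A : I -> set T'), uniq s -> [set` s] `<=` D ->
    (forall i, i \in s -> measurable (A i)) ->
    P (\bigcap_(i in [set` s]) (X i @^-1` A i)) =
    (\prod_(i <- s) P (X i @^-1` A i))%E.

Definition sigma_family {R : realType} d d' {T : measurableType d}
    {T' : measurableType d'} {P : probability T R} {I : Type}
    (D : set I) (X : I -> {RV P >-> T'}) : set (set T) :=
  <<s \bigcup_(i in D) preimage_set_system setT (X i) measurable >>.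

Definition indep_systems {R : realType} d {T : measurableType d}
    (P : probability T R) (F G : set (set T)) : Prop :=
  forall A B, F A -> G B -> P (A `&` B) = (P A * P B)%E.

(* Completion of the sigma-algebra [G] with respect to [P] restricted to [G]. *)
Definition completion {R : realType} d {T : measurableType d}
    (P : probability T R) (G : set (set T)) : set (set T) :=
  [set A | exists B Z : set T,
     [/\ G B, G Z, P Z = 0%E & (A `\` B) `|` (B `\` A) `<=` Z]].

Definition completion_measurable {R : realType} d {T : measurableType d}
    {P : probability T R} (G : set (set T)) (X : {RV P >-> R}) : Prop :=
  preimage_set_system setT X measurable `<=` completion P G.

(* [Y] is a version of the conditional probability of [E] given [G]. *)
Definition is_cond_prob {R : realType} d {T : measurableType d}
    {P : probability T R} (G : set (set T)) (E : set T) (Y : {RV P >-> R})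
    : Prop :=
  completion_measurable G Y /\
  forall A, G A -> (\int[P]_(w in A) (Y w)%:E = P (A `&` E))%E.

(* The vertices of the tree are the [u : seq nat], the root is [::], |u| is
   [size u], and the daughters u1, u2, ... of [u] are
   [rcons u 0], [rcons u 1], ...: daughters are numbered from 0, so that those
   contributing to a product up to [n : xnat] are the [rcons u i] with i < n. *)
Definition iid_copies {R : realType} d0 d {T0 : measurableType d0}
    {P0 : probability T0 R} (N : {RV P0 >-> xnat}) {T : measurableType d}
    {P : probability T R} (Nu : seq nat -> {RV P >-> xnat}) : Prop :=
  (forall u, same_law (Nu u) N) /\ mutually_indep setT Nu.

Definition rde_map {R : realType} (n : xnat) (m : nat -> xnat)
    (x : nat -> nat -> R) : R :=
  1 - xprod n (fun i => 1 - xprod (m i) (x i)).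

(* The law [nu] on [0, 1] is represented by a law on the line carried by
   [0, 1]. *)
Definition invariant_law {R : realType} d0 {T0 : measurableType d0}
    {P0 : probability T0 R} (N : {RV P0 >-> xnat})
    (nu : probability R R) : Prop :=
  nu [set` `[0, 1]] = 1%E /\
  forall (d : measure_display) (T : measurableType d) (P : probability T R)
    (Nu : seq nat -> {RV P >-> xnat}) (X : nat * nat -> {RV P >-> R}),
    iid_copies N Nu ->
    (forall ij w, 0 <= X ij w <= 1) ->
    (forall ij A, measurable A -> distribution P (X ij) A = nu A) ->
    mutually_indep setT X ->
    indep_systems P (sigma_family setT X) (sigma_family setT Nu) ->
    forall A : set R, measurable A ->
      P [set w | A (rde_map (Nu [::] w) (fun i => Nu [:: i] w)
                            (fun i j => X (i, j) w))] = nu A.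

(* Only the [X u] with [size u] even are constrained or meaningful. *)
Record tree_solution {R : realType} d {T : measurableType d}
    {P : probability T R} (Nu : seq nat -> {RV P >-> xnat})
    (X : seq nat -> {RV P >-> R}) : Prop := {
  tree_sol_01 : forall u w, ~~ odd (size u) -> 0 <= X u w <= 1;
  tree_sol_law : forall u v, ~~ odd (size u) -> ~~ odd (size v) ->
    same_law (X u) (X v);
  tree_sol_indep : forall n, mutually_indep [set u | size u = n.*2] X;
  tree_sol_indepN : forall n,
    indep_systems P (sigma_family [set u | size u = n.*2] X)
                    (sigma_family [set v | (size v < n.*2)%N] Nu);
  tree_sol_eq : forall u, ~~ odd (size u) ->
    {ae P, forall w, X u w =
       rde_map (Nu u w) (fun i => Nu (rcons u i) w)
               (fun i j => X (rcons (rcons u i) j) w)} }.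

Definition endogenous_solution {R : realType} d {T : measurableType d}
    {P : probability T R} (Nu : seq nat -> {RV P >-> xnat})
    (C : seq nat -> {RV P >-> R}) : Prop :=
  tree_solution Nu C /\
  forall u, ~~ odd (size u) -> completion_measurable (sigma_family setT Nu) (C u).

Definition discrete_solution {R : realType} d {T : measurableType d}
    {P : probability T R} (Nu : seq nat -> {RV P >-> xnat}) (mu : R)
    (S : seq nat -> {RV P >-> R}) : Prop :=
  [/\ tree_solution Nu S,
      forall u w, ~~ odd (size u) -> S u w = 0 \/ S u w = 1 &
      forall u, ~~ odd (size u) -> P (S u @^-1` [set 1]) = mu%:E].

(* Main.v *)
(* If X and Y have mean mup and E[XY] = x, then one step of the iterated RDE, with
   the same family sizes for both and independent copies of the pair (X, Y) as
   inputs, produces a pair with means mup and mixed moment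
   K x = 2 mup - 1 + H (2 mum - 1 + H x). Let xoo be the increasing limit of the
   iterates of K at mup^2. By strict convexity, xoo and mup are the only fixed points
   of K in [xoo, mup]; if 0 < mup < 1, then xoo < mup if and only if
   K'(mup) = H'(mum) H'(mup) > 1, and otherwise xoo = mup.

   Iterating the RDE from the constant mup gives the conditional expectation, given
   the family sizes of the first levels, of any solution with mean mup. These
   iterates are Cauchy in L^2, with second moments K^n (mup^2). Their limit C is
   endogenous, has second moment xoo and is the conditional expectation given N of
   every solution with mean mup. Hence C is the unique endogenous solution,
   C_u = P(S_u = 1 | N), and C and S have the same law if and only if xoo = mup.

   The second moment of an invariant law with mean mup is a fixed point of K and is at
   least xoo. If it is mup, the law is carried by {0, 1}. Two invariant laws with
   second moment xoo coincide: put independent variables with the two laws on one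
   tree and iterate; the laws are preserved and the L^2 distance tends to 0.

   S is a projective limit: put independent Bernoulli (mup) variables on level 2M
   and compute the values on the levels closer to the root by the RDE; the laws of
   (N, S) obtained for different M are consistent. Probabilities on bit sequences
   come from Lebesgue measure on [0, 1] by nested intervals. *)
Require Import Defs.
From HB Require Import structures.
From mathcomp Require Import all_boot all_order all_algebra.
From mathcomp Require Import all_classical all_reals all_analysis.
From mathcomp Require Import measurable_realfun.
From mathcomp Require Import ring lra.

Set Implicit Arguments.
Unset Strict Implicit.
Unset Printing Implicit Defensive.

Import Order.TTheory GRing.Theory Num.Theory.
Import numFieldNormedType.Exports.

Local Open Scope classical_set_scope.
Local Open Scope ring_scope.

(** A solution is only assumed to have its level 2n independent of the family sizes on the levels
    nearer to the root; its joint law with the whole tree is not given. It is therefore compared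
    with the iterates through [agree]: equality of the expectations of all finite products over
    distinct vertices, times indicators of events of the first levels. This relation survives
    complements and products over a random, possibly infinite, number of daughters. The formula for
    K comes from the multiplicativity of these products, which turns E XY into H (E XY), and from E
    (1 - A)(1 - B) = 1 - E A - E B + E AB.

    The limit of the iterates is taken along a deterministic fast subsequence, so that one
    measurable function of the tree serves every vertex and every probability space.

    Invariance of a law speaks of arbitrary probability spaces, hence yields something only once a
    space with an i.i.d. tree is at hand. Such spaces are built on fair coins, whose index set is
    split into countably many independent rows. *)

Definition mkmfun d d' (T : measurableType d) (T' : measurableType d')
  (f : T -> T') (mf : measurable_fun setT f) : {mfun T >-> T'} :=
  mfun_Sub (mem_set mf).

Lemma measurable_preim d d' (T : measurableType d) (T' : measurableType d')
    (X : T -> T') (A : set T') :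
  measurable_fun setT X -> measurable A -> measurable (X @^-1` A).
Proof. by move=> mX mA; rewrite -[X in measurable X]setTI; exact: mX. Qed.

(** Dynkin's pi-lambda theorem as an induction principle; identities between measures or integrals
    are extended from generators through it. *)
Lemma g_sigma_ind (T : Type) (G H : set (set T)) :
  setI_closed G -> G `<=` H -> H setT ->
  (forall A, H A -> H (~` A)) ->
  (forall F : (set T)^nat, trivIset setT F -> (forall n, H (F n)) ->
     H (\bigcup_n F n)) ->
  <<s G >> `<=` H.
Proof.
move=> GI GH HT HC HU; rewrite -setI_closed_g_dynkin_g_sigma_algebra//.
by apply: smallest_sub.
Qed.

Lemma indicIE {R : realType} (T : Type) (A B : set T) w :
  \1_(A `&` B) w = \1_A w * \1_B w :> R.
Proof. by rewrite indicI. Qed.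

Lemma indicPE {R : realType} (T : Type) (A : set T) (b : bool) w :
  (A w <-> b) -> \1_A w = b%:R :> R.
Proof.
move=> Ab; rewrite indicE; congr ((nat_of_bool _)%:R).
by apply/idP/idP => [|/Ab]; rewrite inE// => /Ab.
Qed.

(** * Expectations of bounded random variables *)

Section expectation.
Context {R : realType} d (T : measurableType d) (P : probability T R).
Implicit Types (X Y Z : T -> R) (A B : set T).

Definition ex X : R := \int[P]_w X w.

Definition bm X := measurable_fun setT X /\ exists M, forall w, `|X w| <= M.

(** Infinite products of [0, 1]-valued variables converge, which fails for merely bounded ones. *)
Definition um X := measurable_fun setT X /\ forall w, 0 <= X w <= 1.

Lemma um_bm X : um X -> bm X.
Proof.
move=> [mX X01]; split => //; exists 1 => w.
by have /andP[? ?] := X01 w; rewrite ger0_norm.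
Qed.

Lemma bm_integrable X : bm X -> P.-integrable setT (EFin \o X).
Proof.
move=> [mX [M XM]]; apply: measurable_bounded_integrable => //.
- by have /= -> := @probability_setT _ _ _ P; rewrite ltry.
- exists M; split; first exact: num_real.
  by move=> x Mx w _; exact: le_trans (XM w) (ltW Mx).
Qed.

Lemma bm_cst c : bm (fun=> c).
Proof. by split; [exact: measurable_cst|exists `|c|]. Qed.

Lemma bmD X Y : bm X -> bm Y -> bm (fun w => X w + Y w).
Proof.
move=> [mX [M XM]] [mY [M' YM]]; split; first exact: measurable_funD.
by exists (M + M') => w; rewrite (le_trans (ler_normD _ _))// lerD.
Qed.

Lemma bmM X Y : bm X -> bm Y -> bm (fun w => X w * Y w).
Proof.
move=> [mX [M XM]] [mY [M' YM]]; split; first exact: measurable_funM.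
by exists (M * M') => w; rewrite normrM ler_pM.
Qed.

Lemma bmN X : bm X -> bm (fun w => - X w).
Proof.
move=> [mX [M XM]]; split; first exact: measurableT_comp.
by exists M => w; rewrite normrN.
Qed.

Lemma bmB X Y : bm X -> bm Y -> bm (fun w => X w - Y w).
Proof. by move=> bX bY; apply: bmD => //; exact: bmN. Qed.

Lemma um_cst c : 0 <= c <= 1 -> um (fun=> c).
Proof. by split. Qed.

Lemma um_indic A : measurable A -> um \1_A.
Proof.
move=> mA; split; first exact: measurable_indic.
by move=> w; rewrite indicE; case: (w \in A); rewrite ?lexx ?ler01.
Qed.

Lemma umM X Y : um X -> um Y -> um (fun w => X w * Y w).
Proof.
move=> [mX X01] [mY Y01]; split; first exact: measurable_funM.
move=> w; have /andP[? ?] := X01 w; have /andP[? ?] := Y01 w.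
by rewrite mulr_ge0//= mulr_ile1.
Qed.

Lemma umC X : um X -> um (fun w => 1 - X w).
Proof.
move=> [mX X01]; split; first exact: measurable_funB.
by move=> w; have := X01 w; lra.
Qed.

Lemma um_prod (I : Type) (s : seq I) (F : I -> T -> R) :
  (forall i, um (F i)) -> um (fun w => \prod_(i <- s) F i w).
Proof.
move=> uF; elim: s => [|i s IH].
  under eq_fun do rewrite big_nil.
  by apply: um_cst; rewrite ler01 lexx.
under eq_fun do rewrite big_cons.
exact: umM.
Qed.

Lemma um_lim (F : nat -> T -> R) X :
  (forall n, um (F n)) -> (forall w, F^~ w @ \oo --> X w) -> um X.
Proof.
move=> uF FX; split.
  by apply: (@measurable_fun_cvg _ _ _ _ F) => // n; exact: (uF n).1.
move=> w; apply/andP; split.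
- by apply: (cvgr_to_ge (FX w)); apply: nearW => n; have /andP[] := (uF n).2 w.
- by apply: (cvgr_to_le (FX w)); apply: nearW => n; have /andP[] := (uF n).2 w.
Qed.

Lemma ex_fin X : bm X -> (\int[P]_w (X w)%:E)%E = (ex X)%:E.
Proof.
move=> bX; rewrite /ex /Rintegral fineK//.
by apply: integrable_fin_num => //; exact: bm_integrable.
Qed.

Lemma ex_cst c : ex (fun=> c) = c.
Proof.
rewrite /ex Rintegral_cst//.
by have /= -> := @probability_setT _ _ _ P; rewrite mulr1.
Qed.

Lemma exD X Y : bm X -> bm Y -> ex (fun w => X w + Y w) = ex X + ex Y.
Proof. by move=> bX bY; rewrite /ex RintegralD//; exact: bm_integrable. Qed.

Lemma exB X Y : bm X -> bm Y -> ex (fun w => X w - Y w) = ex X - ex Y.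
Proof. by move=> bX bY; rewrite /ex RintegralB//; exact: bm_integrable. Qed.

Lemma exZ c X : bm X -> ex (fun w => c * X w) = c * ex X.
Proof. by move=> bX; rewrite /ex RintegralZl//; exact: bm_integrable. Qed.

Lemma ex_le X Y : bm X -> bm Y -> (forall w, X w <= Y w) -> ex X <= ex Y.
Proof.
by move=> bX bY XY; apply: le_Rintegral => //; exact: bm_integrable.
Qed.

Lemma ex_ge0 X : (forall w, 0 <= X w) -> 0 <= ex X.
Proof. by move=> X0; apply: Rintegral_ge0. Qed.

Lemma ex_um X : um X -> 0 <= ex X <= 1.
Proof.
move=> uX; rewrite -[X in X <= _](ex_cst 0) -[X in _ && (_ <= X)](ex_cst 1); apply/andP; split.
- by apply: ex_le; [exact: bm_cst|exact: um_bm|move=> w; case/andP: (uX.2 w)].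
- by apply: ex_le; [exact: um_bm|exact: bm_cst|move=> w; case/andP: (uX.2 w)].
Qed.

Lemma eq_ex X Y : X =1 Y -> ex X = ex Y.
Proof. by move=> /funext ->. Qed.

Lemma ae_eq_ex X Y : measurable_fun setT X -> measurable_fun setT Y ->
  {ae P, forall w, X w = Y w} -> ex X = ex Y.
Proof.
move=> mX mY XY; rewrite /ex /Rintegral; congr fine.
apply: ae_eq_integral => //; [exact/measurable_EFinP|exact/measurable_EFinP|].
by move: XY; apply: filterS => w -> _.
Qed.

Lemma ex_indic A : measurable A -> ex \1_A = fine (P A).
Proof. by move=> mA; rewrite /ex /Rintegral integral_indic// setIT. Qed.

Lemma indic_fin A : measurable A -> P A = (ex \1_A)%:E.
Proof. by move=> mA; rewrite ex_indic// fineK//; exact: fin_num_measure. Qed.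

Lemma ex_cvg (F : nat -> T -> R) X (M : R) :
  (forall n, measurable_fun setT (F n)) -> measurable_fun setT X ->
  (forall n w, `|F n w| <= M) -> {ae P, forall w, F^~ w @ \oo --> X w} ->
  ex (F n) @[n --> \oo] --> ex X.
Proof.
move=> mF mX FM FX.
have bF n : bm (F n) by split => //; exists M.
have FX' : {ae P, forall w, setT w -> (fun n => EFin \o F n) ^~ w @ \oo --> (EFin \o X) w}.
  by apply: filterS FX => w FX _; apply: cvg_EFin => //; exact: nearW.
have FM' : {ae P, forall w n, setT w -> (`|(EFin \o F n) w| <= M%:E)%E}.
  by apply: aeW => w n _ /=; rewrite lee_fin.
have [iX _] := @dominated_convergence _ _ _ P setT measurableT
  (fun n => EFin \o F n) (EFin \o X) (fun=> M%:E)
  (fun n => (measurable_EFinP _ _).2 (mF n)) ((measurable_EFinP _ _).2 mX)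
  FX' (bm_integrable (bm_cst M)) FM'.
by rewrite -[X in _ --> X -> _]fineK; [move=> /fine_cvg|exact: integrable_fin_num].
Qed.

Lemma ex_eq0 X : bm X -> (forall w, 0 <= X w) -> ex X = 0 ->
  {ae P, forall w, X w = 0}.
Proof.
move=> bX X0 eX0; have := ex_fin bX; rewrite eX0 => iX.
have mX : measurable_fun setT (EFin \o X) by exact/measurable_EFinP/bX.1.
have /(ae_eq_integral_abs P measurableT mX) : (\int[P]_(x in setT) `|(EFin \o X) x| = 0)%E.
  by rewrite -[RHS]iX; apply: eq_integral => w _ /=; rewrite ger0_norm.
by apply: filterS => w /(_ I) [].
Qed.

Lemma bm_sq X : bm X -> bm (fun w => X w ^+ 2).
Proof. by move=> bX; under eq_fun do rewrite expr2; exact: bmM. Qed.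

(** Nonnegativity of the variance. *)
Lemma sq_ex_le X : bm X -> ex X ^+ 2 <= ex (fun w => X w ^+ 2).
Proof.
move=> bX; set c := ex X.
have : 0 <= ex (fun w => (X w - c) ^+ 2) by apply: ex_ge0 => w; exact: sqr_ge0.
have -> : ex (fun w => (X w - c) ^+ 2) =
    ex (fun w => (X w ^+ 2 - (2 * c) * X w) + c ^+ 2).
  by apply: eq_ex => w; ring.
rewrite exD ?exB ?exZ ?ex_cst -/c//; try exact: bm_cst; try exact: bm_sq.
- lra.
- by apply: bmM => //; exact: bm_cst.
- by apply: bmB; [exact: bm_sq|apply: bmM => //; exact: bm_cst].
Qed.

Lemma ex_sqB X Y : bm X -> bm Y ->
  ex (fun w => (X w - Y w) ^+ 2) =
  ex (fun w => X w ^+ 2) - 2 * ex (fun w => X w * Y w) + ex (fun w => Y w ^+ 2).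
Proof.
move=> bX bY.
have -> : ex (fun w => (X w - Y w) ^+ 2) =
    ex (fun w => (X w ^+ 2 - 2 * (X w * Y w)) + Y w ^+ 2).
  by apply: eq_ex => w; ring.
rewrite exD ?exB ?exZ//; try exact: bm_sq; try exact: bmM.
- by apply: bmM; [exact: bm_cst|exact: bmM].
- by apply: bmB; [exact: bm_sq|apply: bmM; [exact: bm_cst|exact: bmM]].
Qed.

End expectation.

Lemma prob_setI_full {R : realType} d (T : measurableType d) (P : probability T R)
    (J E : set T) : measurable J -> P J = 1%E -> measurable E -> P (E `&` J) = P E.
Proof.
move=> mJ J1 mE; suff E0 : P (E `\` J) = 0%E.
  transitivity (P (E `\` J) + P (E `&` J))%E; first by rewrite E0 add0e.
  exact/esym/measureDI.
apply/eqP; rewrite -measure_le0.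
have <- : P (~` J) = 0%E by rewrite probability_setC// J1 subee.
apply: le_measure; rewrite ?inE; [exact: measurableD|exact: measurableC|].
by move=> x [].
Qed.

Section clip.
Context {R : realType}.

(** Laws on [0, 1] are represented on the whole line. Composing with the clip makes the identity and
    the square bounded test functions and changes nothing on [0, 1]. *)
Definition clip01 (x : R) : R := Num.max 0 (Num.min 1 x).

Lemma um_clip01 : um clip01.
Proof.
split; last first.
  by move=> x; rewrite le_max lexx /= ge_max ler01 ge_min lexx.
apply: measurable_maxr; first exact: measurable_cst.
apply: measurable_minr; [exact: measurable_cst|exact: measurable_id].
Qed.

Lemma clip01_id x : 0 <= x <= 1 -> clip01 x = x.
Proof. by move=> /andP[x0 x1]; rewrite /clip01 (min_idPr x1) (max_idPr x0). Qed.

Lemma clip01_eq0 x : x <= 0 -> clip01 x = 0.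
Proof.
by move=> x0; rewrite /clip01; apply/max_idPl; rewrite ge_min x0 orbT.
Qed.

Lemma clip01_eq1 x : 1 <= x -> clip01 x = 1.
Proof. by move=> x1; rewrite /clip01 (min_idPl x1); apply/max_idPr. Qed.

Lemma clip01_lip x y : (clip01 x - clip01 y) ^+ 2 <= (x - y) ^+ 2.
Proof.
rewrite -ler_sqrt ?sqr_ge0// !sqrtr_sqr.
have h (a b : R) : a <= b -> clip01 b - clip01 a <= b - a /\ 0 <= clip01 b - clip01 a.
  move=> ab; rewrite /clip01.
  case: (leP 1 a) => a1; case: (leP 1 b) => b1.
  - by rewrite !(max_idPr ler01); lra.
  - by exfalso; lra.
  - by rewrite (max_idPr ler01); case: (leP 0 a) => a0; lra.
  - by case: (leP 0 a) => a0; case: (leP 0 b) => b0; lra.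
case: (leP x y) => xy.
  have [h1 h2] := h _ _ xy; rewrite ler0_norm; last lra.
  by rewrite ler0_norm; lra.
have [h1 h2] := h _ _ (ltW xy); rewrite ger0_norm//.
by rewrite ger0_norm; lra.
Qed.

End clip.

Section law.
Context {R : realType}.

Lemma ex_pushforward d d' (T : measurableType d) (T' : measurableType d')
    (P : probability T R) (X : {mfun T >-> T'}) (g : T' -> R) :
  bm g -> ex (distribution P X) g = ex P (g \o X).
Proof.
move=> bg; rewrite /ex /Rintegral; congr fine.
apply: integral_pushforward => //.
- exact/measurable_EFinP/bg.1.
- apply: (@bm_integrable _ _ _ P); split; first exact: measurableT_comp bg.1 _.
  by have [_ [M gM]] := bg; exists M => w /=.
Qed.

Lemma eq_measure_ex d (T : measurableType d) (P Q : probability T R)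
    (g : T -> R) :
  (forall A, measurable A -> P A = Q A) -> ex P g = ex Q g.
Proof.
move=> PQ; rewrite /ex /Rintegral; congr fine.
by apply: eq_measure_integral => A mA _; exact: PQ.
Qed.

Lemma eq_law_ex d1 d2 d' (T1 : measurableType d1) (T2 : measurableType d2)
    (T' : measurableType d') (P1 : probability T1 R) (P2 : probability T2 R)
    (X : T1 -> T') (Y : T2 -> T') (g : T' -> R) :
  measurable_fun setT X -> measurable_fun setT Y ->
  (forall A, measurable A -> P1 (X @^-1` A) = P2 (Y @^-1` A)) ->
  bm g -> ex P1 (g \o X) = ex P2 (g \o Y).
Proof.
move=> mX mY XY bg.
have := ex_pushforward P1 (mkmfun mX) bg; rewrite /= => <-.
have := ex_pushforward P2 (mkmfun mY) bg; rewrite /= => <-.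
by apply: eq_measure_ex => A mA; exact: XY.
Qed.

End law.

(** * Factorization of expectations by staircase approximation *)

Section layers.
Context {R : realType} d (T : measurableType d) (P : probability T R).

(** For X in [0, 1] this is floor (n X) / n, written as a combination of indicators of events of
    X. *)
Definition layers (n : nat) (X : T -> R) (w : T) : R :=
  n%:R^-1 * \sum_(k < n) \1_(X @^-1` [set x | k.+1%:R <= n%:R * x]) w.

Lemma count_layers (n : nat) (y : R) : 0 <= y <= n%:R ->
  \sum_(k < n) ((k.+1%:R <= y)%R%:R : R) <= y <=
  \sum_(k < n) ((k.+1%:R <= y)%R%:R : R) + 1.
Proof.
elim: n y => [|n IH] y.
  by rewrite !big_ord0 => /andP[y0 y1]; lra.
move=> /andP[y0 y1]; rewrite big_ord_recr/=.
have [ny|yn] := leP n.+1%:R y.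
  have -> : y = n.+1%:R by apply/eqP; rewrite eq_le y1 ny.
  rewrite (eq_bigr (fun=> 1)); last by move=> i _; rewrite ler_nat ltnS ltnW.
  by rewrite sumr_const card_ord mulr1n -natr1; apply/andP; split; lra.
have [yn'|ny] := leP y n%:R.
  by have := IH y; rewrite y0 yn' => /(_ isT); rewrite addr0.
rewrite (eq_bigr (fun=> 1)); last first.
  move=> i _; rewrite (_ : (_ <= y) = true)//; apply: le_trans (ltW ny).
  by rewrite ler_nat.
rewrite sumr_const card_ord mulr0n addr0; apply/andP; split; first exact: ltW.
by move: yn; rewrite -natr1 => /ltW.
Qed.

Lemma layers_near n X w : (0 < n)%N -> 0 <= X w <= 1 ->
  layers n X w <= X w <= layers n X w + n%:R^-1.
Proof.
move=> n0 X01; rewrite /layers.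
have n0' : 0 < n%:R :> R by rewrite ltr0n.
have : 0 <= n%:R * X w <= n%:R.
  have /andP[? ?] := X01; rewrite mulr_ge0 ?ler0n//=.
  by rewrite -[leRHS]mulr1 ler_wpM2l ?ler0n.
move=> /count_layers.
rewrite (eq_bigr (fun k : 'I_n =>
  \1_(X @^-1` [set x | k.+1%:R <= n%:R * x]) w)); last first.
  by move=> k _; rewrite indicE; congr ((nat_of_bool _)%:R); apply/idP/idP; rewrite inE.
set S := \sum_(_ < _) _ => /andP[S1 S2].
rewrite -(ler_pM2l n0') mulrA divff ?lt0r_neq0// mul1r S1/=.
by rewrite -(ler_pM2l n0') mulrDr mulrA divff ?lt0r_neq0// mul1r.
Qed.

Lemma measurable_layer n (k : nat) : measurable [set x : R | k%:R <= n%:R * x].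
Proof.
rewrite (_ : [set x | _] = (fun x : R => n%:R * x) @^-1` `[k%:R, +oo[%classic).
  by apply: measurable_preim => //; apply: measurable_funM => //; exact: measurable_cst.
by apply/seteqP; split=> x /=; rewrite in_itv/= andbT.
Qed.

Lemma ex_sum (I : Type) (s : seq I) (F : I -> T -> R) :
  (forall i, bm (F i)) ->
  bm (fun w => \sum_(i <- s) F i w) /\
  ex P (fun w => \sum_(i <- s) F i w) = \sum_(i <- s) ex P (F i).
Proof.
move=> bF; elim: s => [|i s [IH1 IH2]].
  under eq_fun do rewrite big_nil.
  by rewrite big_nil ex_cst; split => //; exact: bm_cst.
under eq_fun do rewrite big_cons.
by rewrite big_cons -IH2 exD//; split => //; exact: bmD.
Qed.

Lemma um_layers n X : (0 < n)%N -> um X -> bm (layers n X).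
Proof.
move=> n0 [mX X01]; apply: bmM; first exact: bm_cst.
apply: (ex_sum _ _).1 => k; apply/um_bm/um_indic/measurable_preim => //.
exact: measurable_layer.
Qed.

(** Sandwich X between [layers n X] and [layers n X] + 1/n. On the lower function the hypothesis
    applies term by term, and each side of the identity moves by at most E G / n. *)
Lemma ex_indepM (X G : T -> R) : um X -> bm G -> (forall w, 0 <= G w) ->
  (forall B : set R, measurable B ->
    ex P (fun w => \1_(X @^-1` B) w * G w) = ex P \1_(X @^-1` B) * ex P G) ->
  ex P (fun w => X w * G w) = ex P X * ex P G.
Proof.
move=> uX bG G0 XG.
have near n : (0 < n)%N ->
    `|ex P (fun w => X w * G w) - ex P X * ex P G| <= n%:R^-1 * (2 * ex P G).
  move=> n0; pose L := layers n X.
  have bL : bm L by exact: um_layers.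
  have bX := um_bm uX.
  have LG : ex P (fun w => L w * G w) = ex P L * ex P G.
    have bI (k : 'I_n) : bm (\1_(X @^-1` [set x | k.+1%:R <= n%:R * x]) : T -> R).
      by apply/um_bm/um_indic/measurable_preim; [exact: uX.1|exact: measurable_layer].
    rewrite /L /layers exZ ?(ex_sum _ _).2//; last exact: (ex_sum _ _).1.
    rewrite -mulrA mulr_suml.
    rewrite [in RHS](eq_bigr (fun k : 'I_n => ex P (fun w =>
      \1_(X @^-1` [set x | k.+1%:R <= n%:R * x]) w * G w))); last first.
      by move=> k _; rewrite XG//; exact: measurable_layer.
    rewrite -(ex_sum _ _).2; last by move=> k; exact: bmM.
    rewrite -exZ; last by apply: (ex_sum _ _).1 => k; exact: bmM.
    by apply: eq_ex => w; rewrite -mulrA mulr_suml.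
  have c0 : bm (fun _ : T => n%:R^-1 : R) by exact: bm_cst.
  have Lw w := layers_near n0 (uX.2 w).
  have h1 : ex P (fun w => L w * G w) <= ex P (fun w => X w * G w).
    by apply: ex_le => [||w]; [exact: bmM|exact: bmM|];
      rewrite ler_wpM2r//; case/andP: (Lw w).
  have h2 : ex P (fun w => X w * G w) <= ex P (fun w => L w * G w + n%:R^-1 * G w).
    apply: ex_le => [||w]; [exact: bmM|by apply: bmD; exact: bmM|].
    by rewrite -mulrDl ler_wpM2r//; case/andP: (Lw w).
  rewrite exD ?exZ// in h2; try exact: bmM.
  have h3 : ex P L <= ex P X.
    by apply: ex_le => [||w] //; case/andP: (Lw w).
  have h4 : ex P X <= ex P (fun w => L w + n%:R^-1).
    by apply: ex_le => [||w] //; [exact: bmD|case/andP: (Lw w)].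
  rewrite exD ?ex_cst// in h4.
  have eG := ex_ge0 P G0.
  rewrite LG in h1 h2.
  have h5 : ex P L * ex P G <= ex P X * ex P G by rewrite ler_wpM2r.
  have h6 : ex P X * ex P G <= (ex P L + n%:R^-1) * ex P G by rewrite ler_wpM2r.
  have h7 : 0 <= n%:R^-1 * ex P G by rewrite mulr_ge0// invr_ge0 ler0n.
  rewrite mulrDl in h6; rewrite ler_norml; apply/andP; split; nra.
apply/eqP; rewrite -subr_eq0 -normr_le0; apply/ler_addgt0Pl => e e0.
rewrite addr0.
have : (fun n => n.+1%:R^-1 * (2 * ex P G)) @ \oo --> 0 * (2 * ex P G).
  by apply: cvgMl; exact: cvg_harmonic.
rewrite mul0r => /cvgrPdist_le /(_ _ e0) [n _ /(_ n (leqnn n))] /=.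
rewrite sub0r normrN => h; apply: le_trans (near n.+1 isT) _.
exact: le_trans (ler_norm _) h.
Qed.

End layers.

(** * Independence *)

Section indep.
Context {R : realType} d (T : measurableType d) (P : probability T R).

Lemma bigcap_nil (I : eqType) (E : I -> set T) :
  \bigcap_(i in [set` [::]]) E i = setT.
Proof. by apply/seteqP; split=> // w _ i. Qed.

Lemma bigcap_cons (I : eqType) i (s : seq I) (E : I -> set T) :
  \bigcap_(j in [set` i :: s]) E j = E i `&` \bigcap_(j in [set` s]) E j.
Proof.
apply/seteqP; split=> [w Ew|w [Ei Es] j].
  split; first by apply: Ew; rewrite /= mem_head.
  by move=> j js; apply: Ew; rewrite /= in_cons orbC js.
by rewrite /= in_cons => /predU1P[->|js]; [|exact: Es].
Qed.

Lemma prod_indic (I : eqType) (s : seq I) (E : I -> set T) (A : set T) w :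
  \prod_(i <- s) \1_(E i) w * \1_A w =
  \1_((\bigcap_(i in [set` s]) E i) `&` A) w :> R.
Proof.
elim: s => [|i s IH].
  by rewrite big_nil mul1r bigcap_nil setTI.
rewrite big_cons -mulrA IH bigcap_cons -setIA.
by rewrite [in RHS]indicI.
Qed.

Lemma measurable_bigcap_seq (I : eqType) (s : seq I) (E : I -> set T) :
  (forall i, i \in s -> measurable (E i)) ->
  measurable (\bigcap_(i in [set` s]) E i).
Proof.
elim: s => [|i s IH] mE; first by rewrite bigcap_nil.
rewrite bigcap_cons; apply: measurableI.
  by apply: mE; rewrite mem_head.
by apply: IH => j js; apply: mE; rewrite in_cons js orbT.
Qed.

Lemma ex_prod_indep (I : eqType) (s : seq I) (X : I -> T -> R) (A : set T) :
  uniq s -> measurable A -> (forall i, um (X i)) ->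
  (forall B : I -> set R, (forall i, measurable (B i)) ->
    P ((\bigcap_(i in [set` s]) X i @^-1` B i) `&` A) =
    (\prod_(i <- s) P (X i @^-1` B i) * P A)%E) ->
  ex P (fun w => \prod_(i <- s) X i w * \1_A w) =
  \prod_(i <- s) ex P (X i) * ex P \1_A.
Proof.
move=> us mA uX XA.
pose I_ (B : I -> set R) i : T -> R := \1_(X i @^-1` B i).
have mX (B : I -> set R) i : measurable (B i) -> measurable (X i @^-1` B i).
  by move=> mB; apply: measurable_preim => //; exact: (uX i).1.
have uI B i : measurable (B i) -> um (I_ B i).
  by move=> mB; apply: um_indic; exact: mX.
have XA' (B : I -> set R) : (forall i, measurable (B i)) ->
    ex P (fun w => \prod_(i <- s) I_ B i w * \1_A w) =
    \prod_(i <- s) ex P (I_ B i) * ex P \1_A.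
  move=> mB; rewrite (@eq_ex _ _ _ P _ (\1_((\bigcap_(i in [set` s]) X i @^-1` B i) `&` A))).
    rewrite ex_indic; last first.
      by apply: measurableI => //; apply: measurable_bigcap_seq => i _; exact: mX.
    rewrite XA//.
    rewrite (eq_bigr (fun i => (ex P (I_ B i))%:E)); last first.
      by move=> i _; apply: indic_fin; exact: mX.
    by rewrite (indic_fin P mA) prodEFin -EFinM/=.
  by move=> w; rewrite -prod_indic.
(* The indicators are replaced by the variables one at a time: the factors over [s1] are already
   variables, those over [s2] still indicators of arbitrary events. *)
suff main s1 s2 (B : I -> set R) : s = s1 ++ s2 -> (forall i, measurable (B i)) ->
    ex P (fun w => \prod_(i <- s1) X i w * (\prod_(i <- s2) I_ B i w * \1_A w)) =
    \prod_(i <- s1) ex P (X i) * (\prod_(i <- s2) ex P (I_ B i) * ex P \1_A).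
  have := main s [::] (fun=> setT); rewrite cats0 big_nil mul1r => <-//.
  by apply: eq_ex => w; rewrite big_nil mul1r.
elim/last_ind: s1 s2 B => [|s1 i IH] s2 B sE mB.
  rewrite /= in sE; rewrite big_nil mul1r -sE -XA'//.
  by apply: eq_ex => w; rewrite big_nil mul1r.
rewrite cat_rcons in sE.
pose G w := \prod_(i <- s1) X i w * (\prod_(i <- s2) I_ B i w * \1_A w).
have uG : um G.
  apply: umM; first exact: um_prod.
  apply: umM; last exact: um_indic.
  by apply: um_prod => j; exact: uI.
(* Only the set at [i] varies; as [i] is not in [s2], the remaining indicators do not see the
   change. *)
pose B' C j := if j == i then C else B j.
have i2 : i \notin s2.
  by move: us; rewrite sE cat_uniq /= => /and3P[_ _ /andP[]].
have mB' C : measurable C -> forall j, measurable (B' C j).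
  by move=> mC j; rewrite /B'; case: ifP.
have B'E C : (\prod_(j <- s2) ex P (I_ (B' C) j) = \prod_(j <- s2) ex P (I_ B j)) /\
    forall w, \prod_(j <- s2) I_ (B' C) j w = \prod_(j <- s2) I_ B j w.
  by split=> [|w]; rewrite !big_seq; apply: eq_bigr => j js;
    rewrite /I_ /B'; case: eqP => // ji; rewrite -ji js in i2.
have IH' C : measurable C -> ex P (fun w => \1_(X i @^-1` C) w * G w) =
    ex P \1_(X i @^-1` C) * (\prod_(i <- s1) ex P (X i) *
      (\prod_(i <- s2) ex P (I_ B i) * ex P \1_A)).
  move=> mC; have := IH _ (B' C) sE (mB' _ mC); rewrite big_cons (B'E C).1.
  have -> : ex P (I_ (B' C) i) = ex P \1_(X i @^-1` C) by rewrite /I_ /B' eqxx.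
  rewrite -[in RHS]mulrA mulrCA => <-; apply: eq_ex => w.
  have IBC : I_ (B' C) i w = \1_(X i @^-1` C) w by rewrite /I_ /B' eqxx.
  by rewrite big_cons (B'E C).2 IBC /G; ring.
have exG : ex P G = \prod_(i <- s1) ex P (X i) *
      (\prod_(i <- s2) ex P (I_ B i) * ex P \1_A).
  have := IH' setT measurableT; rewrite preimage_setT indicT ex_cst mul1r => <-.
  by apply: eq_ex => w; rewrite mul1r.
have := @ex_indepM _ _ _ P (X i) G (uX i) (um_bm uG).
rewrite -cats1 big_cat big_seq1/= => h.
rewrite [\prod_(j <- s1) ex P (X j) * _]mulrC -mulrA -exG -h.
- by apply: eq_ex => w; rewrite big_cat big_seq1/= /G; ring.
- by move=> w; case/andP: (uG.2 w).
- by move=> C mC; rewrite IH'// exG.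
Qed.

Lemma indep_ext (A : set T) (G : set (set T)) : measurable A ->
  setI_closed G -> G `<=` measurable ->
  (forall B, G B -> P (A `&` B) = (P A * P B)%E) ->
  forall B, <<s G >> B -> P (A `&` B) = (P A * P B)%E.
Proof.
move=> mA GI Gm GP B GB.
suff [] : measurable B /\ P (A `&` B) = (P A * P B)%E by [].
move: B GB; apply: g_sigma_ind => //.
- by move=> B GB; split; [exact: Gm|exact: GP].
- by rewrite setIT probability_setT mule1.
- move=> B [mB AB]; split; first exact: measurableC.
  rewrite -setDE measureD//; last by rewrite ltey_eq fin_num_measure.
  rewrite [X in (_ - X)%E]AB probability_setC// muleBr ?mule1//; exact: fin_num_measure.
- move=> F tF mF; split; first by apply: bigcupT_measurable => n; exact: (mF n).1.
  rewrite setI_bigcupr measure_bigcup//; last 2 first.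
  + by move=> n _; apply: measurableI => //; exact: (mF n).1.
  + exact: trivIset_setIl.
  rewrite measure_bigcup//; last by move=> n _; exact: (mF n).1.
  rewrite (indic_fin P mA) -nneseriesZl//.
  by apply: eq_eseriesr => n _; rewrite -(indic_fin P mA); exact: (mF n).2.
Qed.

Lemma indep_gen (G1 G2 : set (set T)) :
  setI_closed G1 -> setI_closed G2 ->
  G1 `<=` measurable -> G2 `<=` measurable ->
  indep_systems P G1 G2 -> indep_systems P <<s G1 >> <<s G2 >>.
Proof.
move=> I1 I2 m1 m2 G12 A B GA GB.
have mA : measurable A by apply: (smallest_sub _ m1) GA; exact: sigma_algebra_measurable.
have mB : measurable B by apply: (smallest_sub _ m2) GB; exact: sigma_algebra_measurable.
rewrite setIC muleC; apply: (indep_ext mB I1 m1) GA => A' GA'.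
rewrite setIC muleC; apply: (indep_ext (m1 _ GA') I2 m2) GB => B' GB'.
exact: G12.
Qed.

Section blocks.
Context d' (T' : measurableType d') (I : eqType).

(** The sets outside [s] are full, so that two cylinders can be rewritten over a common list of
    indices and intersected there. *)
Definition cylinders (B : set I) (V : I -> {RV P >-> T'}) : set (set T) :=
  [set E | exists (s : seq I) (A : I -> set T'),
    [/\ uniq s, [set` s] `<=` B, forall i, measurable (A i),
        forall i, i \notin s -> A i = setT &
        E = \bigcap_(i in [set` s]) V i @^-1` A i]].

Lemma cylinders_measurable B V : cylinders B V `<=` measurable.
Proof.
move=> _ [s [A [us sB mA AT ->]]]; apply: measurable_bigcap_seq => i _.
by apply: measurable_preim => //; exact: mA.
Qed.

Lemma bigcap_seq_sub (s t : seq I) (E : I -> set T) :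
  {subset s <= t} -> (forall i, i \notin s -> E i = setT) ->
  \bigcap_(i in [set` s]) E i = \bigcap_(i in [set` t]) E i.
Proof.
move=> st ET; apply/seteqP; split=> w Ew i /= it.
  by have [/Ew//|/ET ->] := boolP (i \in s).
by apply: Ew; exact: st.
Qed.

Lemma cylindersI B V : setI_closed (cylinders B V).
Proof.
move=> _ _ [s [A [us sB mA AT ->]]] [s' [A' [us' sB' mA' AT' ->]]].
exists (undup (s ++ s')), (fun i => A i `&` A' i); split.
- exact: undup_uniq.
- by move=> i /=; rewrite mem_undup mem_cat => /orP[/sB|/sB'].
- by move=> i; exact: measurableI.
- move=> i; rewrite mem_undup mem_cat negb_or => /andP[iS iS'].
  by rewrite AT// AT'// setIT.
- rewrite (@bigcap_seq_sub s (undup (s ++ s'))); last 2 first.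
  + by move=> i si; rewrite mem_undup mem_cat si.
  + by move=> i /AT ->.
  rewrite (@bigcap_seq_sub s' (undup (s ++ s'))); last 2 first.
  + by move=> i si; rewrite mem_undup mem_cat si orbT.
  + by move=> i /AT' ->.
  by rewrite -bigcapI.
Qed.

Lemma sigma_family_cylinders B V : sigma_family B V `<=` <<s cylinders B V >>.
Proof.
apply: smallest_sub; first exact: smallest_sigma_algebra.
move=> _ [i Bi [A mA <-]]; apply: sub_sigma_algebra.
exists [:: i], (fun j => if j == i then A else setT); split => //.
- by move=> j /=; rewrite mem_seq1 => /eqP ->.
- by move=> j; case: ifP.
- by move=> j; rewrite mem_seq1 => /negbTE ->.
- by rewrite bigcap_cons bigcap_nil setIT setTI eqxx.
Qed.

Lemma sigma_family_sub (B B' : set I) (V : I -> {RV P >-> T'}) :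
  B `<=` B' -> sigma_family B V `<=` sigma_family B' V.
Proof.
move=> BB'; apply: smallest_sub; first exact: smallest_sigma_algebra.
by move=> A [i Bi VA]; apply: sub_sigma_algebra; exists i => //; exact: BB'.
Qed.

Lemma sigma_family_measurable (B : set I) (V : I -> {RV P >-> T'}) :
  sigma_family B V `<=` measurable.
Proof.
apply: smallest_sub; first exact: sigma_algebra_measurable.
by move=> _ [i _ [A mA <-]]; rewrite setTI; exact: measurable_preim.
Qed.

Lemma mutually_indep_cat (D : set I) (V : I -> {RV P >-> T'}) (s t : seq I)
    (A A' : I -> set T') :
  mutually_indep D V -> uniq (s ++ t) -> [set` s ++ t] `<=` D ->
  (forall i, measurable (A i)) -> (forall i, measurable (A' i)) ->
  P ((\bigcap_(i in [set` s]) V i @^-1` A i) `&`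
     (\bigcap_(i in [set` t]) V i @^-1` A' i)) =
  (P (\bigcap_(i in [set` s]) V i @^-1` A i) *
   P (\bigcap_(i in [set` t]) V i @^-1` A' i))%E.
Proof.
move=> VD ust stD mA mA'.
have [us [st ut]] : uniq s /\ ~~ has [in s] t /\ uniq t.
  by move: ust; rewrite cat_uniq => /and3P[].
pose C i := if i \in s then A i else A' i.
have Ct i : i \in t -> C i = A' i.
  move=> it; rewrite /C; case: ifPn => // si; by have /hasPn/(_ _ it)/negP := st.
have EE : (\bigcap_(i in [set` s]) V i @^-1` A i) `&`
     (\bigcap_(i in [set` t]) V i @^-1` A' i) =
     \bigcap_(i in [set` s ++ t]) V i @^-1` C i.
  apply/seteqP; split=> [w [ws wt] i|w wst].
    rewrite /= mem_cat => /orP[si|ti]; first by rewrite /C si; exact: ws.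
    by rewrite Ct//; exact: wt.
  split=> i /= si; last first.
    by have := wst i; rewrite /= Ct//; apply; rewrite mem_cat si orbT.
  by have := wst i; rewrite /= /C si; apply; rewrite mem_cat si.
rewrite EE !VD//.
- rewrite big_cat/=; congr (_ * _)%E; rewrite !big_seq; apply: eq_bigr => i si.
    by rewrite /C si.
  by rewrite Ct.
- by move=> i /= it; apply: stD; rewrite /= mem_cat it orbT.
- by move=> i /= it; apply: stD; rewrite /= mem_cat it.
- by move=> i _; rewrite /C; case: ifP.
Qed.

Lemma indep_blocks (D B1 B2 : set I) (V : I -> {RV P >-> T'}) :
  mutually_indep D V -> B1 `<=` D -> B2 `<=` D ->
  (forall i, B1 i -> B2 i -> False) ->
  indep_systems P (sigma_family B1 V) (sigma_family B2 V).
Proof.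
(* Both blocks are generated by cylinders, and two cylinders over disjoint blocks form one cylinder
   of the whole family. *)
move=> VD B1D B2D B12 A B /sigma_family_cylinders sA /sigma_family_cylinders sB.
apply: (indep_gen _ _ _ _ _ sA sB); try exact: cylindersI;
  try exact: cylinders_measurable.
move=> _ _ [s [E [us sB1 mE ET ->]]] [t [E' [ut tB2 mE' ET' ->]]].
apply: (mutually_indep_cat VD) => //.
  rewrite cat_uniq us ut andbT/=; apply/hasPn => i it; apply/negP => si.
  by apply: (B12 i); [exact: sB1|exact: tB2].
by move=> i /=; rewrite mem_cat => /orP[/sB1/B1D|/tB2/B2D].
Qed.

(** Induction on [s], carrying along that the remaining intersection is an event of the union of the
    remaining blocks; splitting off one block is then the case of two blocks. [B0] is reserved for
    the past. *)
Lemma indep_many_blocks (J : eqType) (D B0 : set I) (B : J -> set I)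
    (V : I -> {RV P >-> T'}) (s : seq J) (A : set T) (E : J -> set T) :
  mutually_indep D V -> B0 `<=` D -> (forall j, B j `<=` D) ->
  (forall j i, j \in s -> B0 i -> B j i -> False) ->
  (forall j k i, j \in s -> k \in s -> B j i -> B k i -> j = k) ->
  uniq s -> sigma_family B0 V A ->
  (forall j, j \in s -> sigma_family (B j) V (E j)) ->
  P ((\bigcap_(j in [set` s]) E j) `&` A) = (\prod_(j <- s) P (E j) * P A)%E.
Proof.
move=> VD B0D BD B0B BB us sA.
suff main (t : seq J) : {subset t <= s} -> uniq t ->
    (forall j, j \in t -> sigma_family (B j) V (E j)) ->
    sigma_family (B0 `|` \bigcup_(j in [set` t]) B j) V
      ((\bigcap_(j in [set` t]) E j) `&` A) /\
    P ((\bigcap_(j in [set` t]) E j) `&` A) = (\prod_(j <- t) P (E j) * P A)%E.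
  by move=> /main []//.
elim: t => [|j t IH] ts ut sE.
  rewrite bigcap_nil setTI big_nil mul1e; split => //.
  by apply: sigma_family_sub sA; exact: subsetUl.
have [|||IH1 IH2] := IH.
- by move=> k kt; apply: ts; rewrite in_cons kt orbT.
- by move: ut => /= /andP[].
- by move=> k kt; apply: sE; rewrite in_cons kt orbT.
have sEj : sigma_family (B j) V (E j) by apply: sE; rewrite mem_head.
rewrite bigcap_cons -setIA; split.
  apply: (@measurableI _ (g_sigma_algebraType _)).
    apply: sigma_family_sub sEj => i Bji; right; exists j => //=.
    by rewrite mem_head.
  apply: sigma_family_sub IH1 => i [?|[k kt Bki]]; [by left|right].
  by exists k => //=; rewrite in_cons kt orbT.
rewrite big_cons -muleA -IH2.
apply: (indep_blocks VD (BD j) _ _ sEj IH1).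
  by move=> i [/B0D|[k _ /BD]].
move=> i Bji [B0i|[k /= kt Bki]].
  by apply: (B0B j i) => //; apply: ts; rewrite mem_head.
have kj : j = k.
  by apply: (BB _ _ i) => //; apply: ts; rewrite in_cons ?eqxx// kt orbT.
by move: ut; rewrite kj /= kt.
Qed.

End blocks.
End indep.

(** * Families of values with the product sigma-algebra *)

Section family_space.
Context (I : Type) d (L : measurableType d).

Definition fam_gen : set (set (I -> L)) :=
  \bigcup_i preimage_set_system setT (fun x : I -> L => x i) measurable.

Definition fam := g_sigma_algebraType fam_gen.

Lemma measurable_ev i : measurable_fun setT (fun x : fam => x i).
Proof.
by move=> _ A mA; apply: sub_sigma_algebra; exists i => //; exists A.
Qed.

Lemma measurable_fam d' (T : measurableType d') (f : T -> fam) :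
  (forall i, measurable_fun setT (fun w => f w i)) -> measurable_fun setT f.
Proof.
move=> mf; apply: (@measurability _ _ T fam setT f fam_gen) => //.
move=> _ [_ [i _ [A mA <-]] <-]; rewrite !setTI.
exact: measurable_preim (mf i) mA.
Qed.

End family_space.

(** Used with [h] the embedding of a subtree or of a row of coins: whatever is computed from it is
    an event of the corresponding block. *)
Lemma sigma_family_fam {R : realType} d (T : measurableType d)
    (P : probability T R) d' (T' : measurableType d') (I K : Type) (B : set I)
    (V : I -> {RV P >-> T'}) (h : K -> I) (E : set (fam K T')) :
  (forall k, B (h k)) -> measurable E ->
  sigma_family B V ((fun w k => V (h k) w) @^-1` E).
Proof.
move=> hB; rewrite -[sigma_family _ _ _]/([set E | sigma_family B V ((fun w k => V (h k) w) @^-1` E)] E).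
move: E; apply: smallest_sub.
  split.
  - rewrite /= preimage_set0; exact: sigma_algebra0.
  - move=> A sA; rewrite setTD /= preimage_setC; exact: sigma_algebraC.
  - move=> F sF; rewrite /= preimage_bigcup; exact: sigma_algebra_bigcup.
move=> _ [k _ [A mA <-]] /=; apply: sub_sigma_algebra.
by exists (h k) => //; exists A => //; rewrite !setTI.
Qed.

(** * Products over an extended number of factors *)

Definition xlt (i : nat) (n : xnat) : bool := if n is Some k then (i < k)%N else true.

Section xprod.
Context {R : realType}.
Implicit Types (x y : nat -> R) (n : xnat).

(** Setting the missing factors to 1 treats finite and infinite [n] alike; in both cases these
    products converge to [xprod n x]. *)
Definition xpartial n x (m : nat) : R := \prod_(i < m) (if xlt i n then x i else 1).

Lemma xpartial_Some (k m : nat) x : (k <= m)%N ->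
  xpartial (Some k) x m = \prod_(i < k) x i.
Proof.
move=> km; rewrite /xpartial [RHS](big_ord_widen _ (fun i => x i) km).
by rewrite [RHS]big_mkcond; apply: eq_bigr.
Qed.

Lemma xpartial01 n x m : (forall i, 0 <= x i <= 1) -> 0 <= xpartial n x m <= 1.
Proof.
move=> x01; rewrite /xpartial; elim: m => [|m IH].
  by rewrite big_ord0 ler01 lexx.
rewrite big_ord_recr/=; have /andP[? ?] := IH; case: ifP => _.
  by have /andP[? ?] := x01 m; rewrite mulr_ge0//= mulr_ile1.
by rewrite mulr1.
Qed.

Lemma xpartial_cvg n x : (forall i, 0 <= x i <= 1) ->
  xpartial n x @ \oo --> xprod n x.
Proof.
move=> x01; case: n => [k|] /=.
  apply: cvg_near_cst; exists k => // m km.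
  by rewrite /= xpartial_Some.
rewrite (_ : xpartial None x = fun m => \prod_(i < m) x i)//.
apply: nonincreasing_is_cvgn.
  apply/nonincreasing_seqP => m; rewrite big_ord_recr/=.
  have /andP[? ?] := x01 m; rewrite -[leRHS]mulr1 ler_wpM2l//.
  by have /andP[] := @xpartial01 None x m x01.
exists 0 => _ [m _ <-]; by have /andP[] := @xpartial01 None x m x01.
Qed.

(** This makes the mixed moment of two solutions driven by the same family sizes computable: the
    product of two products over the daughters is again one product over the daughters. *)
Lemma xprodM n x y : (forall i, 0 <= x i <= 1) -> (forall i, 0 <= y i <= 1) ->
  xprod n (fun i => x i * y i) = xprod n x * xprod n y.
Proof.
move=> x01 y01; have xy01 i : 0 <= x i * y i <= 1.
  have /andP[? ?] := x01 i; have /andP[? ?] := y01 i.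
  by rewrite mulr_ge0//= mulr_ile1.
have cx := @xpartial_cvg n _ x01; have cy := @xpartial_cvg n _ y01.
have cxy := @xpartial_cvg n _ xy01.
apply: (cvg_unique _ cxy) => //.
rewrite (_ : xpartial n _ = fun m => xpartial n x m * xpartial n y m).
  exact: cvgM.
apply/funext => m; rewrite /xpartial -big_split; apply: eq_bigr => i _ /=.
by case: ifP => //; rewrite mulr1.
Qed.

Lemma eq_xprod n x y : (forall i, xlt i n -> x i = y i) ->
  xprod n x = xprod n y.
Proof.
case: n => [k|] xy /=; first by apply: eq_bigr => i _; apply: xy => /=.
by congr (limn _); apply/funext => k; apply: eq_bigr => i _; exact: xy.
Qed.

Lemma xprod_cst n (c : R) : 0 <= c <= 1 -> xprod n (fun=> c) = xpow c n.
Proof.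
move=> c01; case: n => [k|] /=; first by rewrite prodr_const card_ord.
under eq_fun do rewrite prodr_const card_ord.
case: eqP => [->|/eqP c1].
  by under eq_fun do rewrite expr1n; exact: lim_cst.
apply/cvg_lim => //; apply: cvg_expr; have /andP[? ?] := c01.
by rewrite ger0_norm// lt_neqAle c1.
Qed.

Context d (T : measurableType d).

Lemma um_xpartial (N : T -> xnat) (Z : nat -> T -> R) m :
  measurable_fun setT N -> (forall i, um (Z i)) ->
  um (fun w => xpartial (N w) (Z^~ w) m).
Proof.
move=> mN uZ; split; last by move=> w; apply: xpartial01 => i; exact: (uZ i).2.
apply: (um_prod _ _).1 => i; split; last first.
  by move=> w; case: ifP => _; rewrite ?ler01 ?lexx//; exact: (uZ i).2.
apply: measurable_fun_ifT => //; first exact: measurableT_comp.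
exact: (uZ i).1.
Qed.

Lemma um_xprod (N : T -> xnat) (Z : nat -> T -> R) :
  measurable_fun setT N -> (forall i, um (Z i)) ->
  um (fun w => xprod (N w) (Z^~ w)).
Proof.
move=> mN uZ; apply: (@um_lim _ _ _ (fun m w => xpartial (N w) (Z^~ w) m)).
  by move=> m; exact: um_xpartial.
by move=> w; apply: xpartial_cvg => i; exact: (uZ i).2.
Qed.

End xprod.

(** * Equality of conditional product moments *)

Section step.
Context {R : realType} d (T : measurableType d) (P : probability T R).
Variable G : set (set T).
Hypothesis Gm : G `<=` measurable.

(** Products of the Z and of the W over distinct vertices of D have the same conditional expectation
    given G. Single vertices would not do, since the next step multiplies over daughters. *)
Definition agree (V : eqType) (D : pred V) (Z W : V -> T -> R) : Prop :=
  forall (s : seq V) (A : set T), uniq s -> all D s -> G A ->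
    ex P (fun w => \prod_(v <- s) Z v w * \1_A w) =
    ex P (fun w => \prod_(v <- s) W v w * \1_A w).

Lemma agreeC (V : eqType) (D : pred V) Z W :
  (forall v, um (Z v)) -> (forall v, um (W v)) ->
  agree D Z W -> agree D (fun v w => 1 - Z v w) (fun v w => 1 - W v w).
Proof.
move=> uZ uW ZW.
(* The complements are expanded one at a time: writing out 1 - Z v gives one expectation with v
   dropped and one with v moved from [s] to [t]. *)
suff main (s t : seq V) A : uniq (s ++ t) -> all D (s ++ t) -> G A ->
    ex P (fun w => \prod_(v <- s) (1 - Z v w) * (\prod_(v <- t) Z v w * \1_A w)) =
    ex P (fun w => \prod_(v <- s) (1 - W v w) * (\prod_(v <- t) W v w * \1_A w)).
  move=> s A us Ds GA; have := main s [::] A; rewrite cats0 => /(_ us Ds GA).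
  have one (Y : V -> T -> R) : (fun w => \prod_(v <- s) (1 - Y v w) * (\prod_(v <- [::]) Y v w * \1_A w))
      = (fun w => \prod_(v <- s) (1 - Y v w) * \1_A w).
    by apply/funext => w; rewrite big_nil mul1r.
  by rewrite !one.
elim: s t => [|v s IH] t.
  move=> ut Dt GA; have := ZW t A ut Dt GA.
  have one (Y : V -> T -> R) : (fun w => \prod_(v <- [::]) (1 - Y v w) * (\prod_(v <- t) Y v w * \1_A w))
      = (fun w => \prod_(v <- t) Y v w * \1_A w).
    by apply/funext => w; rewrite big_nil mul1r.
  by rewrite !one.
rewrite cat_cons => ust Dst GA.
have perm : perm_eq (v :: s ++ t) (s ++ v :: t) by exact: permEl (perm_catCA [:: v] _ t).
have ust' : uniq (s ++ t) by case/andP: ust.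
have Dst' : all D (s ++ t) by case/andP: Dst.
have h1 := IH t ust' Dst' GA.
have h2 : _ := IH (v :: t).
rewrite -(perm_uniq perm) -(perm_all _ perm) in h2; move/(_ ust Dst GA) in h2.
have um1 (Y : V -> T -> R) (t' : seq V) : (forall v, um (Y v)) ->
    um (fun w => \prod_(v <- s) (1 - Y v w) * (\prod_(v <- t') Y v w * \1_A w)).
  move=> uY; apply: umM; first by apply: um_prod => i; exact: umC.
  by apply: umM; [exact: um_prod|exact/um_indic/Gm].
have split (Y : V -> T -> R) : (forall v, um (Y v)) ->
   ex P (fun w => \prod_(v <- v :: s) (1 - Y v w) * (\prod_(v <- t) Y v w * \1_A w)) =
   ex P (fun w => \prod_(v <- s) (1 - Y v w) * (\prod_(v <- t) Y v w * \1_A w)) -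
   ex P (fun w => \prod_(v <- s) (1 - Y v w) * (\prod_(v <- v :: t) Y v w * \1_A w)).
  move=> uY; rewrite -exB; try exact/um_bm/um1.
  by apply: eq_ex => w; rewrite !big_cons; ring.
by rewrite !split// h1 h2.
Qed.

(** The factor of a daughter is its value or 1, according to an event of the mother's family size.
    Stability of G under cutting by such events reduces everything to products of values, and
    injectivity of [c] keeps their vertices distinct. *)
Lemma agree_step (U V : eqType) (DU : pred U) (DV : pred V)
    (c : U -> nat -> V) (N : U -> T -> xnat) (Z W : V -> T -> R) :
  (forall u i u' i', c u i = c u' i' -> u = u' /\ i = i') ->
  (forall u i, DU u -> DV (c u i)) ->
  (forall u, measurable_fun setT (N u)) ->
  (forall u A B, DU u -> G A -> G (A `&` N u @^-1` B)) ->
  (forall v, um (Z v)) -> (forall v, um (W v)) ->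
  agree DV Z W ->
  agree DU (fun u w => xprod (N u w) (fun i => Z (c u i) w))
           (fun u w => xprod (N u w) (fun i => W (c u i) w)).
Proof.
move=> cI DUV mN GN uZ uW ZW.
pose F (Y : V -> T -> R) (p : U * nat) w :=
  if xlt p.2 (N p.1 w) then Y (c p.1 p.2) w else 1.
have uF Y p : (forall v, um (Y v)) -> um (F Y p).
  move=> uY; split; last first.
    by move=> w; rewrite /F; case: ifP => _; rewrite ?ler01 ?lexx//; exact: (uY _).2.
  apply: measurable_fun_ifT => //; last exact: (uY _).1.
  exact: (@measurableT_comp _ _ _ _ _ _ (xlt p.2)).
have main (ps : seq (U * nat)) (t : seq V) A :
    uniq (map (fun p => c p.1 p.2) ps ++ t) -> all (fun p => DU p.1) ps ->
    all DV t -> G A ->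
    ex P (fun w => \prod_(p <- ps) F Z p w * (\prod_(v <- t) Z v w * \1_A w)) =
    ex P (fun w => \prod_(p <- ps) F W p w * (\prod_(v <- t) W v w * \1_A w)).
  elim: ps t A => [|p ps IH] t A.
    move=> ut _ Dt GA; have := ZW t A ut Dt GA.
    have one (Y : V -> T -> R) : (fun w => \prod_(p <- [::]) F Y p w * (\prod_(v <- t) Y v w * \1_A w))
        = (fun w => \prod_(v <- t) Y v w * \1_A w).
      by apply/funext => w; rewrite big_nil mul1r.
    by rewrite !one.
  rewrite map_cons cat_cons => upt /andP[Dp Dps] Dt GA.
  pose v := c p.1 p.2.
  have perm : perm_eq (v :: map (fun p => c p.1 p.2) ps ++ t)
      (map (fun p => c p.1 p.2) ps ++ v :: t) by exact: permEl (perm_catCA [:: v] _ t).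
  (* On [A1] the daughter exists and its factor is the value at [v], which joins [t]; on [A2] the
     factor is 1. *)
  pose A1 := A `&` N p.1 @^-1` [set n | xlt p.2 n].
  pose A2 := A `&` N p.1 @^-1` [set n | ~~ xlt p.2 n].
  have GA1 : G A1 by exact: GN.
  have GA2 : G A2 by exact: GN.
  have h1 := IH (v :: t) A1; rewrite -(perm_uniq perm) in h1.
  have {}h1 := h1 upt Dps _ GA1.
  have h2 := IH t A2 _ Dps Dt GA2.
  have um1 (Y : V -> T -> R) (t' : seq V) A' : (forall v, um (Y v)) -> G A' ->
      um (fun w => \prod_(p <- ps) F Y p w * (\prod_(v <- t') Y v w * \1_A' w)).
    move=> uY GA'; apply: umM; first by apply: um_prod => i; exact: uF.
    by apply: umM; [exact: um_prod|exact/um_indic/Gm].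
  have split (Y : V -> T -> R) : (forall v, um (Y v)) ->
     ex P (fun w => \prod_(p <- p :: ps) F Y p w * (\prod_(v <- t) Y v w * \1_A w)) =
     ex P (fun w => \prod_(p <- ps) F Y p w * (\prod_(v <- v :: t) Y v w * \1_A1 w)) +
     ex P (fun w => \prod_(p <- ps) F Y p w * (\prod_(v <- t) Y v w * \1_A2 w)).
    move=> uY; rewrite -exD; try exact/um_bm/um1.
    have A1E w : \1_A1 w = (xlt p.2 (N p.1 w))%:R * \1_A w :> R.
      by rewrite /A1 setIC indicIE; congr (_ * _); exact: indicPE.
    have A2E w : \1_A2 w = (~~ xlt p.2 (N p.1 w))%:R * \1_A w :> R.
      by rewrite /A2 setIC indicIE; congr (_ * _); exact: indicPE.
    apply: eq_ex => w; rewrite !big_cons A1E A2E.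
    have -> : F Y p w = if xlt p.2 (N p.1 w) then Y v w else 1 by [].
    by case: (xlt _ _) => /=; ring.
  rewrite !split// h1 ?h2//; first by case/andP: upt.
  by rewrite /= DUV.
move=> s A us Ds GA.
(* Truncated products, to which [main] applies; dominated convergence removes the truncation. *)
pose Fm (Y : V -> T -> R) m w :=
  \prod_(u <- s) xpartial (N u w) (fun i => Y (c u i) w) m * \1_A w.
have uFm Y m : (forall v, um (Y v)) -> um (Fm Y m).
  move=> uY; apply: umM; last exact/um_indic/Gm.
  by apply: um_prod => u; apply: um_xpartial.
have cvgF Y : (forall v, um (Y v)) ->
    ex P (Fm Y m) @[m --> \oo] -->
    ex P (fun w => \prod_(u <- s) xprod (N u w) (fun i => Y (c u i) w) * \1_A w).
  move=> uY; apply: (@ex_cvg _ _ _ _ _ _ 1).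
  - by move=> m; exact: (uFm Y m uY).1.
  - apply: (umM _ _).1; last exact/um_indic/Gm.
    by apply: um_prod => u; apply: um_xprod.
  - by move=> m w; have /andP[? ?] := (uFm Y m uY).2 w; rewrite ger0_norm.
  - apply: aeW => w; apply: cvgMl.
    have : forall u, xpartial (N u w) (fun i => Y (c u i) w) m @[m --> \oo] -->
        xprod (N u w) (fun i => Y (c u i) w).
      by move=> u; apply: xpartial_cvg => i; exact: (uY _).2.
    move=> cu; elim: (s) => [|u s' IH].
      by rewrite big_nil; under eq_fun do rewrite big_nil; exact: cvg_cst.
    by rewrite big_cons; under eq_fun do rewrite big_cons; exact: cvgM.
apply: (cvg_unique _ (cvgF Z uZ)) => //.
rewrite (_ : (fun m => ex P (Fm Z m)) = (fun m => ex P (Fm W m))); first exact: cvgF.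
apply/funext => m.
pose ps := [seq (u, i) | u <- s, i <- iota 0 m].
have psE (Y : V -> T -> R) :
    Fm Y m = (fun w => \prod_(p <- ps) F Y p w * (\prod_(v <- [::]) Y v w * \1_A w)).
  apply/funext => w; rewrite /Fm big_nil mul1r /ps big_allpairs_dep; congr (_ * _).
  apply: eq_bigr => u _; rewrite /xpartial
    -(big_mkord xpredT (fun i => if xlt i (N u w) then Y (c u i) w else 1)).
  by rewrite /index_iota subn0.
rewrite !psE; apply: main => //.
- rewrite cats0 map_inj_uniq; last by move=> [u i] [u' i'] /= /cI [-> ->].
  by apply: allpairs_uniq => //; [exact: iota_uniq|move=> [] ? ? [] ? ? /=].
- by apply/allP => _ /allpairsP[[u i] /= [us' _ ->]] /=; exact: (allP Ds).
Qed.

End step.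

(** * The generating function *)

Section derivatives.
Context {R : realType}.
Implicit Types (g : R -> R) (p l : R).

(** Differentiability with derivative l, free of division so that the chain rule has no special case
    where g x = g p. *)
Definition slope_at g p l := forall e : R, 0 < e -> exists2 d : R, 0 < d &
  forall x, `|x - p| < d -> `|g x - g p - l * (x - p)| <= e * `|x - p|.

Lemma slope_at_opp g p l : slope_at g p l -> slope_at (fun t => 1 - g t) p (- l).
Proof.
move=> gl e e0; have [d d0 gd] := gl e e0; exists d => // x /gd.
by rewrite -normrN; congr (`|_| <= _); ring.
Qed.

Lemma slope_at_comp g h p a b : slope_at g p a -> slope_at h (g p) b ->
  slope_at (h \o g) p (b * a).
Proof.
move=> ga hb e e0.
pose c : R := `|a| + 1.
have c0 : 0 < c by rewrite ltr_wpDl.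
have [d1 d10 h1] := hb (e / (2 * c)) (divr_gt0 e0 (mulr_gt0 (ltr0Sn R 1) c0)).
(* The bound by 1 makes [c] a Lipschitz constant of g at p; the other bound makes b times the error
   of g at most half of e |x - p|. *)
pose e' : R := Num.min 1 (e / (2 * (`|b| + 1))).
have b0 : 0 < `|b| + 1 by rewrite ltr_wpDl.
have e'0 : 0 < e'.
  by rewrite lt_min ltr01 divr_gt0// mulr_gt0.
have [d2 d20 h2] := ga e' e'0.
exists (Num.min d2 (d1 / c)); first by rewrite lt_min d20 divr_gt0.
move=> x; rewrite lt_min => /andP[xd2 xd1].
have g1 := h2 x xd2.
have gc : `|g x - g p| <= c * `|x - p|.
  have -> : g x - g p = (g x - g p - a * (x - p)) + a * (x - p) by ring.
  apply: (le_trans (ler_normD _ _)); rewrite normrM /c mulrDl addrC lerD2l.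
  apply: (le_trans g1); rewrite ler_wpM2r//.
  by rewrite /e' ge_min lexx.
have gd1 : `|g x - g p| < d1.
  by apply: (le_lt_trans gc); rewrite mulrC -ltr_pdivlMr.
have g3 := h1 _ gd1.
rewrite /=.
have -> : h (g x) - h (g p) - b * a * (x - p) =
    (h (g x) - h (g p) - b * (g x - g p)) + b * (g x - g p - a * (x - p)) by ring.
apply: (le_trans (ler_normD _ _)); rewrite normrM.
have t1 : `|h (g x) - h (g p) - b * (g x - g p)| <= e / 2 * `|x - p|.
  apply: (le_trans g3); apply: (@le_trans _ _ (e / (2 * c) * (c * `|x - p|))).
    by rewrite ler_wpM2l// divr_ge0// ?(ltW e0)// mulr_ge0// ltW.
  rewrite mulrA ler_wpM2r// le_eqVlt; apply/orP; left; apply/eqP.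
  by field; rewrite lt0r_neq0.
have t2 : `|b| * `|g x - g p - a * (x - p)| <= e / 2 * `|x - p|.
  apply: (@le_trans _ _ (`|b| * (e' * `|x - p|))); first by rewrite ler_wpM2l.
  rewrite mulrA ler_wpM2r//.
  apply: (@le_trans _ _ ((`|b| + 1) * (e / (2 * (`|b| + 1))))).
    apply: ler_pM => //; [exact: ltW|by rewrite lerDl|].
    by rewrite /e' ge_min lexx orbT.
  rewrite le_eqVlt; apply/orP; left; apply/eqP.
  by field; rewrite lt0r_neq0.
by apply: (le_trans (lerD t1 t2)); rewrite -mulrDl -splitr.
Qed.

Lemma deriv01_slope g p l : 0 < p < 1 -> slope_at g p l ->
  deriv01 g p = l%:E.
Proof.
move=> /andP[p0 p1] gl; rewrite /deriv01.
(* At an interior point the restriction to [0, 1] does not change the punctured neighbourhoods. *)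
have -> : within [set` `[0, 1]] p^' = p^'.
  apply/seteqP; split=> A pA; last by apply: filterS pA => x Ax _.
  have p01 : \forall x \near p^', x \in `[0, 1].
    apply: nbhs_dnbhs; exists (Num.min p (1 - p)) => /=.
      by rewrite lt_min p0 subr_gt0.
    move=> x /=; rewrite lt_min ltr_norml ltr_norml in_itv/= => /andP[/andP[? ?] /andP[? ?]].
    by apply/andP; split; lra.
  have pA' : \forall x \near p^', x \in `[0, 1] -> A x := pA.
  by apply: filterS2 p01 pA' => x /[swap]; apply.
apply/cvg_lim => //; apply: cvg_EFin; first exact: nearW.
apply/cvgrPdist_le => e e0.
have [d d0 gd] := gl e e0.
exists d => //= x /= xd xp.
have xp0 : x - p != 0 by rewrite subr_eq0.
have -> : l - (g x - g p) / (x - p) = - (g x - g p - l * (x - p)) / (x - p).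
  by field.
rewrite normrM normrN normfV ler_pdivrMr ?normr_gt0//.
by apply: gd; rewrite distrC.
Qed.

End derivatives.

Section pgf.
Context {R : realType} d0 (T0 : measurableType d0) (P0 : probability T0 R)
  (N : {RV P0 >-> xnat}).
Hypothesis N0 : forall w, N w <> Some 0%N.
Local Notation H := (pgf N).

Lemma xpow01 (s : R) n : 0 <= s <= 1 -> 0 <= xpow s n <= 1.
Proof.
move=> /andP[s0 s1]; case: n => [k|] /=; last by case: ifP; rewrite ?ler01 lexx.
by rewrite exprn_ge0// exprn_ile1.
Qed.

Lemma um_xpow d (T : measurableType d) (M : T -> xnat) (s : R) :
  measurable_fun setT M -> 0 <= s <= 1 -> um (fun w => xpow s (M w)).
Proof.
move=> mM s01; split; last by move=> w; exact: xpow01.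
exact: (@measurableT_comp _ _ _ _ _ _ (xpow s)).
Qed.

Lemma pgfE s : H s = ex P0 (fun w => xpow s (N w)).
Proof. by rewrite /pgf unlock. Qed.

Lemma pgf_le s t : 0 <= s -> s <= t -> t <= 1 -> H s <= H t.
Proof.
move=> s0 st t1.
have t0 : 0 <= t by exact: le_trans st.
have s1 : s <= 1 by exact: le_trans t1.
rewrite !pgfE; apply: ex_le => [||w]; try by apply/um_bm/um_xpow => //; apply/andP.
case: (N w) => [k|] /=; first by rewrite lerXn2r.
case: (eqVneq s 1) => [s1'|_]; last by case: ifP.
by rewrite (_ : t == 1)//; apply/eqP/le_anti; rewrite t1 -s1' st.
Qed.

Lemma pgf1 : H 1 = 1.
Proof.
rewrite pgfE -[RHS](ex_cst P0); apply: eq_ex => w.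
by case: (N w) => [k|] /=; rewrite ?expr1n ?eqxx.
Qed.

Lemma pgf0 : H 0 = 0.
Proof.
rewrite pgfE -[RHS](ex_cst P0); apply: eq_ex => w.
have := @N0 w; case: (N w) => [[|k]|] //= _; first by rewrite expr0n.
by rewrite eq_sym oner_eq0.
Qed.

(** Jensen for the variable s^N; it keeps the iterates of the moment map above mup^2. *)
Lemma pgf_sq s : 0 <= s <= 1 -> H s ^+ 2 <= H (s ^+ 2).
Proof.
move=> s01; have s201 : 0 <= s ^+ 2 <= 1.
  by have /andP[? ?] := s01; rewrite sqr_ge0 exprn_ile1.
rewrite !pgfE; apply: (le_trans (sq_ex_le _ (um_bm (um_xpow _ s01)))) => //.
rewrite le_eqVlt; apply/orP; left; apply/eqP/eq_ex => w.
case: (N w) => [k|] /=; first by rewrite -!exprM mulnC.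
have /andP[s0 s1] := s01.
rewrite (_ : (s ^+ 2 == 1) = (s == 1)); first by case: ifP; rewrite ?expr1n ?expr0n.
by rewrite sqrp_eq1.
Qed.

Definition dpow (s : R) (n : xnat) : R :=
  if n is Some k then k%:R * s ^+ k.-1 else 0.

(** The bound is uniform in k, so that E[N s^(N-1); N finite] exists at every s < 1 even if N has no
    mean. *)
Lemma dpow_bound (s r : R) k : 0 <= s -> s <= r -> r < 1 ->
  0 <= k%:R * s ^+ k.-1 <= (1 - r)^-1.
Proof.
move=> s0 sr r1; have r0 : 0 <= r by exact: le_trans sr.
rewrite mulr_ge0 ?ler0n ?exprn_ge0//=.
have q0 : 0 < 1 - r by rewrite subr_gt0.
rewrite -(ler_pM2r q0) mulVf ?lt0r_neq0//.
apply: (@le_trans _ _ (k%:R * r ^+ k.-1 * (1 - r))).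
  by rewrite ler_wpM2r ?(ltW q0)// ler_wpM2l ?ler0n// lerXn2r.
case: k => [|k] /=; first by rewrite !mul0r.
have rk j : 0 <= r ^+ j <= 1 by rewrite exprn_ge0//= exprn_ile1// ltW.
(* Each of the k + 1 terms of the geometric sum (1 - r^(k+1)) / (1 - r) is at least r^k. *)
suff : k.+1%:R * r ^+ k * (1 - r) <= 1 - r ^+ k.+1 by have := rk k.+1; lra.
elim: k => [|k IH]; first by rewrite expr0 expr1 !mul1r.
have -> : k.+2%:R * r ^+ k.+1 * (1 - r) =
    r * (k.+1%:R * r ^+ k * (1 - r)) + r ^+ k.+1 * (1 - r).
  by rewrite -[k.+2%:R]natr1 !exprS; ring.
apply: (le_trans (lerD (ler_wpM2l r0 IH) (lexx _))).
rewrite (exprS r k.+1); have := rk k.+1; nra.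
Qed.

Lemma bm_dpow d (T : measurableType d) (M : T -> xnat) (s : R) :
  measurable_fun setT M -> 0 <= s < 1 -> bm (fun w => dpow s (M w)).
Proof.
move=> mM /andP[s0 s1]; split.
  exact: (@measurableT_comp _ _ _ _ _ _ (dpow s)).
exists (1 - s)^-1 => w; case: (M w) => [k|] /=.
  by have /andP[? ?] := dpow_bound k s0 (lexx s) s1; rewrite ger0_norm.
by rewrite normr0 invr_ge0 subr_ge0 ltW.
Qed.

(** First-order expansion with a remainder uniform in the exponent, so that it can be integrated
    over N; the lower bound is the convexity of each power. *)
Lemma xpow_tangent (x p r : R) n : 0 <= x -> x <= r -> 0 <= p -> p <= r -> r < 1 ->
  0 <= xpow x n - xpow p n - dpow p n * (x - p) <= (1 - r)^-1 ^+ 2 * (x - p) ^+ 2.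
Proof.
move=> x0 xr p0 pr r1.
have c0 : 0 <= (1 - r)^-1 ^+ 2 * (x - p) ^+ 2 by rewrite mulr_ge0 ?sqr_ge0.
case: n => [k|] /=; last first.
  have x1 : x == 1 = false by apply/negbTE; rewrite lt_eqF// (le_lt_trans xr).
  have p1 : p == 1 = false by apply/negbTE; rewrite lt_eqF// (le_lt_trans pr).
  by rewrite x1 p1 mul0r !subr0 lexx.
have q0 : 0 < 1 - r by rewrite subr_gt0.
elim: k => [|k IH]; first by rewrite !expr0 !mul0r subrr subr0 lexx.
have -> : x ^+ k.+1 - p ^+ k.+1 - k.+1%:R * p ^+ k.+1.-1 * (x - p) =
   x * (x ^+ k - p ^+ k - k%:R * p ^+ k.-1 * (x - p)) +
   k%:R * p ^+ k.-1 * (x - p) ^+ 2.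
  by case: k {IH} => [|k]; rewrite /= -?[k.+2%:R]natr1 !exprS ?expr0; ring.
have /andP[IH1 IH2] := IH; have /andP[k1 k2] := dpow_bound k p0 pr r1.
apply/andP; split; first exact: addr_ge0 (mulr_ge0 x0 IH1) (mulr_ge0 k1 (sqr_ge0 _)).
(* The constant C = (1 - r)^-2 solves r C + (1 - r)^-1 = C, which closes the induction. *)
apply: (@le_trans _ _ (r * ((1 - r)^-1 ^+ 2 * (x - p) ^+ 2) + (1 - r)^-1 * (x - p) ^+ 2)).
  apply: lerD; last by rewrite ler_wpM2r ?sqr_ge0.
  by apply: ler_pM.
rewrite le_eqVlt; apply/orP; left; apply/eqP; field.
exact: lt0r_neq0.
Qed.

Definition dpgf (p : R) : R := ex P0 (fun w => dpow p (N w)).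

Lemma pgf_tangent (x p r : R) : 0 <= x -> x <= r -> 0 <= p -> p <= r -> r < 1 ->
  0 <= H x - H p - dpgf p * (x - p) <= (1 - r)^-1 ^+ 2 * (x - p) ^+ 2.
Proof.
move=> x0 xr p0 pr r1.
have x1 : x <= 1 by rewrite (le_trans xr)// ltW.
have p1 : p < 1 by rewrite (le_lt_trans pr).
have bx : bm (fun w => xpow x (N w)) by apply/um_bm/um_xpow => //; apply/andP.
have bp : bm (fun w => xpow p (N w)).
  by apply/um_bm/um_xpow => //; apply/andP; split => //; exact: ltW.
have bd : bm (fun w => dpow p (N w)) by apply: bm_dpow => //; apply/andP.
have bxp : bm (fun _ : T0 => x - p) by exact: bm_cst.
have bB := bmB bx bp; have bM := bmM bxp bd.
have -> : H x - H p - dpgf p * (x - p) =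
    ex P0 (fun w => xpow x (N w) - xpow p (N w) - (x - p) * dpow p (N w)).
  by rewrite !exB// exZ// !pgfE mulrC.
rewrite -[X in _ <= _ <= X](ex_cst P0); apply/andP; split.
  apply: ex_ge0 => w; rewrite mulrC.
  by have /andP[] := xpow_tangent (N w) x0 xr p0 pr r1.
apply: ex_le => [||w]; [exact: bmB|exact: bm_cst|].
rewrite [(x - p) * _]mulrC.
by have /andP[] := xpow_tangent (N w) x0 xr p0 pr r1.
Qed.

Lemma pgf_slope p : 0 < p < 1 -> slope_at H p (dpgf p).
Proof.
move=> /andP[p0 p1] e e0.
pose r : R := (1 + p) / 2.
have r1 : r < 1 by rewrite /r; lra.
have pr : p < r by rewrite /r; lra.
have q0 : 0 < 1 - r by rewrite subr_gt0.
pose C : R := (1 - r)^-1 ^+ 2.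
have C0 : 0 < C by rewrite exprn_gt0// invr_gt0.
exists (Num.min (Num.min p (r - p)) (e / C)).
  by rewrite !lt_min p0 subr_gt0 pr divr_gt0.
move=> x; rewrite !lt_min => /andP[/andP[xp xr] xe].
have x0 : 0 <= x by move: xp; rewrite ltr_norml => /andP[]; lra.
have xr' : x <= r by move: xr; rewrite ltr_norml => /andP[]; lra.
have /andP[h1 h2] := pgf_tangent x0 xr' (ltW p0) (ltW pr) r1.
rewrite ger0_norm//; apply: (le_trans h2).
rewrite -(real_normK (num_real (x - p))) expr2 mulrA ler_wpM2r//.
by rewrite mulrC -ler_pdivlMr// ltW.
Qed.

Hypothesis Hconvex : strictly_convex01 H.

Lemma pgf_mid x y : 0 <= x <= 1 -> 0 <= y <= 1 -> x != y ->
  H ((x + y) / 2) < (H x + H y) / 2.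
Proof.
move=> x01 y01 xy; have := @Hconvex x y 2^-1; rewrite !in_itv/= x01 y01 xy.
have -> : 2^-1 * x + (1 - 2^-1) * y = (x + y) / 2 by field.
have -> : 2^-1 * H x + (1 - 2^-1) * H y = (H x + H y) / 2 by field.
by apply => //; lra.
Qed.

(** Equality would make H constant on [x, y], against strict convexity at the midpoint. *)
Lemma pgf_lt x y : 0 <= x -> x < y -> y <= 1 -> H x < H y.
Proof.
move=> x0 xy y1; rewrite lt_neqAle (pgf_le x0 (ltW xy) y1) andbT; apply/eqP => Hxy.
have x01 : 0 <= x <= 1 by rewrite x0 (le_trans (ltW xy)).
have y01 : 0 <= y <= 1 by rewrite y1 (le_trans x0)// ltW.
have := pgf_mid x01 y01 (negbT (lt_eqF xy)).
have : H x <= H ((x + y) / 2) by apply: pgf_le; lra.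
lra.
Qed.

(** The weak tangent inequality at the midpoint of x and p, combined with strict convexity between x
    and p, makes the inequality at x strict. *)
Lemma pgf_tangent_lt x p : 0 <= x < 1 -> 0 <= p < 1 -> x != p ->
  H p + dpgf p * (x - p) < H x.
Proof.
move=> /andP[x0 x1] /andP[p0 p1] xp.
have tan y : 0 <= y < 1 -> H p + dpgf p * (y - p) <= H y.
  move=> /andP[y0 y1]; pose r : R := Num.max y p.
  have := @pgf_tangent y p r y0; rewrite /r !le_max !lexx orbT gt_max y1 p1.
  by move=> /(_ isT p0 isT isT) /andP[]; lra.
have x01 : 0 <= x <= 1 by rewrite x0 ltW.
have p01 : 0 <= p <= 1 by rewrite p0 ltW.
have := pgf_mid x01 p01 xp.
have := tan ((x + p) / 2).
have -> : 0 <= (x + p) / 2 < 1 by apply/andP; split; lra.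
move=> /(_ isT); have := tan x; rewrite x0 x1 => /(_ isT).
set a := H x; set b := H _; set c := H p; set D := dpgf p.
have -> : D * ((x + p) / 2 - p) = D * (x - p) / 2 by field.
lra.
Qed.

Lemma dpgf_gt0 p : 0 < p < 1 -> 0 < dpgf p.
Proof.
move=> /andP[p0 p1].
have := @pgf_tangent_lt (p / 2) p.
have -> : 0 <= p / 2 < 1 by apply/andP; split; lra.
have -> : 0 <= p < 1 by apply/andP; split; lra.
have -> : p / 2 != p by apply: negbT; apply: lt_eqF; lra.
move=> /(_ isT isT isT).
have : H (p / 2) < H p by apply: pgf_lt; lra.
move=> h1 h2; have : 0 < dpgf p * (p / 2).
  have -> : dpgf p * (p / 2) = - (dpgf p * (p / 2 - p)) by field.
  lra.
by rewrite pmulr_lgt0// divr_gt0.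
Qed.

End pgf.

(** * The recursion for second moments *)

Section recursion.
Context {R : realType} d0 (T0 : measurableType d0) (P0 : probability T0 R)
  (N : {RV P0 >-> xnat}) (mup mum : R).
Local Notation H := (pgf N).
Local Notation h1 := (dpgf N).
Let f (t : R) := 1 - H t.
Hypothesis N0 : forall w, N w <> Some 0%N.
Hypothesis Hconvex : strictly_convex01 H.
Hypothesis cyc : two_cycle f mup mum.

(* The second moment of the odd-level variables in terms of that of the
   even-level ones *)
Definition odd_moment (x : R) : R := 2 * mum - 1 + H x.

Definition moment_map (x : R) : R := 2 * mup - 1 + H (odd_moment x).

Definition moment_seq (n : nat) : R := iter n moment_map (mup ^+ 2).

Definition moment_lim : R := limn moment_seq.

Local Notation K := moment_map.
Local Notation xs := moment_seq.
Local Notation xoo := moment_lim.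

Lemma cyc01 : (0 <= mup <= 1) * (0 <= mum <= 1).
Proof. by case: cyc; rewrite !in_itv. Qed.

Lemma pgf_mup : H mup = 1 - mum.
Proof. by case: cyc => _ _ <- _; rewrite /f opprB addrC subrK. Qed.

Lemma pgf_mum : H mum = 1 - mup.
Proof. by case: cyc => _ _ _ <-; rewrite /f opprB addrC subrK. Qed.

Lemma odd_moment_mup : odd_moment mup = mum.
Proof. by rewrite /odd_moment pgf_mup; ring. Qed.

Lemma moment_map_mup : K mup = mup.
Proof. by rewrite /moment_map odd_moment_mup pgf_mum; ring. Qed.

Lemma mup_sq_le : mup ^+ 2 <= mup.
Proof. by have /andP[? ?] := cyc01.1; rewrite expr2 ler_piMl. Qed.

Lemma odd_moment_itv x : mup ^+ 2 <= x <= mup -> mum ^+ 2 <= odd_moment x <= mum.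
Proof.
move=> /andP[x0 x1]; have /andP[p0 p1] := cyc01.1.
have h2 : H x <= H mup.
  by apply: pgf_le => //; apply: le_trans x0; exact: sqr_ge0.
have h3 : H (mup ^+ 2) <= H x.
  by apply: pgf_le => //; [exact: sqr_ge0|exact: le_trans p1].
(* Since 2 mum - 1 + (1 - mum)^2 = mum^2, Jensen gives the lower bound. *)
have := pgf_sq N cyc01.1; rewrite pgf_mup in h2 *.
by rewrite /odd_moment => ?; apply/andP; split; nra.
Qed.

Lemma moment_map_itv x : mup ^+ 2 <= x <= mup -> mup ^+ 2 <= K x <= mup.
Proof.
move=> /odd_moment_itv /andP[y0 y1]; have /andP[m0 m1] := cyc01.2.
have h2 : H (odd_moment x) <= H mum.
  by apply: pgf_le => //; apply: le_trans y0; exact: sqr_ge0.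
have h3 : H (mum ^+ 2) <= H (odd_moment x).
  by apply: pgf_le => //; [exact: sqr_ge0|exact: le_trans m1].
have := pgf_sq N cyc01.2; rewrite pgf_mum in h2 *.
by rewrite /moment_map => ?; apply/andP; split; nra.
Qed.

Lemma odd_moment_le x y : mup ^+ 2 <= x -> x <= y -> y <= mup ->
  odd_moment x <= odd_moment y.
Proof.
move=> x0 xy y1; rewrite /odd_moment lerD2l; apply: pgf_le => //.
  by apply: le_trans x0; exact: sqr_ge0.
by apply: (le_trans y1); case/andP: cyc01.1.
Qed.

Lemma moment_map_le x y : mup ^+ 2 <= x -> x <= y -> y <= mup -> K x <= K y.
Proof.
move=> x0 xy y1; rewrite /moment_map lerD2l; apply: pgf_le.
- have /odd_moment_itv/andP[+ _] : mup ^+ 2 <= x <= mup by rewrite x0 (le_trans xy).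
  by apply: le_trans; exact: sqr_ge0.
- exact: odd_moment_le.
- have /odd_moment_itv/andP[_ h] : mup ^+ 2 <= y <= mup by rewrite y1 (le_trans x0).
  by apply: (le_trans h); case/andP: cyc01.2.
Qed.

Lemma moment_seq_itv n : mup ^+ 2 <= xs n <= mup.
Proof.
elim: n => [|n IH]; first by rewrite lexx mup_sq_le.
by rewrite /moment_seq iterS; exact: moment_map_itv.
Qed.

Lemma moment_seq_homo : {homo xs : n m / (n <= m)%N >-> n <= m}.
Proof.
apply/nondecreasing_seqP; elim=> [|n IH].
  by have /andP[] := moment_seq_itv 1.
rewrite /moment_seq !iterS; apply: moment_map_le => //.
- by have /andP[] := moment_seq_itv n.
- by have /andP[] := moment_seq_itv n.+1.
Qed.

Lemma moment_seq_cvg : xs @ \oo --> xoo.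
Proof.
apply: nondecreasing_is_cvgn; first exact: moment_seq_homo.
by exists mup => _ [n _ <-]; have /andP[] := moment_seq_itv n.
Qed.

Lemma moment_seq_le_lim n : xs n <= xoo.
Proof.
apply: nondecreasing_cvgn_le; first exact: moment_seq_homo.
by apply/cvg_ex; exists xoo; exact: moment_seq_cvg.
Qed.

Lemma moment_lim_itv : mup ^+ 2 <= xoo <= mup.
Proof.
rewrite (moment_seq_le_lim 0)/=; apply: (cvgr_to_le moment_seq_cvg).
by apply: nearW => n; have /andP[] := moment_seq_itv n.
Qed.

Lemma slope_cvg (g : R -> R) p l : slope_at g p l -> g x @[x --> p] --> g p.
Proof.
move=> gl; apply/cvgrPdist_le => e e0.
have [d d00 gd] := gl 1 ltr01.
have l1 : 0 < 1 + `|l| by rewrite ltr_pwDl.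
near=> x.
have xd : `|x - p| < d by rewrite distrC; near: x; exists d.
have xe : `|x - p| < e / (1 + `|l|).
  by rewrite distrC; near: x; exists (e / (1 + `|l|)); [rewrite /= divr_gt0|].
have := gd x xd; rewrite mul1r => h.
rewrite distrC.
have -> : g x - g p = (g x - g p - l * (x - p)) + l * (x - p) by ring.
apply: (le_trans (ler_normD _ _)); rewrite normrM.
apply: (le_trans (lerD h (lexx _))).
by rewrite -{1}[`|x - p|]mul1r -mulrDl mulrC -ler_pdivlMr// ltW.
Unshelve. all: by end_near. Qed.

Lemma mum_interior : 0 < mup < 1 -> 0 < mum < 1.
Proof.
move=> /andP[p0 p1].
have := @pgf_lt _ _ _ _ N Hconvex 0 mup (lexx 0) p0 (ltW p1).
have := @pgf_lt _ _ _ _ N Hconvex mup 1 (ltW p0) p1 (lexx 1).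
by rewrite (pgf0 N0) pgf1 pgf_mup => ? ?; apply/andP; split; lra.
Qed.

Lemma mup_boundary : ~~ (0 < mup < 1) -> mup ^+ 2 = mup.
Proof.
have /andP[p0 p1] := cyc01.1.
rewrite !lt_neqAle p0 p1 !andbT negb_and !negbK => /orP[/eqP <-|/eqP ->].
  by rewrite expr0n.
by rewrite expr1n.
Qed.

Lemma moment_lim_boundary : ~~ (0 < mup < 1) -> xoo = mup.
Proof.
move=> /mup_boundary pE; have := moment_lim_itv; rewrite pE => h.
by apply/eqP; rewrite eq_le andbC.
Qed.

Lemma moment_map_slope x : 0 < x < 1 -> 0 < odd_moment x < 1 ->
  slope_at K x (h1 (odd_moment x) * h1 x).
Proof.
move=> x01 y01.
have s1 : slope_at odd_moment x (h1 x).
  move=> e e0; have [d d00 h] := pgf_slope N x01 e0; exists d => // y /h.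
  by rewrite /odd_moment; congr (`|_| <= _); ring.
have s2 : slope_at (fun y => 2 * mup - 1 + H y) (odd_moment x) (h1 (odd_moment x)).
  move=> e e0; have [d d00 h] := pgf_slope N y01 e0; exists d => // y /h.
  by congr (`|_| <= _); ring.
exact: slope_at_comp s1 s2.
Qed.

(** Continuity of K at xoo comes from differentiability, which requires xoo and its odd moment to
    lie strictly between 0 and 1: H may jump at 1 when N can be infinite. In the boundary case xoo =
    mup. *)
Lemma moment_lim_fix : K xoo = xoo.
Proof.
have [int|bd] := boolP (0 < mup < 1); last first.
  by rewrite moment_lim_boundary// moment_map_mup.
have /andP[m0 m1] := mum_interior int.
have /andP[p0 p1] := int.
have /andP[x0 x1] := moment_lim_itv.
have /andP[y0 y1] := odd_moment_itv moment_lim_itv.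
have Kc : K x @[x --> xoo] --> K xoo.
  apply: slope_cvg; apply: moment_map_slope; apply/andP; split.
  - by apply: lt_le_trans x0; rewrite exprn_gt0.
  - exact: le_lt_trans x1 p1.
  - by apply: lt_le_trans y0; rewrite exprn_gt0.
  - exact: le_lt_trans y1 m1.
have h2 : K (xs n) @[n --> \oo] --> K xoo.
  exact: (@cvg_comp _ _ _ xs K _ _ _ moment_seq_cvg Kc).
have h3 : xs n.+1 @[n --> \oo] --> xoo.
  by rewrite (@cvg_shiftS _ xs); exact: moment_seq_cvg.
exact: (cvg_unique _ h2 h3).
Qed.

(** K composes two strictly increasing, strictly convex maps: the convexity of the inner one is
    carried through by the monotonicity of the outer one. *)
Lemma moment_map_convex x y t : mup ^+ 2 <= x -> x < y -> y <= mup -> 0 < t < 1 ->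
  K (t * x + (1 - t) * y) < t * K x + (1 - t) * K y.
Proof.
move=> x0 xy y1 /andP[t0 t1].
have /andP[p0 p1] := cyc01.1; have /andP[m0 m1] := cyc01.2.
have sq0 := sqr_ge0 mup; have sqm0 := sqr_ge0 mum.
have x01 : x \in `[0, 1] by rewrite in_itv/=; apply/andP; split; lra.
have y01 : y \in `[0, 1] by rewrite in_itv/=; apply/andP; split; lra.
have t01 : t \in `]0, 1[ by rewrite in_itv/= t0.
have hm := Hconvex x01 y01 (negbT (lt_eqF xy)) t01.
have xz : x <= t * x + (1 - t) * y by nra.
have zy : t * x + (1 - t) * y <= y by nra.
have /odd_moment_itv/andP[ox1 ox2] : mup ^+ 2 <= x <= mup by apply/andP; split; lra.
have /odd_moment_itv/andP[oy1 oy2] : mup ^+ 2 <= y <= mup by apply/andP; split; lra.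
have /odd_moment_itv/andP[om1 om2] :
    mup ^+ 2 <= t * x + (1 - t) * y <= mup by apply/andP; split; lra.
have oxy : odd_moment x < odd_moment y.
  by rewrite /odd_moment ltrD2l; apply: (pgf_lt Hconvex); lra.
have oz : odd_moment (t * x + (1 - t) * y) < t * odd_moment x + (1 - t) * odd_moment y.
  by rewrite /odd_moment; move: hm; lra.
have oz1 : t * odd_moment x + (1 - t) * odd_moment y <= 1 by nra.
have h2 : H (odd_moment (t * x + (1 - t) * y)) < H (t * odd_moment x + (1 - t) * odd_moment y).
  by apply: (pgf_lt Hconvex) => //; lra.
have ox01 : odd_moment x \in `[0, 1] by rewrite in_itv/=; apply/andP; split; lra.
have oy01 : odd_moment y \in `[0, 1] by rewrite in_itv/=; apply/andP; split; lra.
have := Hconvex ox01 oy01 (negbT (lt_eqF oxy)) t01.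
rewrite /moment_map; lra.
Qed.

(* A strictly convex function meets the diagonal at most twice. *)
Lemma moment_fix_two x : mup ^+ 2 <= x <= mup -> K x = x -> xoo <= x ->
  x = xoo \/ x = mup.
Proof.
move=> /andP[x0 x1] Kx lx.
have [->|nx] := eqVneq x xoo; [by left|right].
apply/eqP/negPn/negP => xp.
have lx' : xoo < x by rewrite lt_neqAle eq_sym nx.
have xp' : x < mup by rewrite lt_neqAle xp.
have /andP[l0 _] := moment_lim_itv.
have lp : xoo < mup by exact: lt_trans xp'.
have lp' : 0 < mup - xoo by rewrite subr_gt0.
pose t := (mup - x) / (mup - xoo).
have t01 : 0 < t < 1.
  by rewrite /t divr_gt0 ?subr_gt0//= ltr_pdivrMr// mul1r ltrD2l ltrN2.
have := moment_map_convex l0 lp (lexx _) t01.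
have -> : t * xoo + (1 - t) * mup = x by rewrite /t; field; rewrite lt0r_neq0.
rewrite moment_lim_fix moment_map_mup Kx.
have -> : t * xoo + (1 - t) * mup = x by rewrite /t; field; rewrite lt0r_neq0.
by rewrite ltxx.
Qed.

Lemma moment_lim_lt_interior : xoo < mup -> 0 < mup < 1.
Proof. by move=> h; apply: contraLR h => /moment_lim_boundary ->; rewrite ltxx. Qed.

(** The chord of K between the fixed points xoo and mup has slope 1, so strict convexity makes the
    slope at the right end exceed 1. The tangent inequalities of H at mup and at mum, applied in
    turn, give this directly. *)
Lemma moment_lim_lt_slope : xoo < mup -> 1 < h1 mum * h1 mup.
Proof.
move=> lp; have int := moment_lim_lt_interior lp.
have /andP[p0 p1] := int; have /andP[m0 m1] := mum_interior int.
have /andP[l0 l1] := moment_lim_itv; have /andP[y0 y1] := odd_moment_itv moment_lim_itv.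
have sq0 := sqr_ge0 mup; have sqm0 := sqr_ge0 mum.
have i1 : 0 <= xoo < 1 by apply/andP; split; lra.
have i2 : 0 <= mup < 1 by apply/andP; split; lra.
have i3 : 0 <= mum < 1 by apply/andP; split; lra.
have := pgf_tangent_lt Hconvex i1 i2 (negbT (lt_eqF lp)).
set y := odd_moment xoo; rewrite pgf_mup => t1.
have ymu : h1 mup * (xoo - mup) < y - mum by rewrite /y /odd_moment; lra.
have lKy : H y = xoo - (2 * mup - 1).
  by have := moment_lim_fix; rewrite /moment_map -/y; lra.
have hm0 : 0 < h1 mum by apply: (dpgf_gt0 Hconvex); rewrite m0.
have t2 : H mum + h1 mum * (y - mum) <= H y.
  have [->|yn] := eqVneq y mum; first by rewrite subrr mulr0 addr0.
  apply/ltW/(pgf_tangent_lt Hconvex) => //; apply/andP; split; rewrite /y; lra.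
rewrite pgf_mum in t2.
have t3 : h1 mum * (h1 mup * (xoo - mup)) < h1 mum * (y - mum).
  by rewrite ltr_pM2l.
have : (h1 mum * h1 mup) * (xoo - mup) < xoo - mup by rewrite -mulrA; lra.
by rewrite -{2}[xoo - mup]mul1r ltr_nM2r// subr_lt0.
Qed.

(** If the increasing sequence [xs] converged to mup, it would eventually enter the zone where a
    slope above 1 puts K below the diagonal, and there it would decrease. *)
Lemma slope_moment_lim_lt : 0 < mup < 1 -> 1 < h1 mum * h1 mup -> xoo < mup.
Proof.
move=> int a1; have /andP[p0 p1] := int; have m01 := mum_interior int.
have /andP[_ lp] := moment_lim_itv.
rewrite lt_neqAle lp andbT; apply/eqP => lpE.
have sl := moment_map_slope int; rewrite odd_moment_mup in sl.
have {}sl := sl m01; pose e : R := (h1 mum * h1 mup - 1) / 2.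
have e0 : 0 < e by rewrite divr_gt0// subr_gt0.
have [d d00 hd] := sl e e0.
have below x : x < mup -> mup - x < d -> K x < x.
  move=> xp xd; have := hd x.
  have -> : `|x - mup| = mup - x by rewrite distrC gtr0_norm// subr_gt0.
  move=> /(_ xd); rewrite moment_map_mup ler_norml => /andP[_ h].
  have : 0 < e * (mup - x) by rewrite mulr_gt0// subr_gt0.
  have aE : h1 mum * h1 mup = 2 * e + 1 by rewrite /e; field.
  by move: h; rewrite aE; lra.
(* The sequence never reaches mup: K at [xs n] is at most K at the midpoint of [xs n] and mup, which
   is strictly below mup by convexity. *)
have xlt n : xs n < mup.
  elim: n => [|n IH]; first by rewrite /moment_seq /= expr2 -[ltRHS]mul1r ltr_pM2r.
  have /andP[n0 _] := moment_seq_itv n.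
  rewrite /moment_seq iterS -/(xs n) -[ltRHS]moment_map_mup.
  have half : 0 < (2^-1 : R) < 1 by apply/andP; split; lra.
  have mid : xs n <= 2^-1 * xs n + (1 - 2^-1) * mup by lra.
  have mid2 : 2^-1 * xs n + (1 - 2^-1) * mup <= mup by lra.
  have c1 := moment_map_convex n0 IH (lexx _) half.
  have c2 := moment_map_le n0 mid mid2.
  by move: c1 c2; lra.
have /cvgrPdist_lt /(_ d d00) [n _ /(_ n (leqnn n)) /=] := moment_seq_cvg.
rewrite lpE ger0_norm ?subr_ge0 ?ltW// => xnd.
have := below _ (xlt n) xnd.
have := moment_seq_homo (leqnSn n); rewrite {2}/moment_seq iterS -/(xs n).
by move=> /le_lt_trans h /h; rewrite ltxx.
Qed.

Lemma deriv01_pgf p : 0 < p < 1 -> deriv01 H p = (h1 p)%:E.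
Proof. by move=> p01; apply: deriv01_slope => //; exact: pgf_slope. Qed.

Lemma deriv01_ff p q : 0 < p < 1 -> 0 < q < 1 -> f p = q ->
  deriv01 (f \o f) p = (h1 q * h1 p)%:E.
Proof.
move=> p01 q01 pq; apply: deriv01_slope => //.
have -> : h1 q * h1 p = - h1 q * - h1 p by ring.
apply: slope_at_comp; first exact/slope_at_opp/pgf_slope.
by rewrite pq; exact/slope_at_opp/pgf_slope.
Qed.

(** f has slope -H', so the derivative of f o f is H'(mum) H'(mup) at either point of the cycle. *)
Lemma instability_criterion : 0 < mup < 1 ->
  [/\ (1%:E < deriv01 H mum * deriv01 H mup)%E <-> xoo < mup,
      unstable_fixpoint (f \o f) mup <-> xoo < mup &
      unstable_fixpoint (f \o f) mum <-> xoo < mup].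
Proof.
move=> int; have m01 := mum_interior int.
have [_ _ fp fm] := cyc.
have e : 1 < h1 mum * h1 mup <-> xoo < mup.
  by split; [exact: slope_moment_lim_lt|exact: moment_lim_lt_slope].
split.
- by rewrite !deriv01_pgf// -EFinM lte_fin.
- rewrite /unstable_fixpoint (deriv01_ff int m01)// lte_fin -e /=; split=> [[]//|h].
  by rewrite fp fm.
- rewrite /unstable_fixpoint (deriv01_ff m01 int)// lte_fin mulrC -e /=; split=> [[]//|h].
  by rewrite fm fp.
Qed.

End recursion.

(** * Random trees *)

Section family_law.
Context {R : realType}.

Lemma eq_prob_gen d (T : measurableType d) (P Q : probability T R)
    (G : set (set T)) : setI_closed G -> G `<=` measurable ->
  (forall A, G A -> P A = Q A) -> forall A, <<s G >> A -> P A = Q A.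
Proof.
move=> GI Gm PQ A GA.
suff [] : measurable A /\ P A = Q A by [].
move: A GA; apply: g_sigma_ind => //.
- by move=> A GA; split; [exact: Gm|exact: PQ].
- by split => //; rewrite !probability_setT.
- by move=> A [mA PA]; split; [exact: measurableC|rewrite !probability_setC// PA].
- move=> F tF mF; split; first by apply: bigcupT_measurable => n; exact: (mF n).1.
  rewrite !measure_bigcup//; try by move=> n _; exact: (mF n).1.
  by apply: eq_eseriesr => n _; exact: (mF n).2.
Qed.

Context (K : eqType) d (L : measurableType d).

Lemma eq_prob_fam (P Q : probability (fam K L) R) :
  (forall (s : seq K) (A : K -> set L), uniq s -> (forall i, measurable (A i)) ->
    P (\bigcap_(i in [set` s]) [set x | A i (x i)]) =
    Q (\bigcap_(i in [set` s]) [set x | A i (x i)])) ->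
  forall E, measurable E -> P E = Q E.
Proof.
move=> PQ E mE.
pose ev k : {RV P >-> L} := mkmfun (@measurable_ev K _ L k).
apply: (@eq_prob_gen _ _ P Q (cylinders setT ev)) => //.
- exact: cylindersI.
- exact: cylinders_measurable.
- by move=> _ [s [A [us _ mA _ ->]]]; exact: PQ.
apply: sigma_family_cylinders.
move: E mE; apply: smallest_sub; first exact: smallest_sigma_algebra.
by move=> A [k _ [B mB <-]]; apply: sub_sigma_algebra; exists k => //; exists B.
Qed.

Lemma measurable_family d1 (T1 : measurableType d1) (P1 : probability T1 R)
    (V : K -> {RV P1 >-> L}) :
  measurable_fun setT ((fun w k => V k w) : T1 -> fam K L).
Proof. by apply: measurable_fam => k; exact: measurable_funPT. Qed.

Lemma indep_family_law d1 d2 (T1 : measurableType d1) (T2 : measurableType d2)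
    (P1 : probability T1 R) (P2 : probability T2 R)
    (V1 : K -> {RV P1 >-> L}) (V2 : K -> {RV P2 >-> L}) :
  mutually_indep setT V1 -> mutually_indep setT V2 ->
  (forall k, same_law (V1 k) (V2 k)) ->
  forall E : set (fam K L), measurable E ->
  P1 ((fun w k => V1 k w) @^-1` E) = P2 ((fun w k => V2 k w) @^-1` E).
Proof.
move=> i1 i2 V12 E mE.
have := @eq_prob_fam (distribution P1 (mkmfun (measurable_family V1)))
  (distribution P2 (mkmfun (measurable_family V2))) _ E mE; apply.
move=> s A us mA; rewrite /distribution /pushforward.
change (P1 (\bigcap_(i in [set` s]) V1 i @^-1` A i) =
  P2 (\bigcap_(i in [set` s]) V2 i @^-1` A i)).
have -> := i1 s A us _ (fun i _ => mA i); last by [].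
have -> := i2 s A us _ (fun i _ => mA i); last by [].
by apply: eq_bigr => i _; exact: V12.
Qed.

End family_law.

Lemma mutually_indep_reindex {R : realType} d (T : measurableType d)
    (P : probability T R) d' (T' : measurableType d') (I J : eqType) (D : set I)
    (V : I -> {RV P >-> T'}) (h : J -> I) (g : I -> J) :
  cancel h g -> (forall j, D (h j)) -> mutually_indep D V ->
  mutually_indep setT (V \o h).
Proof.
move=> hg hD VD s A us _ mA.
have := VD (map h s) (A \o g); rewrite big_map/= => VhA.
rewrite (eq_bigr (fun j => P (V (h j) @^-1` A (g (h j))))); last first.
  by move=> j _; rewrite hg.
rewrite -VhA.
- congr (P _); apply/seteqP; split=> w Aw => [_ /mapP[j js ->]|j js].
    by rewrite /= hg; exact: Aw.
  by have := Aw (h j); rewrite /= hg; apply; exact: map_f.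
- by rewrite map_inj_uniq//; exact: can_inj hg.
- by move=> _ /mapP[j _ ->].
- by move=> _ /mapP[j js ->]; rewrite hg; exact: mA.
Qed.

(** * The RDE as an operator on functions of a labelled tree *)

Section branching.
Context {R : realType} d (L : measurableType d) (nl : L -> xnat).
Hypothesis mnl : measurable_fun setT nl.

Local Notation tree := (fam (seq nat) L).

Definition subtree (v : seq nat) (t : tree) : tree := fun u => t (v ++ u).

Lemma measurable_subtree v : measurable_fun setT (subtree v).
Proof. by apply: measurable_fam => u; exact: measurable_ev. Qed.

(** Labels carry the family size [nl] and possibly further randomness: nothing more for the
    endogenous solution, initial values for the invariant laws and for the discrete solution. *)
Definition half_rde (g : tree -> R) (t : tree) : R :=
  xprod (nl (t [::])) (fun i => g (subtree [:: i] t)).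

Definition rde (g : tree -> R) (t : tree) : R :=
  1 - half_rde (fun t => 1 - half_rde g t) t.

Lemma rdeE (g : tree -> R) (t : tree) u :
  rde g (subtree u t) = rde_map (nl (t u)) (fun i => nl (t (rcons u i)))
    (fun i j => g (subtree (rcons (rcons u i) j) t)).
Proof.
rewrite /rde /rde_map /half_rde /subtree cats0; congr (1 - _).
apply: eq_xprod => i _; rewrite cats0 cats1; congr (1 - _).
apply: eq_xprod => j _; congr g; apply/funext => v.
by rewrite -!cats1 !catA.
Qed.

Lemma um_comp d1 d2 (T1 : measurableType d1) (T2 : measurableType d2)
    (g : T2 -> R) (X : T1 -> T2) :
  measurable_fun setT X -> um g -> um (g \o X).
Proof.
by move=> mX [mg g01]; split; [exact: measurableT_comp mg mX|move=> w; exact: g01].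
Qed.

Lemma um_subtree (g : tree -> R) v : um g -> um (g \o subtree v).
Proof. by apply: um_comp; exact: measurable_subtree. Qed.

Lemma um_half_rde g : um g -> um (half_rde g).
Proof.
move=> ug; apply: um_xprod.
  exact: measurableT_comp mnl (measurable_ev _).
by move=> i; exact: um_subtree.
Qed.

Lemma um_rde g : um g -> um (rde g).
Proof. by move=> ug; apply/umC/um_half_rde/umC/um_half_rde. Qed.

Lemma um_iter_rde g n : um g -> um (iter n rde g).
Proof. by move=> ug; elim: n => // n IH; rewrite iterS; exact: um_rde. Qed.

Lemma half_rdeM g h : um g -> um h ->
  half_rde (fun t => g t * h t) =1 (fun t => half_rde g t * half_rde h t).
Proof. by move=> ug uh t; apply: xprodM => i; [exact: ug.2|exact: uh.2]. Qed.

Context d1 (T : measurableType d1) (P : probability T R)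
  (V : seq nat -> {RV P >-> L}).
Hypothesis iV : mutually_indep setT V.
Hypothesis lV : forall u v, same_law (V u) (V v).

Definition the_tree (w : T) : tree := fun u => V u w.

Lemma measurable_tree : measurable_fun setT the_tree.
Proof. exact: measurable_family. Qed.

Lemma subtree_law v (E : set tree) : measurable E ->
  P ((subtree v \o the_tree) @^-1` E) = P (the_tree @^-1` E).
Proof.
move=> mE; apply: (indep_family_law (V1 := V \o cat v) (V2 := V)) => //.
apply: (@mutually_indep_reindex _ _ _ _ _ _ _ _ setT _ _ (drop (size v))) => //.
  by move=> u; rewrite drop_size_cat.
by move=> u; exact: lV.
Qed.

Definition em (g : tree -> R) : R := ex P (g \o the_tree).

Lemma em_subtree v g : bm g -> ex P (g \o (subtree v \o the_tree)) = em g.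
Proof.
move=> bg; apply: eq_law_ex => //.
- exact: measurableT_comp (measurable_subtree v) measurable_tree.
- exact: measurable_tree.
- exact: subtree_law.
Qed.

Definition block (v : seq nat) : set (seq nat) := [set u | exists w, u = v ++ w].

Lemma block_disj u v w : size u = size v -> block u w -> block v w -> u = v.
Proof.
move=> uv [w1 ->] [w2 /eqP]; rewrite eqseq_cat// => /andP[/eqP].
by [].
Qed.

Lemma subtree_event (g : tree -> R) v (B : set R) : measurable_fun setT g ->
  measurable B -> sigma_family (block v) V ((g \o (subtree v \o the_tree)) @^-1` B).
Proof.
move=> mg mB; apply: (sigma_family_fam (h := fun u => v ++ u) (E := g @^-1` B)).
  by move=> u; exists u.
exact: measurable_preim.
Qed.

Lemma ex_subtrees (g : tree -> R) (s : seq (seq nat)) (k : nat)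
    (B0 : set (seq nat)) (A : set T) :
  um g -> uniq s -> all (fun v => size v == k) s ->
  (forall v u, v \in s -> B0 u -> block v u -> False) -> sigma_family B0 V A ->
  ex P (fun w => \prod_(v <- s) g (subtree v (the_tree w)) * \1_A w) =
  ex P (fun w => \prod_(v <- s) em g * \1_A w).
Proof.
move=> ug us sk B0s sA.
have mA : measurable A by exact: sigma_family_measurable sA.
have ugv v : um (g \o (subtree v \o the_tree)).
  apply: um_comp => //.
  exact: measurableT_comp (measurable_subtree v) measurable_tree.
rewrite (@ex_prod_indep _ _ _ _ _ s (fun v => g \o (subtree v \o the_tree)) A us mA)//.
- rewrite (eq_bigr (fun=> em g)); last by move=> v _; exact/em_subtree/um_bm.
  by rewrite -exZ//; exact/um_bm/um_indic.
- move=> B mB.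
  apply: (@indep_many_blocks _ _ _ _ _ _ _ _ setT B0 block V) => //.
    move=> v v' u vs vs'; apply: block_disj.
    by rewrite (eqP (allP sk _ vs)) (eqP (allP sk _ vs')).
  by move=> v vs; apply: subtree_event => //; exact: ug.1.
Qed.

(** Given the labels on the levels before k, the subtrees rooted at level k are independent copies
    of the whole tree; hence the constants on the right. *)
Lemma agree_subtrees (g : tree -> R) (k : nat) : um g ->
  agree P (sigma_family [set u | (size u < k)%N] V) (fun v => size v == k)
    (fun v w => g (subtree v (the_tree w))) (fun=> fun=> em g).
Proof.
move=> ug s A us sk sA; apply: (ex_subtrees ug us sk _ sA).
move=> v u vs /= uk [w uE]; move: uk; rewrite uE size_cat.
by rewrite (eqP (allP sk _ vs)) ltnNge leq_addr.
Qed.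

Context d0 (T0 : measurableType d0) (P0 : probability T0 R) (N : {RV P0 >-> xnat}).
Hypothesis lN : forall B, P (V [::] @^-1` (nl @^-1` B)) = P0 (N @^-1` B).

Lemma em01 g : um g -> 0 <= em g <= 1.
Proof. by move=> ug; apply: ex_um; apply: um_comp => //; exact: measurable_tree. Qed.

Lemma sigma_family_node (k : nat) u A (B : set L) :
  (size u < k)%N -> measurable B ->
  sigma_family [set u | (size u < k)%N] V A ->
  sigma_family [set u | (size u < k)%N] V (A `&` V u @^-1` B).
Proof.
move=> uk mB sA; apply: (@measurableI _ (g_sigma_algebraType _)) => //.
by apply: sub_sigma_algebra; exists u => //; exists B => //; rewrite setTI.
Qed.

(** One step from the constants [em g] turns the product over daughters into the power (em g)^N,
    whose expectation is the generating function. *)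
Lemma em_half_rde g : um g -> em (half_rde g) = pgf N (em g).
Proof.
move=> ug; have eg := em01 ug.
have mN u : measurable_fun setT (fun w => nl (V u w)).
  by apply: (@measurableT_comp _ _ _ _ _ _ nl) => //; exact: measurable_funPT.
have := @agree_step _ _ _ P (sigma_family [set u | (size u < 1)%N] V)
  (@sigma_family_measurable _ _ _ _ _ _ _ _ V) _ _ (fun v : seq nat => size v == 0%N)
  (fun v => size v == 1%N) (fun u i => rcons u i) (fun u w => nl (V u w)) _ _
  _ _ mN _ _ _ (agree_subtrees (k := 1) ug).
(* The agreement is tested on the root alone and on the full event. *)
move=> /(_ _ _ _ _ _ [:: [::]] setT) h.
have {h} := h _ _ _ _ _ isT isT (@measurableT _ (g_sigma_algebraType _)).
have one (Y : T -> R) (F : seq nat -> T -> R) : (forall w, F [::] w = Y w) ->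
    ex P (fun w => \prod_(v <- [:: [::]]) F v w * \1_setT w) = ex P Y.
  by move=> FY; apply: eq_ex => w; rewrite big_seq1 indicT mulr1.
rewrite (one (half_rde g \o the_tree)); last first.
  move=> w; apply: eq_xprod => i _; congr g.
rewrite (one (fun w => xpow (em g) (nl (V [::] w)))); last by move=> w; exact: xprod_cst.
rewrite -/(em _) => ->.
- rewrite pgfE; apply: (@eq_law_ex _ _ _ _ _ _ _ _ _ (fun w => nl (V [::] w)) N (xpow (em g))) => //.
    by move=> B _; exact: lN.
  split => //; exists 1 => n; have /andP[? ?] := xpow01 n eg.
  by rewrite ger0_norm.
- by move=> u i u' i' /rcons_inj [-> ->].
- by move=> u i /eqP; rewrite size_rcons => ->.
- move=> u A B /eqP u0 sA.
  apply: (@sigma_family_node 1 u A (nl @^-1` B)) => //; first by rewrite u0.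
  exact: measurable_preim.
- by move=> v; apply: um_comp ug; exact: measurableT_comp (measurable_subtree v) measurable_tree.
- by move=> v; exact: um_cst.
Qed.

Variables (mup mum : R).
Hypothesis cyc : two_cycle (fun t => 1 - pgf N t) mup mum.

Let cst1 : bm (fun _ : T => 1 : R). Proof. exact: bm_cst. Qed.

Lemma em_comp (g h : tree -> R) : um g -> um h ->
  em (fun t => (1 - g t) * (1 - h t)) = 1 - em g - em h + em (fun t => g t * h t).
Proof.
move=> ug uh.
have bg : bm (g \o the_tree) by apply/um_bm/um_comp => //; exact: measurable_tree.
have bh : bm (h \o the_tree) by apply/um_bm/um_comp => //; exact: measurable_tree.
rewrite /em -[X in X - _ - _](ex_cst P) -!exB//; last exact: bmB.
rewrite -exD//; [|by apply: bmB => //; exact: bmB|exact: bmM].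
by apply: eq_ex => w /=; ring.
Qed.

Lemma emC g : um g -> em (fun t => 1 - g t) = 1 - em g.
Proof.
move=> ug; rewrite /em -[X in X - _](ex_cst P) -exB//.
by apply/um_bm/um_comp => //; exact: measurable_tree.
Qed.

Lemma em_odd g : um g -> em g = mup -> em (fun t => 1 - half_rde g t) = mum.
Proof.
move=> ug eg; rewrite emC; last exact: um_half_rde.
by rewrite em_half_rde// eg (pgf_mup cyc); ring.
Qed.

Lemma em_rde g : um g -> em g = mup -> em (rde g) = mup.
Proof.
move=> ug eg; rewrite /rde emC; last exact/um_half_rde/umC/um_half_rde.
rewrite em_half_rde; last exact/umC/um_half_rde.
by rewrite em_odd// (pgf_mum cyc); ring.
Qed.

(** The moment of two complements is expanded twice, and each time the remaining product is a single
    product over daughters; these are the two layers of the moment map. *)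
Lemma em_rdeM g h : um g -> um h -> em g = mup -> em h = mup ->
  em (fun t => rde g t * rde h t) =
  moment_map N mup mum (em (fun t => g t * h t)).
Proof.
move=> ug uh eg eh.
have ug1 := um_half_rde ug; have uh1 := um_half_rde uh.
have ug2 := umC ug1; have uh2 := umC uh1.
rewrite /rde em_comp; try exact: um_half_rde.
rewrite !em_half_rde// !em_odd// (pgf_mum cyc).
have -> : em (fun t => half_rde (fun t => 1 - half_rde g t) t *
    half_rde (fun t => 1 - half_rde h t) t) =
    pgf N (em (fun t => (1 - half_rde g t) * (1 - half_rde h t))).
  rewrite -em_half_rde; last exact: umM.
  by apply: eq_ex => w /=; rewrite half_rdeM.
rewrite em_comp// !em_half_rde// eg eh (pgf_mup cyc).
have -> : em (fun t => half_rde g t * half_rde h t) =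
    pgf N (em (fun t => g t * h t)).
  rewrite -em_half_rde; last exact: umM.
  by apply: eq_ex => w /=; rewrite half_rdeM.
rewrite /moment_map /odd_moment; congr (_ + pgf N _); ring.
Qed.

Lemma em_iter_rde g n : um g -> em g = mup -> em (iter n rde g) = mup.
Proof.
move=> ug eg; elim: n => // n IH; rewrite iterS.
by apply: em_rde => //; exact: um_iter_rde.
Qed.

Lemma em_iter_rdeM g h n : um g -> um h -> em g = mup -> em h = mup ->
  em (fun t => iter n rde g t * iter n rde h t) =
  iter n (moment_map N mup mum) (em (fun t => g t * h t)).
Proof.
move=> ug uh eg eh; elim: n => // n IH.
by rewrite !iterS em_rdeM ?IH//; try exact: um_iter_rde; exact: em_iter_rde.
Qed.

End branching.

(** * The endogenous solution *)

Section versions.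
Context {R : realType} d (T : measurableType d) (P : probability T R).

Lemma negligible_bigcup_count (I : countType) (F : I -> set T) :
  (forall i, P.-negligible (F i)) -> P.-negligible (\bigcup_i F i).
Proof.
move=> nF; pose F' n := if unpickle n is Some i then F i else set0.
have nF' n : P.-negligible (F' n).
  by rewrite /F'; case: unpickle => [i|]; [exact: nF|exact: negligible_set0].
apply: negligibleS (negligible_bigcup nF') => w [i _ Fw].
by exists (pickle i) => //; rewrite /F' pickleK.
Qed.

Lemma ex_on (X : T -> R) (A : set T) : bm X -> measurable A ->
  (\int[P]_(w in A) (X w)%:E)%E = (ex P (fun w => X w * \1_A w))%:E.
Proof.
move=> bX mA; rewrite -ex_fin; last by apply: bmM => //; exact/um_bm/um_indic.
rewrite integral_mkcond; apply: eq_integral => w _.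
rewrite /patch indicE; case: (w \in A); first by rewrite mulr1.
by rewrite mulr0.
Qed.

Lemma ex_on_ext (X Y : T -> R) (G : set (set T)) :
  bm X -> bm Y -> setI_closed G -> G `<=` measurable -> G setT ->
  (forall A, G A -> ex P (fun w => X w * \1_A w) = ex P (fun w => Y w * \1_A w)) ->
  forall A, <<s G >> A ->
    ex P (fun w => X w * \1_A w) = ex P (fun w => Y w * \1_A w).
Proof.
move=> bX bY GI Gm GT XY A GA.
suff [] : measurable A /\
    ex P (fun w => X w * \1_A w) = ex P (fun w => Y w * \1_A w) by [].
have one (Z : T -> R) : ex P (fun w => Z w * \1_setT w) = ex P Z.
  by apply: eq_ex => w; rewrite indicT mulr1.
have XYT : ex P X = ex P Y by have := XY _ GT; rewrite !one.
move: A GA; apply: g_sigma_ind => //.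
- by move=> A GA; split; [exact: Gm|exact: XY].
- by rewrite !one.
- move=> A [mA XYA]; split; first exact: measurableC.
  have split (Z : T -> R) : bm Z -> ex P (fun w => Z w * \1_(~` A) w) =
      ex P Z - ex P (fun w => Z w * \1_A w).
    move=> bZ; rewrite -exB//; last by apply: bmM => //; exact/um_bm/um_indic.
    apply: eq_ex => w; rewrite !indicE in_setC.
    by case: (w \in A) => /=; ring.
  by rewrite !split// XYT XYA.
- move=> F tF mF; have mU : measurable (\bigcup_n F n).
    by apply: bigcupT_measurable => n; exact: (mF n).1.
  split=> //; apply: EFin_inj; rewrite -!ex_on//.
  have int (Z : T -> R) : bm Z -> P.-integrable (\bigcup_k F k) (EFin \o Z).
    by move=> bZ; apply: (@integrableS _ _ _ P setT) => //; exact: bm_integrable.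
  have := integral_bigcup tF (fun n => (mF n).1) (int X bX); rewrite /= => ->.
  have := integral_bigcup tF (fun n => (mF n).1) (int Y bY); rewrite /= => ->.
  by apply: eq_eseriesr => n _; rewrite !ex_on ?(mF n).2//; exact: (mF n).1.
Qed.

Context d' (T' : measurableType d') (I : Type) (B : set I) (V : I -> {RV P >-> T'}).
Local Notation G := (sigma_family B V).
Hypothesis Gm : G `<=` measurable.

Let GI A1 A2 : G A1 -> G A2 -> G (A1 `&` A2).
Proof. exact: (@measurableI _ (g_sigma_algebraType _)). Qed.

(** The event C' < C is a countable union, over rationals q < r, of the events where C > r and C' <
    q. Each is null: the difference is at least r - q there, but integrates to 0. *)
Lemma version_le (C C' : {RV P >-> R}) : bm C -> bm C' ->
  completion_measurable G C -> completion_measurable G C' ->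
  (forall A, G A -> ex P (fun w => C w * \1_A w) = ex P (fun w => C' w * \1_A w)) ->
  {ae P, forall w, C w <= C' w}.
Proof.
move=> bC bC' cC cC' CC'.
pose E (r q : R) := C @^-1` `]r, +oo[%classic `&` C' @^-1` `]-oo, q[%classic.
have null (r q : R) : q < r -> P.-negligible (E r q).
  move=> qr.
  (* The half-line events lie only in the completion of G; each is replaced by a member of G up to a
     null set. *)
  have [|B1 [Z1 [GB1 GZ1 Z10 BZ1]]] := cC (C @^-1` `]r, +oo[%classic).
    by exists `]r, +oo[%classic; [exact: measurable_itv|rewrite setTI].
  have [|B2 [Z2 [GB2 GZ2 Z20 BZ2]]] := cC' (C' @^-1` `]-oo, q[%classic).
    by exists `]-oo, q[%classic; [exact: measurable_itv|rewrite setTI].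
  have mE : measurable (E r q).
    by apply: measurableI; apply: measurable_preim => //; exact: measurable_itv.
  have mB : measurable (B1 `&` B2) by apply: measurableI; exact: Gm.
  have bI (D : set T) : measurable D -> bm (\1_D : T -> R).
    by move=> mD; exact/um_bm/um_indic.
  have EB (X : T -> R) : bm X -> ex P (fun w => X w * \1_(E r q) w) =
      ex P (fun w => X w * \1_(B1 `&` B2) w).
    move=> bX; apply: ae_eq_ex; [exact: (bmM bX (bI _ mE)).1|exact: (bmM bX (bI _ mB)).1|].
    exists (Z1 `|` Z2); split.
    - by apply: measurableU; exact: Gm.
    - apply: null_set_setU => //; exact: Gm.
    - move=> w /= h; apply: contrapT => /not_orP[n1 n2]; apply: h.
      congr (_ * _); apply: indicPE; rewrite in_setI.
      have e1 : (C @^-1` `]r, +oo[%classic) w <-> w \in B1.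
        rewrite inE; split=> h; apply: contrapT => h'; apply: n1; apply: BZ1.
          by left.
        by right.
      have e2 : (C' @^-1` `]-oo, q[%classic) w <-> w \in B2.
        rewrite inE; split=> h; apply: contrapT => h'; apply: n2; apply: BZ2.
          by left.
        by right.
      by split=> [[/e1 -> /e2 ->]|/andP[/e1 ? /e2 ?]].
  have e0 : ex P (fun w => (C w - C' w) * \1_(E r q) w) = 0.
    rewrite EB; last exact: bmB.
    have -> : (fun w => (C w - C' w) * \1_(B1 `&` B2) w) =
        (fun w => C w * \1_(B1 `&` B2) w - C' w * \1_(B1 `&` B2) w).
      by apply/funext => w; ring.
    by rewrite exB; [rewrite CC' ?subrr//; exact: GI|exact: bmM (bI _ mB)|exact: bmM (bI _ mB)].
  have : (r - q) * ex P \1_(E r q) <= 0.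
    rewrite -e0 -exZ; last exact: bI.
    apply: ex_le; [apply: bmM; [exact: bm_cst|exact: bI]|
      by apply: bmM; [exact: bmB|exact: bI]|move=> w].
    rewrite indicE; case: (boolP (w \in _)); last by rewrite !mulr0.
    rewrite inE => -[/=]; rewrite !in_itv/= andbT => h1 h2; rewrite !mulr1; lra.
  rewrite pmulr_rle0 ?subr_gt0// => e1.
  have e2 : ex P \1_(E r q) = 0.
    by apply/eqP; rewrite eq_le e1/=; case/andP: (ex_um P (um_indic mE)).
  have PE : P (E r q) = 0%E.
    by have := indic_fin P mE; rewrite e2.
  exact: (ex_intro _ (E r q) (And3 mE PE (@subset_refl _ _))).
pose F (p : rat * rat) : set T :=
  if p.2 < p.1 then E (ratr p.1) (ratr p.2) else set0.
have nF p : P.-negligible (F p).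
  by rewrite /F; case: ifPn => pp; [apply: null; rewrite ltr_rat|exact: negligible_set0].
apply: negligibleS (negligible_bigcup_count nF) => w /= /negP; rewrite -ltNge => CC.
have [b] := rat_in_itvoo CC; rewrite in_itv/= => /andP[b1 b2].
have [a] := rat_in_itvoo b2; rewrite in_itv/= => /andP[a1 a2].
exists (a, b); first by [].
rewrite /F /=; move: a1; rewrite ltr_rat => ->; split=> /=; first by rewrite in_itv/= andbT.
by rewrite in_itv/=.
Qed.

Lemma version_unique (C C' : {RV P >-> R}) : bm C -> bm C' ->
  completion_measurable G C -> completion_measurable G C' ->
  (forall A, G A -> ex P (fun w => C w * \1_A w) = ex P (fun w => C' w * \1_A w)) ->
  {ae P, forall w, C w = C' w}.
Proof.
move=> bC bC' cC cC' CC'.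
have h1 := version_le bC bC' cC cC' CC'.
have h2 : {ae P, forall w, C' w <= C w}.
  by apply: version_le => // A GA; rewrite CC'.
by apply: filterS2 h1 h2 => w ? ?; apply/le_anti/andP.
Qed.

End versions.

(** X - X^2 is nonnegative with mean 0, so X is almost surely 0 or 1. *)
Lemma distribution01 {R : realType} d (T : measurableType d)
    (P : probability T R) (X : T -> R) (m : R) : um X -> ex P X = m ->
  ex P (fun w => X w ^+ 2) = m ->
  forall A : set R, measurable A ->
    P (X @^-1` A) = (m * \1_A 1 + (1 - m) * \1_A 0)%:E.
Proof.
move=> uX Xm X2m A mA.
have bX := um_bm uX; have bX2 := bm_sq bX.
have X01 : {ae P, forall w, X w - X w ^+ 2 = 0}.
  apply: ex_eq0; [exact: bmB| |by rewrite exB// Xm X2m subrr].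
  by move=> w; have /andP[? ?] := uX.2 w; rewrite subr_ge0 expr2 ler_piMl.
have mXA : measurable (X @^-1` A) by apply: measurable_preim => //; exact: uX.1.
rewrite (indic_fin P mXA); congr (_%:E).
have -> : ex P \1_(X @^-1` A) = ex P (fun w => \1_A 1 * X w + \1_A 0 * (1 - X w)).
  apply: ae_eq_ex.
  - exact: (um_indic _).1.
  - apply: measurable_funD; apply: measurable_funM => //; try exact: measurable_cst.
      exact: uX.1.
    exact: (umC uX).1.
  apply: filterS X01 => w /eqP.
  have -> : X w - X w ^+ 2 = X w * (1 - X w) by ring.
  have XA : \1_(X @^-1` A) w = \1_A (X w) :> R.
    by rewrite !indicE; congr ((nat_of_bool _)%:R); apply/idP/idP; rewrite !inE.
  rewrite mulf_eq0 subr_eq0 => /orP[|] /eqP Xw; first by rewrite XA Xw; ring.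
  by rewrite XA -Xw; ring.
have b1 : bm (fun _ : T => 1 : R) by exact: bm_cst.
rewrite exD.
- rewrite !exZ//; last exact: bmB.
  by rewrite exB// ex_cst Xm; ring.
- by apply: bmM => //; exact: bm_cst.
- by apply: bmM; [exact: bm_cst|exact: bmB].
Qed.

(** * Almost sure convergence from fast L2 convergence *)

Section fast_convergence.
Context {R : realType} d (T : measurableType d) (P : probability T R).

Lemma geom_series_le (n : nat) : \sum_(k < n) (2^-1 : R) ^+ k <= 2.
Proof.
suff : \sum_(k < n) (2^-1 : R) ^+ k = 2 - 2 * 2^-1 ^+ n.
  move=> ->; have : 0 <= (2^-1 : R) ^+ n by rewrite exprn_ge0.
  lra.
elim: n => [|n IH]; first by rewrite big_ord0 expr0; ring.
by rewrite big_ord_recr/= IH exprS; field.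
Qed.

Lemma sum_bounded_cvg (a : nat -> R) (M : R) :
  (forall n, \sum_(k < n) `|a k.+1 - a k| <= M) -> cvgn a.
Proof.
move=> aM.
have : cvgn (series (fun k => a k.+1 - a k)).
  apply: normed_cvg.
  suff : cvgn (fun n => \sum_(k < n) `|a k.+1 - a k|).
    by congr (cvgn _); apply/funext => n; rewrite /normed_series_of/= /series/= big_mkord.
  apply: nondecreasing_is_cvgn; last by exists M => _ [n _ <-].
  by apply/nondecreasing_seqP => n; rewrite big_ord_recr/= lerDl.
move=> /cvg_ex [l sl]; apply/cvg_ex; exists (a 0%N + l).
have : (fun n => a 0%N + series (fun k => a k.+1 - a k) n) @ \oo --> a 0%N + l.
  by apply: cvgD => //; exact: cvg_cst.
apply: cvg_trans; apply: near_eq_cvg; apply: nearW => n.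
by rewrite /series/= telescope_sumr//; ring.
Qed.

(* Square-summability with geometric weights suffices: [2 |x| <= c + x^2 / c]. *)
Lemma ae_cvg_fast (X : nat -> T -> R) : (forall k, bm (X k)) ->
  (forall k, ex P (fun w => (X k.+1 w - X k w) ^+ 2) <= (2^-1 ^+ k) ^+ 2) ->
  {ae P, forall w, cvgn (X^~ w)}.
Proof.
move=> bX dX; pose c k : R := 2^-1 ^+ k.
have c0 k : 0 < c k by rewrite exprn_gt0.
pose g k w := (c k)^-1 * (X k.+1 w - X k w) ^+ 2.
have g0 k w : 0 <= g k w by rewrite mulr_ge0 ?sqr_ge0// invr_ge0 ltW.
have bg k : bm (g k) by apply: bmM; [exact: bm_cst|apply/bm_sq/bmB].
have eg k : ex P (g k) <= c k.
  rewrite exZ; last by apply/bm_sq/bmB.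
  by rewrite mulrC ler_pdivrMr// -expr2.
have mg k : measurable_fun setT (EFin \o g k) by exact/measurable_EFinP/(bg k).1.
have fg : P.-integrable setT (fun w => \sum_(k <oo) (g k w)%:E)%E.
  apply/integrableP; split.
    by apply: ge0_emeasurable_sum => [k w _ _|k _]; [rewrite lee_fin|exact: mg].
  rewrite (eq_integral (fun w => \sum_(k <oo) (g k w)%:E)%E); last first.
    move=> w _; rewrite gee0_abs//; apply: nneseries_ge0 => k _ _.
    by rewrite lee_fin.
  rewrite (@integral_nneseries _ _ _ P setT measurableT (fun k w => (g k w)%:E))//; last first.
    by move=> k w _; rewrite lee_fin.
  apply: (@le_lt_trans _ _ 2%:E); last by rewrite ltry.
  apply: lime_le.
    by apply: is_cvg_nneseries => k _ _; apply: integral_ge0 => w _; rewrite lee_fin.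
  apply: nearW => n.
  rewrite (eq_bigr (fun k => (ex P (g k))%:E)); last by move=> k _; exact: ex_fin.
  rewrite sumEFin lee_fin big_mkord.
  apply: le_trans (geom_series_le n); apply: ler_sum => k _; exact: eg.
have := integrable_ae measurableT fg; apply: filterS => w /(_ I) wfin.
pose M := fine (\sum_(k <oo) (g k w)%:E)%E.
apply: (@sum_bounded_cvg _ (2 + M)) => n.
apply: (@le_trans _ _ (\sum_(k < n) (c k + g k w))).
  apply: ler_sum => k _; set x := X _ w - X _ w.
  rewrite /g -/x -(ler_pM2l (c0 k)) mulrDr mulrA divff ?lt0r_neq0// mul1r.
  have : x ^+ 2 = `|x| ^+ 2 by rewrite real_normK ?num_real.
  move=> ->; have h : (c k - `|x|) ^+ 2 = c k * c k - 2 * (c k * `|x|) + `|x| ^+ 2.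
    by ring.
  have : 0 <= (c k - `|x|) ^+ 2 by exact: sqr_ge0.
  have : 0 <= c k * `|x| by rewrite mulr_ge0// ltW.
  by rewrite h; lra.
rewrite big_split; apply: lerD; first exact: geom_series_le.
rewrite -lee_fin /M fineK// -sumEFin.
rewrite -(big_mkord xpredT (fun k => (g k w)%:E)).
by apply: nneseries_lim_ge => k _ _; rewrite lee_fin.
Qed.

End fast_convergence.

Section endogenous.
Context {R : realType} d0 (T0 : measurableType d0) (P0 : probability T0 R)
  (N : {RV P0 >-> xnat}) (mup mum : R).
Local Notation H := (pgf N).
Hypothesis N0 : forall w, N w <> Some 0%N.
Hypothesis Hconvex : strictly_convex01 H.
Hypothesis cyc : two_cycle (fun t => 1 - H t) mup mum.

Local Notation K := (moment_map N mup mum).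
Local Notation xs := (moment_seq N mup mum).
Local Notation xoo := (moment_lim N mup mum).
Local Notation tree := (fam (seq nat) xnat).
Local Notation rde := (@rde R _ xnat idfun).

(* [iter_mean n] is the conditional expectation of the root variable given the
   family sizes in the first [2n] levels. *)
Definition iter_mean (n : nat) : tree -> R := iter n rde (fun=> mup).

Let mid : measurable_fun setT (idfun : xnat -> xnat).
Proof. exact: measurable_id. Qed.

Lemma um_mup : um (fun _ : tree => mup).
Proof. by apply: um_cst; exact: (cyc01 cyc).1. Qed.

Lemma um_iter_mean n : um (iter_mean n).
Proof. by apply: um_iter_rde => //; exact: um_mup. Qed.

(** The squared L2 distance of consecutive iterates along phi is at most xoo - xs (phi k), and the
    criterion for almost sure convergence wants it below (2^-k)^2. Being chosen from moments alone,
    phi depends on no probability space and no vertex. *)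
Lemma fast_index_ex : exists phi : nat -> nat,
  [/\ forall k, (k < phi k)%N, forall k, (phi k <= phi k.+1)%N &
      forall k, xoo - xs (phi k) <= (2^-1 ^+ k) ^+ 2].
Proof.
have : forall k, exists n, forall m, (n <= m)%N -> xoo - xs m <= (2^-1 ^+ k) ^+ 2.
  move=> k; have /cvgrPdist_le := moment_seq_cvg cyc.
  have c0 : 0 < ((2^-1 : R) ^+ k) ^+ 2 by rewrite !exprn_gt0.
  move=> /(_ _ c0) [n _ nP]; exists n => m nm.
  by apply: le_trans (nP m nm); rewrite /= ler_norm.
move=> /choice [psi psiP].
exists (fun k => \sum_(j < k.+1) (psi j).+1)%N; split=> k.
- elim: k => [|k IH]; first by rewrite big_ord1.
  by rewrite big_ord_recr/= addnS ltnS (leq_trans IH)// leq_addr.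
- by rewrite [leqRHS]big_ord_recr/= leq_addr.
- by apply: psiP; rewrite big_ord_recr/= addnS (leq_trans (leq_addl _ _) (leqnSn _)).
Qed.

Definition fast_index : nat -> nat := sval (cid fast_index_ex).
Local Notation phi := fast_index.

Lemma fast_indexP : [/\ forall k, (k < phi k)%N, forall k, (phi k <= phi k.+1)%N &
      forall k, xoo - xs (phi k) <= (2^-1 ^+ k) ^+ 2].
Proof. exact: svalP (cid fast_index_ex). Qed.

Lemma fast_index_cvg : phi @ \oo --> \oo.
Proof.
have [kphi _ _] := fast_indexP.
apply/cvgnyPge => A; exists A => // k Ak /=.
by apply: leq_trans (ltnW (kphi k)).
Qed.

(** The upper limit is defined and measurable also on trees where the iterates diverge; the clip
    makes the bounds immediate. *)
Definition mean_lim (t : tree) : R := clip01 (limn_sup (fun k => iter_mean (phi k) t)).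
Local Notation Phi := mean_lim.

Lemma um_mean_lim : um Phi.
Proof.
apply: (@um_comp _ _ _ _ _ _ (fun t => limn_sup (fun k => iter_mean (phi k) t)) _ um_clip01).
apply: measurable_fun_limn_sup.
- move=> t _; exists 1 => _ [k _ <-].
  by have /andP[] := (um_iter_mean (phi k)).2 t.
- move=> t _; exists 0 => _ [k _ <-].
  by have /andP[] := (um_iter_mean (phi k)).2 t.
- by move=> k; exact: (um_iter_mean (phi k)).1.
Qed.

Lemma mean_lim_cvg t : cvgn (fun k => iter_mean (phi k) t) ->
  iter_mean (phi k) t @[k --> \oo] --> Phi t.
Proof.
move=> ct; rewrite /mean_lim cvg_limn_supE//.
have l1 : limn (fun k => iter_mean (phi k) t) <= 1.
  by apply: limr_le => //; apply: nearW => k; have /andP[] := (um_iter_mean (phi k)).2 t.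
have l0 : 0 <= limn (fun k => iter_mean (phi k) t).
  by apply: limr_ge => //; apply: nearW => k; have /andP[] := (um_iter_mean (phi k)).2 t.
by rewrite clip01_id// l0.
Qed.

Context d (T : measurableType d) (P : probability T R)
  (Nu : seq nat -> {RV P >-> xnat}).
Hypothesis iid : iid_copies N Nu.

Local Notation tau := (the_tree Nu).
Local Notation em := (em Nu).

Let iV := iid.2.

Let lV u v : same_law (Nu u) (Nu v).
Proof. by move=> A mA; rewrite iid.1// iid.1. Qed.

Let lN (B : set xnat) : P (Nu [::] @^-1` (idfun @^-1` B)) = P0 (N @^-1` B).
Proof. exact: iid.1. Qed.

Lemma em_mup : em (fun=> mup) = mup.
Proof. exact: ex_cst. Qed.

Lemma em_iter_mean n : em (iter_mean n) = mup.
Proof.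
apply: (em_iter_rde mid iV lV lN cyc); [exact: um_mup|exact: em_mup].
Qed.

Lemma bm_em (g : tree -> R) : um g -> bm (g \o tau).
Proof. by move=> ug; apply/um_bm/um_comp => //; exact: measurable_tree. Qed.

(** A martingale identity: the mixed moment depends on the smaller index only. The m common steps
    follow the recursion, and before them one factor is the constant mup, so that the start is
    mup^2. *)
Lemma em_iter_meanM m n : (m <= n)%N ->
  em (fun t => iter_mean n t * iter_mean m t) = xs m.
Proof.
move=> mn; rewrite -(subnKC mn) /iter_mean iterD.
have ei := em_iter_mean (n - m).
rewrite (em_iter_rdeM mid iV lV lN cyc m (um_iter_mean (n - m)) um_mup ei em_mup).
rewrite /moment_seq; congr (iter _ _ _).
rewrite -/(iter_mean _) expr2 -[X in _ = X * _]ei /em mulrC -exZ; last exact/bm_em/um_iter_mean.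
by apply: eq_ex => w /=; rewrite mulrC.
Qed.

(** By the martingale identity the squared distance of consecutive terms is xs (phi k.+1) - xs (phi
    k). *)
Lemma mean_lim_ae :
  {ae P, forall w, iter_mean (phi k) (tau w) @[k --> \oo] --> Phi (tau w)}.
Proof.
have [kphi phiS phi2] := fast_indexP.
have bi k : bm (iter_mean (phi k) \o tau) by exact/bm_em/um_iter_mean.
have : {ae P, forall w, cvgn (fun k => (iter_mean (phi k) \o tau) w)}.
  apply: (@ae_cvg_fast _ _ _ _ (fun k => iter_mean (phi k) \o tau)) => // k.
  rewrite ex_sqB//.
  have e1 j : ex P (fun w => (iter_mean (phi j) \o tau) w ^+ 2) = xs (phi j).
    by rewrite -(em_iter_meanM (leqnn (phi j))); apply: eq_ex => w /=; rewrite expr2.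
  have e2 : ex P (fun w => (iter_mean (phi k.+1) \o tau) w * (iter_mean (phi k) \o tau) w) = xs (phi k).
    by rewrite -(em_iter_meanM (phiS k)).
  rewrite !e1 e2; apply: le_trans (phi2 k).
  have := moment_seq_le_lim cyc (phi k.+1); lra.
by apply: filterS => w; exact: mean_lim_cvg.
Qed.

Lemma em_mean_limM (g : tree -> R) : um g ->
  em (fun t => iter_mean (phi k) t * g t) @[k --> \oo] --> em (fun t => Phi t * g t).
Proof.
move=> ug; have bg := bm_em ug.
have b (h : tree -> R) : um h -> um ((fun t => h t * g t) \o tau).
  by move=> uh; apply: um_comp; [exact: measurable_tree|exact: umM].
apply: (@ex_cvg _ _ _ _ _ _ 1).
- by move=> k; exact: (b _ (um_iter_mean _)).1.
- exact: (b _ um_mean_lim).1.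
- move=> k w; have /andP[? ?] := (b _ (um_iter_mean (phi k))).2 w.
  by rewrite ger0_norm.
- by apply: filterS mean_lim_ae => w cw; apply: cvgMl.
Qed.

(** The mixed moments converging to the left-hand side are constant from k = n on. *)
Lemma em_mean_lim_mean n : em (fun t => Phi t * iter_mean n t) = xs n.
Proof.
have [kphi _ _] := fast_indexP.
apply: (cvg_unique _ (em_mean_limM (um_iter_mean n))) => //.
apply: cvg_near_cst; exists n => // k nk.
by rewrite em_iter_meanM//; apply: leq_trans (ltnW (kphi k)).
Qed.

Lemma em_mean_lim : em Phi = mup.
Proof.
have u1 : um (fun _ : tree => 1 : R) by apply: um_cst; rewrite ler01 lexx.
have one g : em (fun t => g t * 1) = em g by apply: eq_ex => w /=; rewrite mulr1.
rewrite -one; apply: (cvg_unique _ (em_mean_limM u1)) => //.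
by apply: cvg_near_cst; apply: nearW => k; rewrite one em_iter_mean.
Qed.

Lemma moment_seq_fast : xs (phi k) @[k --> \oo] --> xoo.
Proof. exact: cvg_comp fast_index_cvg (moment_seq_cvg cyc). Qed.

Lemma em_mean_lim_sq : em (fun t => Phi t * Phi t) = xoo.
Proof.
apply: (cvg_unique _ (em_mean_limM um_mean_lim)) => //.
rewrite (_ : (fun k => _) = fun k => xs (phi k)); first exact: moment_seq_fast.
apply/funext => k; rewrite -em_mean_lim_mean; apply: eq_ex => w /=.
by rewrite mulrC.
Qed.

(** An iterate is [rde] of the previous one, so its mixed moment with [rde Phi] follows by the
    recursion from that of the previous iterate with Phi. *)
Lemma em_rde_mean_lim : em (fun t => Phi t * rde Phi t) = xoo.
Proof.
have ur := um_rde mid um_mean_lim.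
apply: (cvg_unique _ (em_mean_limM ur)) => //.
rewrite (_ : (fun k => _) = fun k => xs (phi k)); first exact: moment_seq_fast.
apply/funext => k; have [kphi _ _] := fast_indexP.
case: (phi k) (kphi k) => // n _; rewrite /iter_mean iterS -/(iter_mean n).
rewrite (em_rdeM mid iV lV lN cyc (um_iter_mean n) um_mean_lim (em_iter_mean n) em_mean_lim).
rewrite /moment_seq iterS; congr K; rewrite -/(xs n) -em_mean_lim_mean.
by apply: eq_ex => w /=; rewrite mulrC.
Qed.

(** Infinite products are not continuous, so the equation is not passed to the limit. Instead the
    three moments in E (Phi - rde Phi)^2 are all xoo; for the square of [rde Phi] this is the fixed
    point equation of xoo. *)
Lemma mean_lim_rde (u : seq nat) : {ae P, forall w, Phi (subtree u (tau w)) =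
  rde_map (Nu u w) (fun i => Nu (rcons u i) w)
    (fun i j => Phi (subtree (rcons (rcons u i) j) (tau w)))}.
Proof.
have ur := um_rde mid um_mean_lim.
pose D (t : tree) := (Phi t - rde Phi t) ^+ 2.
have bD : bm D by exact: bm_sq (bmB (um_bm um_mean_lim) (um_bm ur)).
have eD : em D = 0.
  rewrite /em (ex_sqB P (bm_em um_mean_lim) (bm_em ur)).
  have := em_rde_mean_lim; rewrite /em /comp => ->.
  have -> : ex P (fun w => Phi (tau w) ^+ 2) = xoo.
    by rewrite -em_mean_lim_sq; apply: eq_ex => w /=; rewrite expr2.
  have -> : ex P (fun w => rde Phi (tau w) ^+ 2) = xoo.
    rewrite -[RHS](moment_lim_fix N0 Hconvex cyc) -em_mean_lim_sq.
    rewrite -(em_rdeM mid iV lV lN cyc um_mean_lim um_mean_lim em_mean_lim em_mean_lim).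
    by apply: eq_ex => w /=; rewrite expr2.
  ring.
have := em_subtree iV lV u bD; rewrite eD.
have bDu : bm (D \o (subtree u \o tau)).
  split; last by have [_ [M DM]] := bD; exists M => w; exact: DM.
  apply: measurableT_comp bD.1 _.
  exact: measurableT_comp (measurable_subtree u) (measurable_tree Nu).
move=> /(ex_eq0 bDu (fun w => sqr_ge0 _)); apply: filterS => w /eqP.
by rewrite /D/= sqrf_eq0 subr_eq0 => /eqP ->; exact: rdeE.
Qed.

End endogenous.

Lemma expectation_ex {R : realType} d (T : measurableType d)
    (P : probability T R) (X : T -> R) : bm X -> ('E_P[X] = (ex P X)%:E)%E.
Proof. by move=> bX; rewrite unlock ex_fin. Qed.

Section endogenous_solution.
Context {R : realType} d0 (T0 : measurableType d0) (P0 : probability T0 R)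
  (N : {RV P0 >-> xnat}) (mup mum : R).
Local Notation H := (pgf N).
Hypothesis N0 : forall w, N w <> Some 0%N.
Hypothesis Hconvex : strictly_convex01 H.
Hypothesis cyc : two_cycle (fun t => 1 - H t) mup mum.
Context d (T : measurableType d) (P : probability T R)
  (Nu : seq nat -> {RV P >-> xnat}).
Hypothesis iid : iid_copies N Nu.

Local Notation xs := (moment_seq N mup mum).
Local Notation xoo := (moment_lim N mup mum).
Local Notation tree := (fam (seq nat) xnat).
Local Notation rde := (@rde R _ xnat idfun).
Local Notation tau := (the_tree Nu).
Local Notation em := (em Nu).
Local Notation Phi := (mean_lim cyc).
Local Notation imean := (iter_mean mup).
Local Notation level k := [set v : seq nat | (size v < k)%N].

Let iV := iid.2.

Let lV u v : same_law (Nu u) (Nu v).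
Proof. by move=> A mA; rewrite iid.1// iid.1. Qed.

Lemma measurable_subtree_of (u : seq nat) (g : tree -> R) : measurable_fun setT g ->
  measurable_fun setT (g \o (subtree u \o tau)).
Proof.
move=> mg; apply: measurableT_comp mg _.
exact: measurableT_comp (measurable_subtree u) (measurable_tree Nu).
Qed.

Lemma um_subtree_of (u : seq nat) (g : tree -> R) : um g ->
  um (g \o (subtree u \o tau)).
Proof.
move=> ug; split; last by move=> w; exact: ug.2.
exact: measurable_subtree_of ug.1.
Qed.

Definition endo (u : seq nat) : {RV P >-> R} :=
  mkmfun (measurable_subtree_of u (um_mean_lim cyc).1).

Lemma um_endo u : um (endo u).
Proof. exact: um_subtree_of (um_mean_lim cyc). Qed.

Lemma endo_sigma u (A : set R) : measurable A ->
  sigma_family (block u) Nu (endo u @^-1` A).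
Proof. by move=> mA; apply: subtree_event => //; exact: (um_mean_lim cyc).1. Qed.

Lemma endo_mean u : ex P (endo u) = mup.
Proof.
rewrite -[RHS](em_mean_lim cyc iid).
by apply: em_subtree => //; exact/um_bm/um_mean_lim.
Qed.

Lemma endo_sq u : ex P (fun w => endo u w ^+ 2) = xoo.
Proof.
rewrite -[RHS](em_mean_lim_sq cyc iid).
have bsq : bm (fun t => Phi t * Phi t) by apply: bmM; exact/um_bm/um_mean_lim.
rewrite -(em_subtree iV lV u bsq); apply: eq_ex => w /=; exact: expr2.
Qed.

Lemma endo_endogenous : endogenous_solution Nu endo.
Proof.
split; last first.
  move=> u _ _ [A mA <-]; rewrite setTI; exists (endo u @^-1` A), set0; split.
  - exact: (sigma_family_sub (@subsetT _ _) (endo_sigma mA)).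
  - exact: sigma_algebra0.
  - exact: measure0.
  - by rewrite !setDv setU0.
split.
- by move=> u w _; exact: (um_endo u).2.
- move=> u v _ _ A mA.
  have mE : measurable (Phi @^-1` A).
    by apply: measurable_preim => //; exact: (um_mean_lim cyc).1.
  have := subtree_law iV lV u mE; have := subtree_law iV lV v mE.
  by rewrite /distribution /pushforward /= => <-.
- move=> n s A us sn mA.
  have := @indep_many_blocks _ _ _ P _ _ _ _ setT set0 block Nu s setT
    (fun u => endo u @^-1` A u) iV.
  rewrite setIT probability_setT mule1; apply => //.
  + move=> v w u vs ws; apply: block_disj.
    by rewrite (sn _ vs) (sn _ ws).
  + exact: (@measurableT _ (g_sigma_algebraType _)).
  + by move=> u us'; apply: endo_sigma; exact: mA.
- move=> n A B sA sB.
  apply: (indep_blocks (B1 := [set u | (n.*2 <= size u)%N]) (B2 := level n.*2) iV) => //.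
    by move=> u /= nu; rewrite ltnNge nu.
  move: A sA; apply: smallest_sub; first exact: smallest_sigma_algebra.
  move=> _ [u un [A mA <-]]; rewrite setTI.
  apply: (sigma_family_sub _ (endo_sigma mA)) => _ [v ->] /=.
  by rewrite size_cat un leq_addr.
- by move=> u _; exact: mean_lim_rde.
Qed.

(** * Comparison of an arbitrary solution with the endogenous one *)

Section tree_solution.
Variable X : seq nat -> {RV P >-> R}.
Hypothesis solX : tree_solution Nu X.
Hypothesis meanX : ex P (X [::]) = mup.

(** A solution is unconstrained at odd levels and may even leave [0, 1] there, so it is replaced by
    0. *)
Let Z (u : seq nat) (w : T) : R := if odd (size u) then 0 else X u w.

Let uZ u : um (Z u).
Proof.
rewrite /Z; case: (boolP (odd (size u))) => ou; first by apply: um_cst; rewrite lexx ler01.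
by split; [exact: measurable_funPT|move=> w; exact: (tree_sol_01 solX)].
Qed.

Lemma tree_solution_um u : ~~ odd (size u) -> um (X u).
Proof.
by split; [exact: measurable_funPT|move=> w; exact: (tree_sol_01 solX)].
Qed.

Lemma tree_solution_mean u : ~~ odd (size u) -> ex P (X u) = mup.
Proof.
move=> ou; have u0 := tree_solution_um (isT : ~~ odd (size [::])).
have e v : ~~ odd (size v) -> ex P (X v) = ex P (clip01 \o X v).
  by move=> ov; apply: eq_ex => w /=; rewrite clip01_id//; exact: (tree_sol_01 solX).
rewrite -meanX !e//; apply: eq_law_ex => // [A mA|]; last exact/um_bm/um_clip01.
exact: (tree_sol_law solX).
Qed.

Let agree0 (n : nat) : agree P (sigma_family (level n.*2) Nu)
  (fun v => size v == n.*2) Z (fun v w => imean 0 (subtree v (tau w))).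
Proof.
move=> s A us sn sA.
have mA : measurable A by exact: sigma_family_measurable sA.
have sizes v : v \in s -> size v = n.*2 by move=> vs; exact/eqP/(allP sn).
have ZX v : v \in s -> Z v = X v.
  by move=> vs; rewrite /Z sizes// odd_double.
rewrite (ex_prod_indep us mA uZ).
- rewrite [in LHS]big_seq (eq_bigr (fun=> mup)) -?big_seq; last first.
    by move=> v vs; rewrite ZX// tree_solution_mean// sizes// odd_double.
  by rewrite -exZ//; exact/um_bm/um_indic.
- move=> B mB.
  have sX : [set` s] `<=` [set u | size u = n.*2] by move=> v; exact: sizes.
  have EX : \bigcap_(i in [set` s]) Z i @^-1` B i = \bigcap_(i in [set` s]) X i @^-1` B i.
    by apply: eq_bigcapr => v vs; rewrite ZX.
  rewrite EX (tree_sol_indepN solX (n := n))//; last first.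
    apply: (@measurable_bigcap_seq _ (g_sigma_algebraType _)) => v vs.
    by apply: sub_sigma_algebra; exists v; [exact: sX|exists (B v) => //; rewrite setTI].
  rewrite (tree_sol_indep solX us sX)//; congr (_ * _)%E.
  by rewrite !big_seq; apply: eq_bigr => v vs; rewrite ZX.
Qed.

Let agree_ae (G : set (set T)) (D : pred (seq nat)) (Y Y' W : seq nat -> T -> R) :
  G `<=` measurable -> (forall v, um (Y v)) -> (forall v, um (Y' v)) ->
  (forall v, D v -> {ae P, forall w, Y v w = Y' v w}) ->
  agree P G D Y W -> agree P G D Y' W.
Proof.
move=> Gm uY uY' YY' YW s A us Ds GA; rewrite -YW//.
apply: ae_eq_ex.
- by apply: (umM _ _).1; [exact: um_prod|exact/um_indic/Gm].
- by apply: (umM _ _).1; [exact: um_prod|exact/um_indic/Gm].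
have : {ae P, forall w, \prod_(v <- s) Y v w = \prod_(v <- s) Y' v w}.
  elim: s {us} Ds => [|v s IH] /=.
    by move=> _; apply: aeW => w; rewrite !big_nil.
  move=> /andP[/YY' Dv /IH Ds]; apply: filterS2 Dv Ds => w e1 e2.
  by rewrite !big_cons e1 e2.
by apply: filterS => w ->.
Qed.

(** At level 2(m + l), where the conditioning stops, the solution is replaced by its mean. Then one
    climbs towards the root: applying the RDE to both sides turns [imean l] on level 2m + 2 into
    [imean l.+1] on level 2m. *)
Let agree_level (l m : nat) : agree P (sigma_family (level (m + l).*2) Nu)
  (fun v => size v == m.*2) Z (fun v w => imean l (subtree v (tau w))).
Proof.
elim: l m => [|l IH] m; first by rewrite addn0; exact: agree0.
have Gm : sigma_family (level (m + l.+1).*2) Nu `<=` measurable.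
  exact: sigma_family_measurable.
have ui k v : um (fun w => imean k (subtree v (tau w))).
  exact: um_subtree_of (um_iter_mean cyc k).
have mN u : measurable_fun setT (Nu u) by exact: measurable_funPT.
have step (k : nat) (Y W : seq nat -> T -> R) : (k < (m + l.+1).*2)%N ->
    (forall v, um (Y v)) -> (forall v, um (W v)) ->
    agree P (sigma_family (level (m + l.+1).*2) Nu) (fun v => size v == k.+1) Y W ->
    agree P (sigma_family (level (m + l.+1).*2) Nu) (fun v => size v == k)
      (fun u w => 1 - xprod (Nu u w) (fun i => Y (rcons u i) w))
      (fun u w => 1 - xprod (Nu u w) (fun i => W (rcons u i) w)).
  move=> km uY uW YW; apply: agreeC => //.
  - by move=> v; apply: um_xprod.
  - by move=> v; apply: um_xprod.
  apply: (agree_step Gm (DU := fun v : seq nat => size v == k) (c := rcons) (N := Nu)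
    _ _ mN _ uY uW YW).
  - by move=> u i u' i' /rcons_inj [-> ->].
  - by move=> u i /eqP uk; rewrite size_rcons uk.
  - by move=> u A B /eqP uk sA; apply: sigma_family_node => //; rewrite uk.
have u2 (Y : seq nat -> T -> R) : (forall v, um (Y v)) ->
    forall v, um (fun w => 1 - xprod (Nu v w) (fun i => Y (rcons v i) w)).
  by move=> uY v; apply/umC/um_xprod.
have m2 : (m.*2.+1 < (m + l.+1).*2)%N.
  by rewrite addnS doubleS !ltnS leq_double leq_addr.
have := IH m.+1; rewrite addSnnS => /(step m.*2.+1 _ _ m2 uZ (ui l)).
move=> /(step m.*2 _ _ (ltnW m2) (u2 _ uZ) (u2 _ (ui l))) h.
have -> : (fun v w => imean l.+1 (subtree v (tau w))) =
  (fun u w => 1 - xprod (Nu u w) (fun i => 1 - xprod (Nu (rcons u i) w)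
    (fun j => imean l (subtree (rcons (rcons u i) j) (tau w))))).
  apply/funext => u; apply/funext => w; rewrite /iter_mean iterS; exact: rdeE.
(* The solution satisfies the RDE only almost surely. *)
apply: agree_ae h => //; first exact: (u2 _ (u2 _ uZ)).
move=> u /eqP um2; have := tree_sol_eq solX (u := u); rewrite um2 odd_double => /(_ isT).
apply: filterS => w; rewrite /Z um2 odd_double => ->.
by apply/esym; rewrite /rde_map; congr (1 - _); apply: eq_xprod => i _;
  congr (1 - _); apply: eq_xprod => j _; rewrite !size_rcons um2 /= odd_double.
Qed.

(** Over an event of finitely many levels, X u has the same integral as every late iterate, and the
    squared L2 distance from the n-th iterate to [endo u] is xoo - xs n. *)
Lemma tree_solution_given (u : seq nat) (A : set T) : ~~ odd (size u) ->
  sigma_family setT Nu A ->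
  ex P (fun w => X u w * \1_A w) = ex P (fun w => endo u w * \1_A w).
Proof.
move=> ou sA.
have bX := um_bm (tree_solution_um ou); have bE := um_bm (um_endo u).
pose m := (size u)./2.
have um2 : size u = m.*2 by rewrite -[LHS]odd_double_half (negbTE ou).
(* Events of finitely many levels: they generate, and are closed under intersection because the
   sigma-algebras increase. *)
pose G : set (set T) := \bigcup_k sigma_family (level k.*2) Nu.
have mono j k : (j <= k)%N ->
    sigma_family (level j.*2) Nu `<=` sigma_family (level k.*2) Nu.
  move=> jk; apply: sigma_family_sub => v /= vj; apply: leq_trans vj _.
  by rewrite leq_double.
have Gm : G `<=` measurable.
  by move=> B [k _ sB]; exact: sigma_family_measurable sB.
apply: (@ex_on_ext _ _ _ P _ _ G) => //.
- move=> B1 B2 [k1 _ s1] [k2 _ s2]; exists (maxn k1 k2) => //.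
  apply: (@measurableI _ (g_sigma_algebraType _)).
    by apply: mono s1; exact: leq_maxl.
  by apply: mono s2; exact: leq_maxr.
- by exists 0%N => //; exact: (@measurableT _ (g_sigma_algebraType _)).
- move=> B [k _ sB]; have mB := sigma_family_measurable sB.
  have bB : bm (\1_B : T -> R) by exact/um_bm/um_indic.
  have close n : (k <= n)%N ->
      (ex P (fun w => X u w * \1_B w) - ex P (fun w => endo u w * \1_B w)) ^+ 2
      <= xoo - xs n.
    move=> kn.
    have bI := um_bm (um_subtree_of u (um_iter_mean cyc n)).
    have sB' : sigma_family (level (m + n).*2) Nu B.
      by apply: mono sB; rewrite (leq_trans kn)// leq_addl.
    have := @agree_level n m [:: u] B isT; rewrite /= um2 eqxx => /(_ isT sB').
    have one (Y : seq nat -> T -> R) :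
       ex P (fun w => \prod_(v <- [:: u]) Y v w * \1_B w) = ex P (fun w => Y u w * \1_B w).
      by apply: eq_ex => w; rewrite big_seq1.
    rewrite !one /Z (negbTE ou) => ->.
    rewrite -exB; [|exact: bmM|exact: bmM].
    set Y := fun w => _; have bY : bm Y by apply: bmB; exact: bmM.
    apply: (le_trans (sq_ex_le P bY)).
    apply: (@le_trans _ _ (ex P (fun w => (imean n (subtree u (tau w)) - endo u w) ^+ 2))).
      apply: ex_le; [exact: bm_sq|by apply/bm_sq/bmB|move=> w].
      rewrite /Y -mulrBl exprMn indicE; case: (w \in B); rewrite ?expr1n ?mulr1//.
      by rewrite expr0n mulr0 sqr_ge0.
    rewrite ex_sqB// endo_sq.
    have e1 : ex P (fun w => imean n (subtree u (tau w)) ^+ 2) = xs n.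
      rewrite -(em_iter_meanM cyc iid (leqnn n)) -(em_subtree iV lV u).
        by apply: eq_ex => w /=; exact: expr2.
      by apply: bmM; exact/um_bm/(um_iter_mean cyc).
    have e2 : ex P (fun w => imean n (subtree u (tau w)) * endo u w) = xs n.
      rewrite -(em_mean_lim_mean cyc iid n) -(em_subtree iV lV u).
        by apply: eq_ex => w /=; exact: mulrC.
      by apply: bmM; [exact/um_bm/um_mean_lim|exact/um_bm/(um_iter_mean cyc)].
    by rewrite e1 e2; lra.
  apply/eqP; rewrite -subr_eq0 -sqrf_eq0 eq_le sqr_ge0 andbT.
  have : (fun n => xoo - xs n) @ \oo --> xoo - xoo.
    by apply: cvgB; [exact: cvg_cst|exact: moment_seq_cvg cyc].
  rewrite subrr => /cvgr_to_ge; apply; exists k => // n /= kn; exact: close.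
move: A sA; apply: smallest_sub; first exact: smallest_sigma_algebra.
move=> B [v _ vB]; apply: sub_sigma_algebra; exists (size v).+1 => //.
apply: sub_sigma_algebra; exists v => //=.
by rewrite -addnn ltn_addr.
Qed.

End tree_solution.

Lemma endogenous_solution_unique (C : seq nat -> {RV P >-> R}) (u : seq nat) :
  endogenous_solution Nu C -> ('E_P[C [::]] = mup%:E)%E -> ~~ odd (size u) ->
  {ae P, forall w, C u w = endo u w}.
Proof.
move=> [solC endC] meanC ou.
have uC v : ~~ odd (size v) -> um (C v) by exact: tree_solution_um solC v.
have {}meanC : ex P (C [::]) = mup.
  by apply: EFin_inj; rewrite -meanC expectation_ex//; exact/um_bm/uC.
apply: (version_unique (B := setT) (V := Nu)) => //.
- exact: sigma_family_measurable.
- exact/um_bm/uC.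
- exact/um_bm/um_endo.
- exact: endC.
- exact: endo_endogenous.2.
- by move=> A sA; exact: tree_solution_given.
Qed.

Lemma discrete_solution_mean (S : seq nat -> {RV P >-> R}) (u : seq nat) :
  discrete_solution Nu mup S -> ~~ odd (size u) ->
  [/\ um (S u), ex P (S u) = mup, ex P (fun w => S u w ^+ 2) = mup &
    forall w, S u w = \1_(S u @^-1` [set 1]) w].
Proof.
move=> [solS S01 S1] ou.
have SE w : S u w = \1_(S u @^-1` [set 1]) w.
  have [S0|S1'] := S01 u w ou.
    rewrite (@indicPE _ _ _ false) ?S0// /preimage/= S0; split=> // /eqP.
    by rewrite eq_sym oner_eq0.
  by rewrite (@indicPE _ _ _ true).
have mS : measurable (S u @^-1` [set 1]) by exact: measurable_preim.
have eS : ex P (S u) = mup.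
  rewrite (eq_ex _ SE); apply: EFin_inj; rewrite -(S1 u ou).
  by apply/esym; exact: indic_fin.
split => //; first exact: tree_solution_um solS u ou.
rewrite -eS; apply: eq_ex => w.
by have [->|->] := S01 u w ou; rewrite ?expr0n ?expr1n.
Qed.

Lemma discrete_solution_cond_prob (C S : seq nat -> {RV P >-> R}) (u : seq nat) :
  endogenous_solution Nu C -> ('E_P[C [::]] = mup%:E)%E ->
  discrete_solution Nu mup S -> ~~ odd (size u) ->
  is_cond_prob (sigma_family setT Nu) (S u @^-1` [set 1]) (C u).
Proof.
move=> [solC endC] meanC dS ou; split; first exact: endC.
move=> A sA; have mA : measurable A by exact: sigma_family_measurable sA.
have uC v : ~~ odd (size v) -> um (C v) by exact: tree_solution_um solC v.
have {}meanC : ex P (C [::]) = mup.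
  by apply: EFin_inj; rewrite -meanC expectation_ex//; exact/um_bm/uC.
have solS : tree_solution Nu S by case: dS.
have [_ meanS _ _] := discrete_solution_mean dS (isT : ~~ odd (size [::])).
have [uS _ _ SE] := discrete_solution_mean dS ou.
rewrite ex_on//; last exact/um_bm/uC.
rewrite (tree_solution_given solC meanC ou sA) -(tree_solution_given solS meanS ou sA).
have mS : measurable (S u @^-1` [set 1]) by exact: measurable_preim.
have mAS : measurable (A `&` S u @^-1` [set 1]) by exact: measurableI.
transitivity ((ex P \1_(A `&` S u @^-1` [set 1]))%:E)%E; last first.
  by apply/esym; exact: indic_fin.
by congr (_%:E); apply: eq_ex => w; rewrite SE setIC indicIE.
Qed.

(** The second moments are xoo for C and mup for S, which is 0-1 valued. If they coincide, C is
    almost surely 0-1 valued too and both laws are Bernoulli (mup). *)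
Lemma distinct_iff (C S : seq nat -> {RV P >-> R}) :
  endogenous_solution Nu C -> ('E_P[C [::]] = mup%:E)%E ->
  discrete_solution Nu mup S ->
  (~ same_law (C [::]) (S [::])) <-> xoo < mup.
Proof.
move=> endC meanC dS.
have o0 : ~~ odd (size ([::] : seq nat)) by [].
have CE := endogenous_solution_unique endC meanC o0.
have uC := tree_solution_um endC.1 o0.
have [uS eS eS2 _] := discrete_solution_mean dS o0.
have eC : ex P (C [::]) = mup.
  by apply: EFin_inj; rewrite -meanC expectation_ex//; exact/um_bm.
have uE := um_endo [::].
have eC2 : ex P (fun w => C [::] w ^+ 2) = xoo.
  rewrite -(endo_sq [::]); apply: ae_eq_ex.
  - exact: (bm_sq (um_bm uC)).1.
  - exact: (bm_sq (um_bm uE)).1.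
  - by apply: filterS CE => w ->.
have /andP[_ le1] := moment_lim_itv cyc.
split=> [|lt1 CS].
  apply: contra_notT; rewrite -leNgt => ge1 A mA.
  have e1 : xoo = mup by apply/le_anti; rewrite le1.
  rewrite /distribution /pushforward.
  have hC := distribution01 uC eC _ mA; have hS := distribution01 uS eS _ mA.
  by rewrite /= hC ?hS// eC2.
have : ex P (fun w => C [::] w ^+ 2) = ex P (fun w => S [::] w ^+ 2).
  pose sq (x : R) := (Num.max 0 (Num.min 1 x)) ^+ 2.
  have clip01 x : 0 <= (Num.max 0 (Num.min 1 x) : R) <= 1.
    by rewrite le_max lexx/= ge_max ler01 ge_min lexx.
  have bsq : bm sq.
    apply: bm_sq; split.
      apply: measurable_maxr; first exact: measurable_cst.
      by apply: measurable_minr; [exact: measurable_cst|exact: measurable_id].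
    by exists 1 => x; have /andP[? ?] := clip01 x; rewrite ger0_norm.
  have e (X : T -> R) : um X -> ex P (fun w => X w ^+ 2) = ex P (sq \o X).
    move=> uX; apply: eq_ex => w; have /andP[x0 x1] := uX.2 w.
    by rewrite /sq/= (min_idPr x1) (max_idPr x0).
  rewrite (e _ uC) (e _ uS); apply: eq_law_ex => // A mA; exact: CS.
by rewrite eC2 eS2 => e; move: lt1; rewrite e ltxx.
Qed.

End endogenous_solution.

(** * Probabilities on bit sequences *)

Section bit_sequences.
Context {R : realType}.
Local Notation bits := (fam nat bool).

Definition cyl (w : seq bool) : set bits := [set b : nat -> bool | mkseq b (size w) = w].

Lemma mkseqS (b : nat -> bool) n : mkseq b n.+1 = rcons (mkseq b n) (b n).
Proof. by rewrite /mkseq -addn1 iotaD map_cat cats1. Qed.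

Lemma cyl_rcons w c : cyl (rcons w c) = cyl w `&` [set b : nat -> bool | b (size w) = c].
Proof.
apply/seteqP; split=> b; rewrite /cyl/= size_rcons mkseqS.
  by move=> /rcons_inj[].
by move=> [-> ->].
Qed.

Lemma measurable_coord (i : nat) (c : bool) : measurable [set b : bits | b i = c].
Proof. exact: (measurable_preim (A := [set c]) (measurable_ev i)). Qed.

Lemma cyl_nil : cyl [::] = setT.
Proof. by apply/seteqP; split. Qed.

Lemma measurable_cyl w : measurable (cyl w).
Proof.
elim/last_ind: w => [|w c IH]; last by rewrite cyl_rcons; apply: measurableI => //; exact: measurable_coord.
by rewrite cyl_nil; exact: measurableT.
Qed.

Lemma uniform_interval (l r : R) : 0 <= l -> l <= r -> r <= 1 ->
  uniform_prob (@ltr01 R) `[l, r[%classic = (r - l)%:E.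
Proof.
move=> l0 lr r1; rewrite /uniform_prob.
rewrite (eq_integral (fun=> 1%:E)); last first.
  move=> x; rewrite inE/= in_itv/= => /andP[lx xr]; rewrite /uniform_pdf.
  by rewrite (le_trans l0 lx) (ltW (lt_le_trans xr r1)) subr0 invr1.
rewrite integral_cst//= mul1e lebesgue_measure_itv/= lte_fin.
by move: lr; rewrite le_eqVlt => /predU1P[->|->] //; rewrite ltxx subrr.
Qed.

Lemma measurable_unif_id : measurable_fun setT (id : measurableTypeR R -> R).
Proof. by move=> _ A mA; rewrite setTI. Qed.

(** Pushing forward by the identity only changes the type on which the measure lives. *)
Definition unif01 : probability R R :=
  distribution (uniform_prob (@ltr01 R)) (mkmfun measurable_unif_id).

Lemma unif01_sub (l r : R) : 0 <= l -> l <= r -> r <= 1 ->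
  unif01 `[l, r[%classic = (r - l)%:E.
Proof. exact: uniform_interval. Qed.

Lemma unif01_itv : unif01 `[0, 1[%classic = 1%E.
Proof. by rewrite unif01_sub// subr0. Qed.

Lemma unif01_cut (E : set R) : measurable E -> unif01 (E `&` `[0, 1[%classic) = unif01 E.
Proof. by apply: prob_setI_full; [exact: measurable_itv|exact: unif01_itv]. Qed.

Section nested_intervals.
Variable p : seq bool -> R.
Hypothesis p0 : forall w, 0 <= p w.
Hypothesis p_nil : p [::] = 1.
Hypothesis pS : forall w, p w = p (rcons w false) + p (rcons w true).

(* Left endpoint of the interval of length [p w] attached to the word [w] *)
Definition left_end (w : seq bool) : R :=
  \sum_(i < size w) if nth false w i then p (rcons (take i w) false) else 0.

Lemma left_end_rcons w c :
  left_end (rcons w c) = left_end w + if c then p (rcons w false) else 0.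
Proof.
rewrite /left_end size_rcons big_ord_recr/= nth_rcons ltnn eqxx.
rewrite -cats1 take_size_cat//; congr (_ + _); apply: eq_bigr => i _.
by rewrite nth_cat ltn_ord take_cat ltn_ord.
Qed.

(* The word of length [n] whose interval contains [x] *)
Fixpoint word (n : nat) (x : R) : seq bool :=
  if n is m.+1 then
    let w := word m x in rcons w (left_end w + p (rcons w false) <= x)
  else [::].

Lemma size_word n x : size (word n x) = n.
Proof. by elim: n => //= n IH; rewrite size_rcons IH. Qed.

(** The interval of w is cut at left_end w + p (rcons w false) into those of its two extensions, and
    the next digit of [word] records the side of x. *)
Lemma word_interval w x : 0 <= x < 1 ->
  (word (size w) x == w) = (left_end w <= x < left_end w + p w).
Proof.
move=> x01; elim/last_ind: w => [|w c IH].
  by rewrite /left_end big_ord0 add0r p_nil x01 eqxx.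
rewrite size_rcons /= left_end_rcons eqseq_rcons IH.
case: (word (size w) x =P w) IH => [->|wx] IH.
  rewrite -IH /=.
  have /andP[l1 l2] : left_end w <= x < left_end w + p w by rewrite -IH.
  case: c => /=; rewrite ?addr0; last first.
    by rewrite l1 eqbF_neg -ltNge.
  by rewrite -addrA -pS l2 andbT; case: (_ <= x).
rewrite -IH andFb; apply/esym/negbTE; move: IH => /esym/negbT.
rewrite !negb_and => /orP[h|h]; apply/orP.
  left; apply: contra h; apply: le_trans; rewrite lerDl; by case: c.
right; apply: contra h => h; apply: (lt_le_trans h).
case: c {h}; rewrite ?addr0 -?addrA -?pS// lerD2l.
by rewrite [leRHS]pS lerDl.
Qed.

Lemma word_bounds w : 0 <= left_end w /\ left_end w + p w <= 1.
Proof.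
elim/last_ind: w => [|w c [IH1 IH2]]; first by rewrite /left_end big_ord0 add0r p_nil.
rewrite left_end_rcons; have := p0 (rcons w true); have := p0 (rcons w false).
by move: IH2; rewrite pS; case: c; split; lra.
Qed.

Lemma measurable_word n w : measurable [set x | word n x = w].
Proof.
elim: n w => [|n IH] w.
  have [->|w0] := eqVneq w [::].
    by rewrite (_ : [set x | _] = setT)//; apply/seteqP; split.
  by rewrite (_ : [set x | _] = set0)//; apply/seteqP; split => // x /= wE; rewrite wE eqxx in w0.
case/lastP: w => [|w c].
  rewrite (_ : [set x | _] = set0)//; apply/seteqP; split => // x /= /(congr1 size).
  by rewrite size_rcons.
rewrite (_ : [set x | _] = [set x | word n x = w] `&`
    (if c then `[left_end w + p (rcons w false), +oo[%classic
     else `]-oo, left_end w + p (rcons w false)[%classic)).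
  by apply: measurableI => //; case: c; exact: measurable_itv.
apply/seteqP; split=> x /=.
  move=> /rcons_inj[<-]; split => //; case: c H => H; rewrite /= in_itv/= ?andbT ?H//.
  by rewrite ltNge H.
move=> [-> h]; congr rcons; case: c h => /=; rewrite in_itv/= ?andbT//.
by move=> h; apply/negbTE; rewrite -ltNge.
Qed.

Definition word_bits (x : R) : bits := fun i => last false (word i.+1 x).

Lemma mkseq_word_bits n x : mkseq (word_bits x) n = word n x.
Proof.
by elim: n => //= n IH; rewrite mkseqS IH /word_bits/= last_rcons.
Qed.

Lemma measurable_word_bits : measurable_fun setT word_bits.
Proof.
apply: measurable_fam => i _ A _; rewrite setTI.
rewrite (_ : _ @^-1` _ = \bigcup_(w : seq bool)
    ([set x | word i.+1 x = w] `&` (if last false w \in A then setT else set0))).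
  apply: countable_bigcupT_measurable => // w.
  by apply: measurableI; [exact: measurable_word|case: ifP].
apply/seteqP; split=> x; rewrite /preimage/=.
  by move=> Ax; exists (word i.+1 x) => //; split => //=; rewrite mem_set.
by move=> [w _ [/= <-]]; case: ifPn => //; rewrite inE.
Qed.

Definition words_prob : probability bits R :=
  distribution unif01 (mkmfun measurable_word_bits).

Lemma words_probE w : words_prob (cyl w) = (p w)%:E.
Proof.
have [l0 l1] := word_bounds w.
have mE : measurable [set x : R | word (size w) x = w] by exact: measurable_word.
have EE : word_bits @^-1` cyl w = [set x : R | word (size w) x = w].
  by apply/seteqP; split=> x; rewrite /preimage/cyl/= mkseq_word_bits.
change (unif01 (word_bits @^-1` cyl w) = (p w)%:E); rewrite EE -unif01_cut//.
rewrite (_ : _ `&` _ = `[left_end w, left_end w + p w[%classic).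
  rewrite unif01_sub ?lerDl//; congr (_%:E); ring.
apply/seteqP; split=> x /=.
  by move=> [/eqP]; rewrite !in_itv/= => h x01; rewrite -word_interval.
rewrite !in_itv/= => h; have x01 : 0 <= x < 1.
  by have /andP[? ?] := h; apply/andP; split; lra.
by split => //; apply/eqP; rewrite word_interval.
Qed.

End nested_intervals.

(** D is the union of the cylinders of length n that it meets. *)
Lemma eq_prob_prefix (P Q : probability bits R) (n : nat) (D : set bits) :
  (forall w, size w = n -> P (cyl w) = Q (cyl w)) -> measurable D ->
  (forall b b' : bits, mkseq b n = mkseq b' n -> D b -> D b') -> P D = Q D.
Proof.
move=> PQ mD dep.
have DE : D = \bigcup_(w in [set: n.-tuple bool]) (D `&` cyl w).
  apply/seteqP; split=> [b Db|b [w _ []]//].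
  have sb : size (mkseq b n) == n by rewrite size_mkseq.
  by exists (Tuple sb) => //; split => //; rewrite /cyl/= size_mkseq.
have tD : trivIset [set: n.-tuple bool] (fun w => D `&` cyl w).
  move=> w w' _ _ [b [[_ bw] [_ bw']]]; apply/val_inj.
  by move: bw bw'; rewrite /cyl/= !size_tuple => <- <-.
have mDw (w : n.-tuple bool) : measurable (D `&` cyl w).
  by apply: measurableI => //; exact: measurable_cyl.
rewrite DE !measure_fin_bigcup//; try exact: finite_finset.
apply: eq_fsbigr => w _.
have [[b [Db bw]]|nD] := pselect (exists b, (D `&` cyl w) b).
  have -> : D `&` cyl w = cyl w.
    apply/seteqP; split=> [b' []//|b' b'w]; split => //; apply: dep Db.
    by move: bw b'w; rewrite /cyl/= !size_tuple => -> ->.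
  by apply: PQ; rewrite size_tuple.
by rewrite (_ : _ `&` _ = set0) ?measure0//; apply/seteqP; split => // b Db; apply: nD; exists b.
Qed.

Lemma eq_prob_cyl (P Q : probability bits R) : (forall w, P (cyl w) = Q (cyl w)) ->
  forall E, measurable E -> P E = Q E.
Proof.
move=> PQ; apply: eq_prob_fam => s A us mA.
pose n := (\max_(i <- s) i).+1.
apply: (eq_prob_prefix (n := n)) => //.
  apply: measurable_bigcap_seq => i _.
  exact: (measurable_preim (measurable_ev i) (mA i)).
move=> b b' bb' Fb i /= si; have := Fb i si; rewrite /=.
suff -> : b i = b' i by [].
have i_n : (i < n)%N by rewrite ltnS; exact: (@leq_bigmax_seq _ s xpredT id).
have := congr1 (fun t => nth false t i) bb'.
by rewrite /= !nth_mkseq.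
Qed.

Lemma prob_cyl_split (P : probability bits R) w :
  P (cyl w) = (P (cyl (rcons w false)) + P (cyl (rcons w true)))%E.
Proof.
have {1}-> : cyl w = cyl (rcons w false) `|` cyl (rcons w true).
  rewrite !cyl_rcons -setIUr; apply/seteqP; split=> [b bw|b []//].
  by split => //=; case: (b (size w)); [right|left].
rewrite measureU//; try exact: measurable_cyl.
by rewrite !cyl_rcons; apply/seteqP; split => // b [[_ /= ->] []].
Qed.

(** * Projective limits of laws on bit sequences *)

Section projective_limit.
Variable keep : nat -> nat -> bool.
Hypothesis keep_mono : forall M i, keep M i -> keep M.+1 i.
Hypothesis keep_all : forall i, exists M, keep M i.

(** [keep M] selects the coordinates settled at stage M. The others are set to false instead of
    being dropped, so that all stages live on one space. *)
Definition mask (M : nat) (b : bits) : bits := fun i => keep M i && b i.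

Lemma measurable_mask M : measurable_fun setT (mask M).
Proof.
apply: measurable_fam => i; apply: measurable_and; first exact: measurable_cst.
exact: measurable_ev.
Qed.

Lemma keep_le M M' i : (M <= M')%N -> keep M i -> keep M' i.
Proof. by move=> /subnKC <-; elim: (M' - M)%N => [|k IH]; rewrite ?addn0// addnS => /IH /keep_mono. Qed.

Lemma mask_mask M M' b : (M <= M')%N -> mask M (mask M' b) = mask M b.
Proof.
move=> MM; apply/funext => i; rewrite /mask andbA; case: (boolP (keep M i)) => //= ki.
by rewrite (keep_le MM ki).
Qed.

(** The probability of a word is read off at any stage that settles all its digits. Consistency
    makes it independent of the stage and additive over extensions, and the nested intervals realise
    it. *)
Lemma projective_limit (Pm : nat -> probability bits R) :
  (forall M E, measurable E -> Pm M.+1 (mask M @^-1` E) = Pm M (mask M @^-1` E)) ->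
  exists Q : probability bits R,
    forall M E, measurable E -> Q (mask M @^-1` E) = Pm M (mask M @^-1` E).
Proof.
move=> PS.
have Ple M M' E : (M <= M')%N -> measurable E ->
    Pm M' (mask M @^-1` E) = Pm M (mask M @^-1` E).
  move=> /subnKC <- mE; elim: (M' - M)%N => [|k IH]; first by rewrite addn0.
  rewrite addnS -IH.
  have mME : measurable (mask M @^-1` E) by exact: (measurable_preim (measurable_mask M)).
  have -> : mask M @^-1` E = mask (M + k) @^-1` (mask M @^-1` E).
    by apply/seteqP; split=> b; rewrite /preimage/= mask_mask// leq_addr.
  exact: PS.
have /choice [m mP] : forall n, exists M, forall i, (i < n)%N -> keep M i.
  elim=> [|n [M IH]]; first by exists 0%N.
  have [M' kM'] := keep_all n; exists (maxn M M') => i.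
  rewrite ltnS leq_eqVlt => /predU1P[->|/IH].
    by apply: keep_le kM'; exact: leq_maxr.
  by apply: keep_le; exact: leq_maxl.
have mask_prefix M n (b : bits) : (m n <= M)%N -> mkseq (mask M b) n = mkseq b n.
  move=> mM; apply/eq_in_map => i; rewrite mem_iota add0n => /andP[_ i_n].
  by rewrite /mask (keep_le mM)// mP.
have cylE M w : (m (size w) <= M)%N -> mask M @^-1` cyl w = cyl w.
  by move=> mM; apply/seteqP; split=> b; rewrite /preimage/cyl/= mask_prefix.
have Pcyl M w : (m (size w) <= M)%N -> Pm M (cyl w) = Pm (m (size w)) (cyl w).
  move=> mM; have := Ple _ _ _ mM (measurable_cyl w).
  by rewrite cylE.
pose p w := fine (Pm (m (size w)) (cyl w)).
have pE w M : (m (size w) <= M)%N -> Pm M (cyl w) = (p w)%:E.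
  by move=> mM; rewrite Pcyl// /p fineK// fin_num_measure//; exact: measurable_cyl.
have p0 w : 0 <= p w by rewrite fine_ge0.
have p1 : p [::] = 1 by rewrite /p cyl_nil probability_setT.
have pS w : p w = p (rcons w false) + p (rcons w true).
  pose M := maxn (m (size w)) (m (size w).+1).
  apply: EFin_inj; rewrite EFinD -!(@pE _ M) ?size_rcons ?leq_maxr ?leq_maxl//.
  exact: prob_cyl_split.
exists (words_prob p) => M E mE.
have QE := words_probE p0 p1 pS; set Q := words_prob _ in QE *.
pose QM := distribution Q (mkmfun (measurable_mask M)).
pose PM := distribution (Pm M) (mkmfun (measurable_mask M)).
apply: (@eq_prob_cyl QM PM _ E mE) => w.
change (Q (mask M @^-1` cyl w) = Pm M (mask M @^-1` cyl w)).
(* At stage M' both the coordinates of the mask and all digits of w are settled. *)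
pose n := size w; pose M' := maxn M (m n).
have mcw : measurable (mask M @^-1` cyl w).
  exact: (measurable_preim (measurable_mask M) (measurable_cyl w)).
rewrite -(Ple M M')//; [|exact: leq_maxl|exact: measurable_cyl].
apply: (eq_prob_prefix (n := n)) => //.
  by move=> v vn; rewrite QE (pE v M')// vn leq_maxr.
move=> b b' bb'; rewrite /preimage/cyl/= => {2}<-.
apply/eq_in_map => i; rewrite mem_iota add0n => /andP[_ i_n]; rewrite /mask.
have := congr1 (fun t => nth false t i) bb'.
by rewrite /= !nth_mkseq// => ->.
Qed.

End projective_limit.
End bit_sequences.

(** * Fair coins and sampling from them *)

Section fair_coins.
Context {R : realType}.
Local Notation bits := (fam nat bool).

Definition half_pow (w : seq bool) : R := 2^-1 ^+ size w.

Lemma half_pow_ge0 w : 0 <= half_pow w.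
Proof. by rewrite exprn_ge0// invr_ge0. Qed.

Lemma half_pow_nil : half_pow [::] = 1.
Proof. exact: expr0. Qed.

Lemma half_powS w : half_pow w = half_pow (rcons w false) + half_pow (rcons w true).
Proof. by rewrite /half_pow !size_rcons exprS; lra. Qed.

Definition coin : probability bits R := words_prob half_pow.

Lemma coinE w : coin (cyl w) = (half_pow w)%:E.
Proof. by apply: words_probE; [exact: half_pow_ge0|exact: half_pow_nil|exact: half_powS]. Qed.

Definition flip (n : nat) (b : bits) : bits := fun i => b i (+) (i == n).

Lemma measurable_flip n : measurable_fun setT (flip n).
Proof.
apply: measurable_fam => i.
move=> _ A _; rewrite setTI.
exact: (measurable_preim (measurable_ev i) (A := [set c | A (c (+) (i == n))])).
Qed.

Lemma coin_flip n (E : set bits) : measurable E -> coin (flip n @^-1` E) = coin E.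
Proof.
apply: (@eq_prob_cyl _ (distribution coin (mkmfun (measurable_flip n)))) => w.
change (coin (flip n @^-1` cyl w) = coin (cyl w)).
have -> : flip n @^-1` cyl w = cyl (mkseq (fun i => nth false w i (+) (i == n)) (size w)).
  apply/seteqP; split=> b; rewrite /preimage/cyl/= size_mkseq => h;
    apply: (@eq_from_nth _ false) => [|i]; rewrite !size_mkseq// => iw; rewrite !nth_mkseq//.
    by rewrite -h nth_mkseq// /flip addbK.
  have := congr1 (fun t => nth false t i) h.
  by rewrite /= !nth_mkseq// /flip => ->; rewrite addbK.
by rewrite !coinE /half_pow size_mkseq.
Qed.

(** Flipping bit n preserves the law and D and exchanges the two values of the bit; averaging the
    event with its image gives the factor. *)
Lemma coin_indep1 n (A : set bool) (D : set bits) : measurable D ->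
  (forall b, D (flip n b) <-> D b) ->
  ex coin (\1_([set b : bits | A (b n)] `&` D)) =
  (\1_A true + \1_A false) / 2 * ex coin \1_D.
Proof.
move=> mD Dn.
pose E := [set b : bits | A (b n)].
have mE : measurable E by exact: (measurable_preim (measurable_ev n) (A := A)).
have mED : measurable (E `&` D) by exact: measurableI.
have mFED : measurable (flip n @^-1` (E `&` D)).
  exact: (measurable_preim (measurable_flip n)).
have exF : ex coin \1_(flip n @^-1` (E `&` D)) = ex coin \1_(E `&` D).
  by rewrite !ex_indic// coin_flip.
have : ex coin (fun b => \1_(E `&` D) b + \1_(flip n @^-1` (E `&` D)) b) =
    ex coin (fun b => (\1_A true + \1_A false) * \1_D b).
  apply: eq_ex => b.
  have -> : \1_(flip n @^-1` (E `&` D)) b = \1_A (~~ b n) * \1_D b :> R.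
    have -> : \1_(flip n @^-1` (E `&` D)) b = \1_(E `&` D) (flip n b) :> R by [].
    rewrite indicI /=; congr (_ * _).
      have -> : \1_E (flip n b) = \1_A (flip n b n) :> R by [].
      by rewrite /flip eqxx addbT.
    by rewrite !indicE; congr (nat_of_bool _)%:R; apply/idP/idP; rewrite !inE => /Dn.
  have -> : \1_(E `&` D) b = \1_A (b n) * \1_D b :> R.
    by rewrite indicI.
  by case: (b n); rewrite /=; ring.
have bI (X : set bits) : measurable X -> bm (\1_X : bits -> R).
  by move=> mX; exact/um_bm/um_indic.
rewrite exD//; try exact: bI.
rewrite exF exZ//; [|exact: bI].
by rewrite -/E; lra.
Qed.

Definition bit (i : nat) : {RV coin >-> bool} := mkmfun (@measurable_ev nat _ bool i).

Lemma bits_indep : mutually_indep setT bit.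
Proof.
move=> s A; elim: s => [|n s IH] us _ mA.
  by rewrite bigcap_nil big_nil probability_setT.
have /andP[ns us'] := us.
have {}mA i : measurable (A i) by [].
have mD : measurable (\bigcap_(i in [set` s]) bit i @^-1` A i).
  by apply: measurable_bigcap_seq => i _; apply: measurable_preim.
have mE : measurable (bit n @^-1` A n) by apply: measurable_preim.
have step D := @coin_indep1 n (A n) D.
rewrite bigcap_cons big_cons -IH//.
rewrite (indic_fin coin mD) (indic_fin coin mE) (indic_fin coin (measurableI _ _ mE mD)) -EFinM.
congr (_%:E); rewrite step//; last first.
  move=> b; split=> h i /= si; have := h i si; rewrite /preimage/= /flip.
    by case: eqP => [iN|_]; [move: ns; rewrite -iN si|rewrite addbF].
  by case: eqP => [iN|_]; [move: ns; rewrite -iN si|rewrite addbF].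
congr (_ * _); have := step setT measurableT (fun=> iff_refl _).
by rewrite setIT indicT ex_cst mulr1 => <-.
Qed.

(** * Countably many independent rows of coins *)

Section rows.
Variable K : countType.

Definition row (k : K) (b : bits) : bits := fun j => b (pickle (k, j)).

Lemma measurable_row k : measurable_fun setT (row k).
Proof. by apply: measurable_fam => j; exact: measurable_ev. Qed.

Lemma row_law k (E : set bits) : measurable E -> coin (row k @^-1` E) = coin E.
Proof.
move=> mE.
have cK : cancel (fun j : nat => pickle (k, j))
    (fun i => if (unpickle i : option (K * nat)) is Some (_, j) then j else 0%N).
  by move=> j; rewrite pickleK.
apply: (indep_family_law (V1 := bit \o (fun j => pickle (k, j))) (V2 := bit)) => //.
- exact: (mutually_indep_reindex cK _ bits_indep).
- exact: bits_indep.
- move=> j A mA.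
  have law n : coin (bit n @^-1` A) = (((\1_A true + \1_A false) / 2)%:E).
    rewrite (indic_fin coin (measurable_preim (measurable_ev n) mA)); congr (_%:E).
    have := @coin_indep1 n A setT measurableT (fun=> iff_refl _).
    by rewrite setIT indicT ex_cst mulr1.
  by change (coin (bit (pickle (k, j)) @^-1` A) = coin (bit j @^-1` A)); rewrite !law.
Qed.

Lemma rows_sampled_indep d (L : measurableType d) (V : K -> {RV coin >-> L})
    (f : K -> bits -> L) :
  (forall k, measurable_fun setT (f k)) -> (forall k b, V k b = f k (row k b)) ->
  mutually_indep setT V.
Proof.
move=> mf Vf s A us _ mA.
pose B k := [set i | exists j, i = pickle (k : K, j : nat)].
have := @indep_many_blocks _ _ _ coin _ _ _ K setT set0 B bit s setT
  (fun k => V k @^-1` A k) bits_indep.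
rewrite setIT probability_setT mule1; apply => //.
- move=> k k' i ks ks' [j ->] [j' /(pcan_inj pickleK)[]]//.
- exact: (@measurableT _ (g_sigma_algebraType _)).
- move=> k ks.
  have -> : V k @^-1` A k = (fun b j => bit (pickle (k, j)) b) @^-1` (f k @^-1` A k).
    by apply/seteqP; split => b; rewrite /preimage/= Vf.
  apply: (sigma_family_fam (B := B k) (V := bit) (h := fun j => pickle (k, j))).
    by move=> j; exists j.
  by apply: measurable_preim => //; exact: mA.
Qed.

End rows.

Section labels.
Context (K : countType) d (L : measurableType d) (f : bits -> L).
Hypothesis mf : measurable_fun setT f.

Lemma measurable_label (k : K) : measurable_fun setT (f \o row k).
Proof. by apply: measurableT_comp mf _; exact: measurable_row. Qed.

Definition label (k : K) : {RV coin >-> L} := mkmfun (measurable_label k).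

Lemma label_indep : mutually_indep setT label.
Proof. exact: (rows_sampled_indep (f := fun=> f)). Qed.

Lemma label_law (k : K) (A : set L) : measurable A ->
  coin (label k @^-1` A) = coin (f @^-1` A).
Proof.
by move=> mA; apply: (row_law k (E := f @^-1` A)); exact: measurable_preim.
Qed.

Lemma label_same (k l : K) : same_law (label k) (label l).
Proof.
move=> A mA; change (coin (label k @^-1` A) = coin (label l @^-1` A)).
by rewrite !label_law.
Qed.

End labels.

Lemma left_end_mkseq (b : bits) n :
  left_end half_pow (mkseq b n.+1) = left_end half_pow (mkseq b n) +
    if b n then 2^-1 ^+ n.+1 else 0.
Proof. by rewrite mkseqS left_end_rcons /half_pow size_rcons size_mkseq. Qed.

Lemma left_end01 (w : seq bool) : 0 <= left_end half_pow w <= 1.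
Proof.
have [h1 h2] := word_bounds half_pow_ge0 half_pow_nil half_powS w.
by rewrite h1 (le_trans _ h2)// lerDl half_pow_ge0.
Qed.

Lemma left_end_cvg (b : bits) : cvgn (fun n => left_end half_pow (mkseq b n)).
Proof.
apply: nondecreasing_is_cvgn.
  apply/nondecreasing_seqP => n; rewrite left_end_mkseq lerDl; case: ifP => // _.
by exists 1 => _ [n _ <-]; have /andP[] := left_end01 (mkseq b n).
Qed.

(* The number with binary digits [b] *)
Definition binary (b : bits) : R := limn (fun n => left_end half_pow (mkseq b n)).

Lemma um_binary : um binary.
Proof.
apply: (@um_lim _ _ bits (fun n b => left_end half_pow (mkseq b n))); last first.
  by move=> b; exact: left_end_cvg.
move=> n; split; last by move=> b; exact: left_end01.
elim: n => [|n IH].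
  by rewrite (_ : (fun _ => _) = cst 0)//; apply/funext => b; rewrite /left_end big_ord0.
rewrite (_ : (fun _ => _) = (fun b : bits => left_end half_pow (mkseq b n) +
    if b n then 2^-1 ^+ n.+1 else 0)); last by apply/funext => b; rewrite left_end_mkseq.
apply: measurable_funD => //; apply: measurable_fun_ifT => //; exact: measurable_ev.
Qed.

Lemma binaryK (x : R) : 0 <= x < 1 -> binary (word_bits half_pow x) = x.
Proof.
move=> x01; apply/cvg_lim => //.
have h n : left_end half_pow (word half_pow n x) <= x <
    left_end half_pow (word half_pow n x) + 2^-1 ^+ n.
  have := word_interval half_pow_ge0 half_pow_nil half_powS (word half_pow n x) x01.
  by rewrite /half_pow size_word eqxx => /esym.
apply: (squeeze_cvgr (f := fun n => x - 2^-1 ^+ n) (h := fun=> x)).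
- by apply: nearW => n; rewrite mkseq_word_bits; have /andP[] := h n; lra.
- rewrite -[X in _ --> X]subr0; apply: cvgB; first exact: cvg_cst.
  apply: cvg_expr; rewrite ger0_norm ?invr_ge0//; lra.
- exact: cvg_cst.
Qed.

Lemma coin_sample (Q : probability bits R) : exists2 phi : bits -> bits,
  measurable_fun setT phi &
  forall E, measurable E -> coin (phi @^-1` E) = Q E.
Proof.
pose p w := fine (Q (cyl w)).
have pE w : (p w)%:E = Q (cyl w).
  by rewrite /p fineK//; apply: fin_num_measure; exact: measurable_cyl.
have p0 w : 0 <= p w by rewrite fine_ge0.
have p1 : p [::] = 1 by rewrite /p cyl_nil probability_setT.
have pS w : p w = p (rcons w false) + p (rcons w true).
  by apply: EFin_inj; rewrite EFinD !pE prob_cyl_split.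
have mphi : measurable_fun setT (word_bits p \o binary).
  exact: measurableT_comp (measurable_word_bits p) um_binary.1.
exists (word_bits p \o binary) => // E mE.
rewrite -(@eq_prob_cyl _ (words_prob p) Q)//; last by move=> w; rewrite words_probE.
have mw (q : seq bool -> R) (F : set bits) : measurable F -> measurable (word_bits q @^-1` F).
  exact: (measurable_preim (measurable_word_bits q)).
have mphiE : measurable ((word_bits p \o binary) @^-1` E) by exact: measurable_preim.
(* The coin law is by definition the image of the uniform law under binary digits, and [binary]
   undoes these on [0, 1). *)
change (unif01 (word_bits half_pow @^-1` ((word_bits p \o binary) @^-1` E)) =
  unif01 (word_bits p @^-1` E)).
rewrite -unif01_cut; last exact: mw.
rewrite -[RHS]unif01_cut; last exact: mw.
congr (unif01 _); apply/seteqP; split=> x [h]; rewrite /= in_itv/= => x01;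
  by move: h; rewrite /preimage/= binaryK.
Qed.

(** The sample lies in the range of the decoder f everywhere, not just almost surely. That [f \o e]
    is the identity where Q lives is checked in each application. *)
Lemma coin_sample_code d (T : measurableType d) (Q : probability T R)
    (e : T -> bits) (f : bits -> T) :
  measurable_fun setT e -> measurable_fun setT f -> exists2 phi : bits -> T,
  measurable_fun setT phi /\ (forall b, exists b', phi b = f b') &
  forall E, measurable E -> coin (phi @^-1` E) = Q ((f \o e) @^-1` E).
Proof.
move=> me mf; have [phi mphi phiE] := coin_sample (distribution Q (mkmfun me)).
exists (f \o phi) => [|E mE].
  by split; [exact: measurableT_comp mf mphi|move=> b; exists (phi b)].
have mfE : measurable (f @^-1` E) by exact: measurable_preim.
by rewrite comp_preimage phiE.
Qed.

Lemma coin_sample01 (Q : probability R R) : Q [set` `[0, 1]] = 1%E ->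
  exists2 phi : bits -> R, um phi &
  forall E, measurable E -> coin (phi @^-1` E) = Q E.
Proof.
move=> Q1.
(* Halving brings the endpoint 1 into [0, 1), where binary digits are faithful; the minimum keeps
   the decoder in [0, 1]. *)
pose e (x : R) : bits := word_bits half_pow (x / 2).
pose f (b : bits) : R := Num.min 1 (2 * binary b).
have me : measurable_fun setT e.
  apply: (@measurableT_comp _ _ _ _ _ _ (word_bits half_pow)); first exact: measurable_word_bits.
  exact: measurable_funM.
have mf : measurable_fun setT f.
  apply: measurable_minr; first exact: measurable_cst.
  by apply: measurable_funM => //; exact: um_binary.1.
have [phi [mphi phif] phiE] := coin_sample_code Q me mf.
exists phi.
  split => // b; have [b' ->] := phif b; rewrite /f.
  have /andP[h1 h2] := um_binary.2 b'.
  by rewrite le_min ler01 mulr_ge0//= ge_min lexx.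
move=> E mE; rewrite phiE//.
have m01 : measurable ([set` `[0, 1]] : set R) by exact: measurable_itv.
have cut (F : set R) := @prob_setI_full _ _ _ Q _ F m01 Q1.
have mfe : measurable ((f \o e) @^-1` E).
  by apply: measurable_preim => //; exact: measurableT_comp mf me.
rewrite -cut// -[RHS]cut//; congr (Q _).
have feK (x : R) : x \in `[0, 1] -> f (e x) = x.
  rewrite in_itv/= => /andP[x0 x1]; rewrite /f /e binaryK; last first.
    by apply/andP; split; lra.
  rewrite mulrCA mulfV// mulr1; exact/min_idPr.
by apply/seteqP; split=> x [h h01]; split => //; move: h; rewrite /preimage/= feK.
Qed.

(** Decodes the unary code of an extended natural number; the zero sequence stands for infinity. *)
Definition first_bit (b : bits) : xnat :=
  if pselect (exists j, b j) is left h then Some (ex_minn h) else None.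

Lemma first_bit_unary (n : xnat) : first_bit (fun j => n == Some j) = n.
Proof.
rewrite /first_bit; case: pselect => [h|h].
  by case: ex_minnP => j /eqP -> _.
by case: n h => [k|] h //; exfalso; apply: h; exists k; rewrite eqxx.
Qed.

Lemma measurable_first_bit : measurable_fun setT first_bit.
Proof.
move=> _ A _; rewrite setTI.
have m1 (n : option nat) : measurable [set b : bits | first_bit b = n].
  case: n => [k|].
    rewrite (_ : [set b | _] = [set b : bits | b k = true] `&`
        \bigcap_(i in [set` iota 0 k]) [set b : bits | b i = false]).
      apply: measurableI; first exact: measurable_coord.
      by apply: measurable_bigcap_seq => i _; exact: measurable_coord.
    apply/seteqP; split=> b /=; rewrite /first_bit; case: pselect => [h|h] //.
    - case: ex_minnP => j bj jm [<-]; split => // i; rewrite /= mem_iota add0n => /andP[_ ij].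
      by apply/negbTE/negP => /jm; rewrite leqNgt ij.
    - move=> [bk bi]; congr Some; case: ex_minnP => j bj jm; apply/eqP.
      rewrite eqn_leq jm//= leqNgt; apply/negP => jk.
      by have := bi j; rewrite /= mem_iota add0n bj => /(_ jk).
    - by move=> [bk _]; exfalso; apply: h; exists k.
  rewrite (_ : [set b | _] = \bigcap_i [set b : bits | b i = false]).
    by apply: bigcapT_measurable => i; exact: measurable_coord.
  apply/seteqP; split=> b /=; rewrite /first_bit; case: pselect => [h|h] //.
  - by move=> _ i _ /=; apply/negbTE/negP => bi; apply: h; exists i.
  - by move=> bi; exfalso; case: h => j; rewrite (bi j).
rewrite (_ : _ @^-1` _ = \bigcup_(n : option nat) if n \in A then [set b : bits | first_bit b = n] else set0).
  by apply: countable_bigcupT_measurable => // n; case: ifP.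
apply/seteqP; split=> b.
  by move=> Ab; exists (first_bit b) => //; rewrite mem_set.
by move=> [n _]; case: ifPn => // /set_mem An /= bn; rewrite /preimage/= bn.
Qed.

Lemma measurable_unary : measurable_fun setT ((fun n j => n == Some j) : xnat -> bits).
Proof. exact: measurable_fam. Qed.

Lemma coin_sample_xnat (Q : probability xnat R) : exists2 phi : bits -> xnat,
  measurable_fun setT phi &
  forall E, measurable E -> coin (phi @^-1` E) = Q E.
Proof.
have [phi [mphi _] phiE] := coin_sample_code Q measurable_unary measurable_first_bit.
exists phi => // E mE; rewrite phiE//; congr (Q _).
by apply/seteqP; split=> n; rewrite /preimage/= first_bit_unary.
Qed.

End fair_coins.

(** * Invariant laws *)

Section L2_distance.
Context {R : realType}.

(* Test against Lipschitz approximations of half lines. *)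
Lemma eq_law_L2 d (T : measurableType d) (P : probability T R)
    (Q1 Q2 : probability R R) (X Y : nat -> T -> R) :
  (forall n, um (X n)) -> (forall n, um (Y n)) ->
  (forall n A, measurable A -> P (X n @^-1` A) = Q1 A) ->
  (forall n A, measurable A -> P (Y n @^-1` A) = Q2 A) ->
  ex P (fun w => (X n w - Y n w) ^+ 2) @[n --> \oo] --> (0 : R) ->
  forall A, measurable A -> Q1 A = Q2 A.
Proof.
move=> uX uY lX lY XY.
pose h (a : R) (m : nat) (x : R) := clip01 (m%:R * (a - x)).
have mh a m : measurable_fun setT (h a m).
  apply: (measurableT_comp um_clip01.1); apply: measurable_funM => //.
  exact: measurable_funB.
have uh a m : um (h a m).
  by split; [exact: mh|move=> x; exact: um_clip01.2].
have eqh a m : ex Q1 (h a m) = ex Q2 (h a m).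
  have exX n : ex P (h a m \o X n) = ex Q1 (h a m).
    rewrite -[h a m in RHS]/(h a m \o id); apply: eq_law_ex => //; first exact: (uX n).1.
    - exact: lX.
    - exact/um_bm.
  have exY n : ex P (h a m \o Y n) = ex Q2 (h a m).
    rewrite -[h a m in RHS]/(h a m \o id); apply: eq_law_ex => //; first exact: (uY n).1.
    - exact: lY.
    - exact/um_bm.
  have bhX n : bm (h a m \o X n) by exact/um_bm/(um_comp (uX n).1).
  have bhY n : bm (h a m \o Y n) by exact/um_bm/(um_comp (uY n).1).
  have bXY n : bm (fun w => X n w - Y n w) by apply: bmB; exact: um_bm.
  have le n : (ex Q1 (h a m) - ex Q2 (h a m)) ^+ 2 <=
      m%:R ^+ 2 * ex P (fun w => (X n w - Y n w) ^+ 2).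
    rewrite -(exX n) -(exY n) -exB//.
    apply: (le_trans (sq_ex_le P (bmB (bhX n) (bhY n)))).
    rewrite -exZ; last exact: bm_sq.
    apply: ex_le; [exact/bm_sq/bmB|apply: bmM; [exact: bm_cst|exact: bm_sq]|].
    move=> w /=; apply: (le_trans (clip01_lip _ _)).
    rewrite [leLHS](_ : _ = m%:R ^+ 2 * (X n w - Y n w) ^+ 2)//; ring.
  have : (ex Q1 (h a m) - ex Q2 (h a m)) ^+ 2 <= 0.
    rewrite -[leRHS](mulr0 (m%:R ^+ 2)).
    apply: (cvgr_to_ge (cvgMr (b := 0) (XY))).
    by apply: nearW => n; exact: le.
  by rewrite le_eqVlt ltNge sqr_ge0 orbF sqrf_eq0 subr_eq0 => /eqP.
have eqI a : Q1 `]-oo, a[%classic = Q2 `]-oo, a[%classic.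
  have mI : measurable (`]-oo, a[%classic : set R) by exact: measurable_itv.
  rewrite (indic_fin Q1 mI) (indic_fin Q2 mI); congr (_%:E).
  have cv (Q : probability R R) : ex Q (h a m) @[m --> \oo] --> ex Q \1_(`]-oo, a[%classic).
    apply: (@ex_cvg _ _ _ _ _ _ 1) => //.
    - by move=> m x; have /andP[? ?] := (uh a m).2 x; rewrite ger0_norm.
    - apply: aeW => x.
      rewrite (@indicPE _ _ _ (x < a)) ?in_itv//=.
      case: ltP => xa; last first.
        apply: cvg_near_cst; apply: nearW => m; apply: clip01_eq0.
        by rewrite mulr_ge0_le0//; lra.
      apply: cvg_near_cst; near=> m; apply: clip01_eq1.
      rewrite -ler_pdivrMr; last lra.
      by near: m; exact: nbhs_infty_ger.
  have e : (fun m => ex Q1 (h a m)) = (fun m => ex Q2 (h a m)).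
    by apply/funext => m; exact: eqh.
  by have := cv Q1; rewrite e => c1; apply: (cvg_unique _ c1 (cv Q2)).
move=> A mA0; have mA : (@ocitv R).-sigma.-measurable A by [].
rewrite RGenInftyO.measurableE in mA.
apply: (@eq_prob_gen _ _ _ Q1 Q2 (@RGenInftyO.G R)) => //.
- move=> _ _ [x ->] [y ->]; exists (Num.min x y).
  by apply/seteqP; split=> z /=; rewrite !in_itv/= lt_min => /andP.
- by move=> _ [x ->]; exact: measurable_itv.
- by move=> _ [x ->]; exact: eqI.
Unshelve. all: by end_near.
Qed.

End L2_distance.

Section invariant_step.
Context {R : realType} d (L : measurableType d) (nl : L -> xnat).
Hypothesis mnl : measurable_fun setT nl.
Context d1 (T : measurableType d1) (P : probability T R)
  (V : seq nat -> {RV P >-> L}).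
Hypothesis iV : mutually_indep setT V.
Hypothesis lV : forall u v, same_law (V u) (V v).
Context d0 (T0 : measurableType d0) (P0 : probability T0 R) (N : {RV P0 >-> xnat}).
Hypothesis lN : forall B, P (V [::] @^-1` (nl @^-1` B)) = P0 (N @^-1` B).
Variable nu : probability R R.
Hypothesis inv_nu : invariant_law N nu.
Local Notation tree := (fam (seq nat) L).
Local Notation tau := (the_tree V).

(** Invariance asks for inputs independent of sizes indexed by the whole tree, whereas the inputs
    here are functions of subtrees that themselves contain sizes. The sizes are therefore
    re-indexed. *)
Lemma invariant_rde (g : tree -> R) : um g ->
  (forall A, measurable A -> P ((g \o tau) @^-1` A) = nu A) ->
  forall A, measurable A -> P ((rde nl g \o tau) @^-1` A) = nu A.
Proof.
move=> ug gnu A mA.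
(* The equation reads sizes on levels 0 and 1 only. These are taken in the subtree of daughter 0,
   whose level 2 carries the inputs; all other sizes are borrowed from the subtree of daughter 1, so
   that sizes and inputs use disjoint labels. *)
pose sig v : seq nat := if (size v < 2)%N then 0%N :: v else 1%N :: v.
have sigK : cancel sig behead by move=> v; rewrite /sig; case: ifP.
have mN v : measurable_fun setT (nl \o V (sig v)).
  by apply: measurableT_comp mnl _; exact: measurable_funPT.
pose Nu v : {RV P >-> xnat} := mkmfun (mN v).
have mX (ij : nat * nat) : measurable_fun setT (g \o (subtree [:: 0%N; ij.1; ij.2] \o tau)).
  apply: measurableT_comp ug.1 _.
  exact: measurableT_comp (measurable_subtree _) (measurable_tree V).
pose X ij : {RV P >-> R} := mkmfun (mX ij).
have := @inv_nu.2 _ T P Nu X _ _ _ _ _ A mA.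
have -> : [set w | A (rde_map (Nu [::] w) (fun i => Nu [:: i] w) (fun i j => X (i, j) w))]
    = (subtree [:: 0%N] \o tau) @^-1` (rde nl g @^-1` A).
  by apply/seteqP; split=> w; rewrite /preimage/= rdeE.
rewrite subtree_law//; last by apply: measurable_preim => //; exact: (um_rde mnl ug).1.
apply.
- split.
    by move=> u B mB; rewrite -[RHS]lN; apply: lV; exact: measurable_preim.
  move=> s B us _ mB.
  apply: (mutually_indep_reindex sigK (D := setT) _ iV (A := fun v => nl @^-1` B v)) => //.
  by move=> i si; apply: measurable_preim => //; exact: mB.
- by move=> ij w; exact: ug.2.
- move=> [i j] B mB; rewrite -gnu//.
  apply: (subtree_law iV lV [:: 0%N; i; j] (E := g @^-1` B)).
  by apply: measurable_preim => //; exact: ug.1.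
- move=> s B us _ mB.
  have := @indep_many_blocks _ _ _ P _ _ _ (nat * nat)%type setT set0
    (fun ij => block [:: 0%N; ij.1; ij.2]) V s setT (fun ij => X ij @^-1` B ij) iV.
  rewrite setIT probability_setT mule1; apply => //.
  + by move=> [i j] [i' j'] u _ _ /= h1 h2; 
    have [-> ->] := @block_disj [:: 0%N; i; j] [:: 0%N; i'; j'] u erefl h1 h2.
  + exact: (@measurableT _ (g_sigma_algebraType _)).
  + by move=> ij sij; apply: subtree_event; [exact: ug.1|exact: mB].
- move=> B C sB sC.
  apply: (indep_blocks (B1 := [set u | (2 < size u)%N && (head 1%N u == 0%N)])
    (B2 := range sig) iV) => //.
  + move=> u /= /andP[u2 /eqP u0] [v _ uE]; move: u2 u0; rewrite -uE /sig.
    by case: ifP => //= v2; rewrite ltnS ltnNge -ltnS v2.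
  + move: B sB; apply: smallest_sub; first exact: smallest_sigma_algebra.
    move=> _ [[i j] _ [B mB <-]]; rewrite setTI.
    apply: (@sigma_family_sub _ _ _ _ _ _ _ (block [:: 0%N; i; j])); first by move=> _ [v ->].
    by apply: subtree_event => //; exact: ug.1.
  + move: C sC; apply: smallest_sub; first exact: smallest_sigma_algebra.
    move=> _ [v _ [C mC <-]]; apply: sub_sigma_algebra; exists (sig v); first by exists v.
    by exists (nl @^-1` C) => //; exact: measurable_preim.
Qed.

Lemma invariant_iter_rde (g : tree -> R) n : um g ->
  (forall A, measurable A -> P ((g \o tau) @^-1` A) = nu A) ->
  forall A, measurable A -> P ((iter n (rde nl) g \o tau) @^-1` A) = nu A.
Proof.
move=> ug gnu; elim: n => // n IH; rewrite iterS.
by apply: invariant_rde => //; exact: um_iter_rde.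
Qed.

End invariant_step.

Section invariant_laws.
Context {R : realType} d0 (T0 : measurableType d0) (P0 : probability T0 R)
  (N : {RV P0 >-> xnat}) (mup mum : R).
Local Notation H := (pgf N).
Hypothesis N0 : forall w, N w <> Some 0%N.
Hypothesis Hconvex : strictly_convex01 H.
Hypothesis cyc : two_cycle (fun t => 1 - H t) mup mum.
Local Notation xs := (moment_seq N mup mum).
Local Notation xoo := (moment_lim N mup mum).
Local Notation K := (moment_map N mup mum).
Local Notation Q0 := (@coin R).

Definition second_moment (nu : probability R R) : R :=
  ex nu (fun x => clip01 x ^+ 2).

Lemma bm_clip_sq : bm (fun x : R => clip01 x ^+ 2).
Proof. exact/bm_sq/um_bm/um_clip01. Qed.

Lemma invariant_mean (nu : probability R R) : nu [set` `[0, 1]] = 1%E ->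
  (\int[nu]_x x%:E = mup%:E)%E -> ex nu clip01 = mup.
Proof.
move=> nu1 numean.
have nu0 : nu (~` [set` `[0, 1]]) = 0%E by rewrite probability_setC// nu1 subee.
rewrite /ex /Rintegral -[RHS]/(fine mup%:E) -numean; congr fine.
apply: ae_eq_integral => //.
- exact: (measurable_EFinP _ _).2 um_clip01.1.
- exists (~` [set` `[0, 1]]); split.
  + exact: measurableC.
  + exact: nu0.
  + move=> x /= nx x01; apply: nx => _; congr EFin; apply: clip01_id.
    by move: x01; rewrite /= in_itv.
Qed.

(** X n and Y n are the n-th iterates at the root started from two independent samples at each
    vertex; their independence makes the mixed moments start at mup^2. The last clause is the fixed
    point equation for the second moment, once the law is known not to change. *)
Lemma invariant_pair (nu1 nu2 : probability R R) :
  invariant_law N nu1 -> (\int[nu1]_x x%:E = mup%:E)%E ->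
  invariant_law N nu2 -> (\int[nu2]_x x%:E = mup%:E)%E ->
  exists X Y : nat -> fam nat bool -> R,
    [/\ forall n, um (X n) /\ um (Y n),
        forall n A, measurable A -> Q0 (X n @^-1` A) = nu1 A,
        forall n A, measurable A -> Q0 (Y n @^-1` A) = nu2 A,
        forall n, ex Q0 (fun b => X n b * Y n b) = xs n &
        ex Q0 (fun b => X 1%N b ^+ 2) = K (ex Q0 (fun b => X 0%N b ^+ 2))].
Proof.
move=> inv1 mean1 inv2 mean2.
have [phi mphi phiE] := coin_sample_xnat (distribution P0 N).
have [phi1 uphi1 phi1E] := coin_sample01 inv1.1.
have [phi2 uphi2 phi2E] := coin_sample01 inv2.1.
pose L := (xnat * (R * R))%type.
(* Three independent rows of coins serve one vertex: its family size and the two samples. *)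
pose f (b : fam nat bool) : L := (phi (row 0%N b), (phi1 (row 1%N b), phi2 (row 2%N b))).
have mr (k : nat) d' (T' : measurableType d') (h : fam nat bool -> T') :
    measurable_fun setT h -> measurable_fun setT (fun b => h (row k b)).
  by move=> mh; apply: measurableT_comp mh _; exact: measurable_row.
have mf : measurable_fun setT f.
  apply: measurable_fun_pair; first exact: mr.
  by apply: measurable_fun_pair; apply: mr; [exact: uphi1.1|exact: uphi2.1].
pose V (u : seq nat) : {RV Q0 >-> L} := label mf u.
have iV : mutually_indep setT V by exact: label_indep.
have Vlaw := @label_law R (seq nat) _ _ f mf.
have lV := @label_same R (seq nat) _ _ f mf.
pose nl (l : L) := l.1.
have mnl : measurable_fun setT nl by exact: measurable_fst.
have lN B : Q0 (V [::] @^-1` (nl @^-1` B)) = P0 (N @^-1` B).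
  transitivity (Q0 (phi @^-1` B)); last exact: phiE.
  rewrite Vlaw; last exact: measurable_preim.
  by apply: (row_law 0%N (E := phi @^-1` B)); exact: measurable_preim.
pose g1 (t : fam (seq nat) L) : R := clip01 (t [::]).2.1.
pose g2 (t : fam (seq nat) L) : R := clip01 (t [::]).2.2.
have m2 : measurable_fun setT (fun t : fam (seq nat) L => (t [::]).2).
  by apply: measurableT_comp measurable_snd _; exact: measurable_ev.
have ug1 : um g1.
  apply: (um_comp _ um_clip01); exact: measurableT_comp measurable_fst m2.
have ug2 : um g2.
  apply: (um_comp _ um_clip01); exact: measurableT_comp measurable_snd m2.
have g1E b : g1 (the_tree V b) = phi1 (row 1%N (row ([::] : seq nat) b)).
  by rewrite /g1 clip01_id//; exact: uphi1.2.
have g2E b : g2 (the_tree V b) = phi2 (row 2%N (row ([::] : seq nat) b)).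
  by rewrite /g2 clip01_id//; exact: uphi2.2.
have law1 A : measurable A -> Q0 ((g1 \o the_tree V) @^-1` A) = nu1 A.
  move=> mA; rewrite -phi1E//.
  have -> : (g1 \o the_tree V) @^-1` A = row ([::] : seq nat) @^-1` (row 1%N @^-1` (phi1 @^-1` A)).
    by apply/seteqP; split=> b; rewrite /preimage/= g1E.
  have mp : measurable (phi1 @^-1` A) by apply: measurable_preim => //; exact: uphi1.1.
  rewrite row_law; last by apply: measurable_preim => //; exact: measurable_row.
  exact: row_law.
have law2 A : measurable A -> Q0 ((g2 \o the_tree V) @^-1` A) = nu2 A.
  move=> mA; rewrite -phi2E//.
  have -> : (g2 \o the_tree V) @^-1` A = row ([::] : seq nat) @^-1` (row 2%N @^-1` (phi2 @^-1` A)).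
    by apply/seteqP; split=> b; rewrite /preimage/= g2E.
  have mp : measurable (phi2 @^-1` A) by apply: measurable_preim => //; exact: uphi2.1.
  rewrite row_law; last by apply: measurable_preim => //; exact: measurable_row.
  exact: row_law.
have mtau := measurable_tree V.
have mean (Y : fam nat bool -> R) (nu : probability R R) : um Y -> nu [set` `[0, 1]] = 1%E ->
    (\int[nu]_x x%:E = mup%:E)%E ->
    (forall A, measurable A -> Q0 (Y @^-1` A) = nu A) -> ex Q0 Y = mup.
  move=> uY nu1' numean law; rewrite -(invariant_mean nu1' numean).
  rewrite (@eq_ex _ _ _ _ _ (clip01 \o Y)); last first.
    by move=> b /=; rewrite clip01_id//; exact: uY.2.
  rewrite -[clip01 in RHS]/(clip01 \o id).
  apply: eq_law_ex => //; first exact: uY.1.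
  exact/um_bm/um_clip01.
have e1 : em V g1 = mup by apply: (mean _ nu1) => //; [exact: um_comp|exact: inv1.1].
have e2 : em V g2 = mup by apply: (mean _ nu2) => //; [exact: um_comp|exact: inv2.1].
have e12 : em V (fun t => g1 t * g2 t) = mup ^+ 2.
  pose F (k : nat) : fam nat bool -> R := if k == 1%N then phi1 else phi2.
  have uF k : um (F k) by rewrite /F; case: ifP.
  have uW k : um (F k \o row k) by apply: (um_comp _ (uF k)); exact: measurable_row.
  pose W k : {RV Q0 >-> R} := mkmfun (uW k).1.
  have iW : mutually_indep setT W.
    by apply: (rows_sampled_indep (f := F)) => // k; exact: (uF k).1.
  have eW k (nu : probability R R) : nu [set` `[0, 1]] = 1%E -> (\int[nu]_x x%:E = mup%:E)%E ->
      (forall A, measurable A -> Q0 (F k @^-1` A) = nu A) -> ex Q0 (W k) = mup.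
    move=> nu1' numean law; apply: (mean _ nu (uW k)) => // A mA; rewrite -law//.
    by apply: (row_law k (E := F k @^-1` A)); apply: measurable_preim => //; exact: (uF k).1.
  have := @ex_prod_indep _ _ _ Q0 _ [:: 1%N; 2%N] W setT isT measurableT uW.
  rewrite !big_cons !big_nil indicT ex_cst !mulr1.
  rewrite (eW 1%N nu1 inv1.1 mean1 phi1E) (eW 2%N nu2 inv2.1 mean2 phi2E) -expr2 => <-; last first.
    move=> B mB; rewrite setIT probability_setT mule1; apply: iW => // i _; exact: mB.
  pose G (b : fam nat bool) := phi1 (row 1%N b) * phi2 (row 2%N b).
  have uG : um G by exact: (umM (uW 1%N) (uW 2%N)).
  transitivity (ex Q0 (G \o row ([::] : seq nat))).
    by apply: eq_ex => b; rewrite /= g1E g2E.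
  transitivity (ex Q0 (G \o id)).
    apply: eq_law_ex => //; [exact: measurable_row|exact: row_law|exact: um_bm].
  by apply: eq_ex => b; rewrite !big_cons big_nil /= !mulr1.
exists (fun n => iter n (rde nl) g1 \o the_tree V), (fun n => iter n (rde nl) g2 \o the_tree V).
split.
- by move=> n; split; apply: (um_comp mtau); exact: um_iter_rde.
- by move=> n; exact: (invariant_iter_rde mnl iV lV lN inv1).
- by move=> n; exact: (invariant_iter_rde mnl iV lV lN inv2).
- by move=> n; have := em_iter_rdeM mnl iV lV lN cyc n ug1 ug2 e1 e2; rewrite e12.
- have := em_rdeM mnl iV lV lN cyc ug1 ug1 e1 e1.
  by rewrite /em => h; rewrite (eq_ex _ (fun b => expr2 _)) h; congr (K _); apply: eq_ex => b;
    rewrite expr2.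
Qed.

Lemma second_moment_of (nu : probability R R) (X : fam nat bool -> R) : um X ->
  (forall A, measurable A -> Q0 (X @^-1` A) = nu A) ->
  ex Q0 (fun b => X b ^+ 2) = second_moment nu.
Proof.
move=> uX lX; rewrite (@eq_ex _ _ _ _ _ ((fun x => clip01 x ^+ 2) \o X)); last first.
  by move=> b /=; rewrite clip01_id//; exact: uX.2.
rewrite /second_moment -[X in _ = ex nu X]/((fun x => clip01 x ^+ 2) \o id).
by apply: eq_law_ex => //; [exact: uX.1|exact: bm_clip_sq].
Qed.

(** Couple the law with itself: E (X_n - Y_n)^2 >= 0 bounds xs n by the second moment, so this fixed
    point of K is at least xoo. *)
Lemma invariant_second_moment (nu : probability R R) :
  invariant_law N nu -> (\int[nu]_x x%:E = mup%:E)%E ->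
  second_moment nu = xoo \/ second_moment nu = mup.
Proof.
move=> inv mean; have [X [Y [uXY lX lY XY XK]]] := invariant_pair inv mean inv mean.
have eX n := second_moment_of (uXY n).1 (lX n).
have eY n := second_moment_of (uXY n).2 (lY n).
have mc := invariant_mean inv.1 mean.
have bc := um_bm (@um_clip01 R).
apply: (moment_fix_two N0 Hconvex cyc).
- rewrite -[X in X ^+ 2]mc sq_ex_le//= -[leRHS]mc; apply: ex_le => //; first exact: bm_clip_sq.
  by move=> x; have /andP[? ?] := um_clip01.2 x; rewrite expr2 ler_piMl.
- by move: XK; rewrite !eX => <-.
- apply: (cvgr_to_le (moment_seq_cvg cyc)); apply: nearW => n.
  rewrite -XY.
  have : 0 <= ex Q0 (fun b => (X n b - Y n b) ^+ 2) by apply: ex_ge0 => b; exact: sqr_ge0.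
  rewrite ex_sqB ?eX ?eY; try exact/um_bm/(uXY n).1; try exact/um_bm/(uXY n).2.
  lra.
Qed.

Lemma invariant_bernoulli (nu : probability R R) :
  invariant_law N nu -> (\int[nu]_x x%:E = mup%:E)%E -> second_moment nu = mup ->
  forall A, measurable A -> nu A = (mup * \1_A 1 + (1 - mup) * \1_A 0)%:E.
Proof.
move=> inv mean sq A mA; have [X [Y [uXY lX _ _ _]]] := invariant_pair inv mean inv mean.
rewrite -(lX 0%N A mA); apply: distribution01 => //; first exact: (uXY 0%N).1.
  rewrite -(invariant_mean inv.1 mean) (@eq_ex _ _ _ _ _ (clip01 \o X 0%N)); last first.
    by move=> b /=; rewrite clip01_id//; exact: (uXY 0%N).1.2.
  rewrite -[clip01 in RHS]/(clip01 \o id).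
  apply: eq_law_ex => //; [exact: (uXY 0%N).1.1|exact: lX|exact/um_bm/um_clip01].
by rewrite (second_moment_of (uXY 0%N).1 (lX 0%N)).
Qed.

Lemma invariant_low_unique (nu1 nu2 : probability R R) :
  invariant_law N nu1 -> (\int[nu1]_x x%:E = mup%:E)%E ->
  invariant_law N nu2 -> (\int[nu2]_x x%:E = mup%:E)%E ->
  second_moment nu1 = xoo -> second_moment nu2 = xoo ->
  forall A, measurable A -> nu1 A = nu2 A.
Proof.
move=> inv1 mean1 inv2 mean2 sq1 sq2.
have [X [Y [uXY lX lY XY _]]] := invariant_pair inv1 mean1 inv2 mean2.
apply: (eq_law_L2 (fun n => (uXY n).1) (fun n => (uXY n).2) lX lY).
rewrite (_ : (fun n => _) = (fun n => xoo - 2 * xs n + xoo)); last first.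
  apply/funext => n; rewrite ex_sqB; try exact/um_bm/(uXY n).1; try exact/um_bm/(uXY n).2.
  by rewrite XY (second_moment_of (uXY n).1 (lX n)) (second_moment_of (uXY n).2 (lY n)) sq1 sq2.
rewrite [X in _ --> X](_ : _ = xoo - 2 * xoo + xoo); last by ring.
apply: cvgD; last exact: cvg_cst.
apply: cvgB; first exact: cvg_cst.
by apply: cvgMr; exact: (moment_seq_cvg cyc).
Qed.

Theorem at_most_two_invariant_laws (nu1 nu2 nu3 : probability R R) :
  let solution (nu : probability R R) :=
    invariant_law N nu /\ (\int[nu]_x x%:E = mup%:E)%E in
  let same (nu nu' : probability R R) :=
    forall A : set R, measurable A -> nu A = nu' A in
  solution nu1 -> solution nu2 -> solution nu3 ->
  [\/ same nu1 nu2, same nu1 nu3 | same nu2 nu3].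
Proof.
move=> solution same.
have low nu nu' : solution nu -> solution nu' -> second_moment nu = xoo ->
    second_moment nu' = xoo -> same nu nu'.
  by move=> [i1 m1] [i2 m2]; exact: invariant_low_unique.
have high nu nu' : solution nu -> solution nu' -> second_moment nu = mup ->
    second_moment nu' = mup -> same nu nu'.
  move=> [i1 m1] [i2 m2] s1 s2 A mA.
  by rewrite (invariant_bernoulli i1 m1 s1 mA) (invariant_bernoulli i2 m2 s2 mA).
move=> s1 s2 s3.
have [e1|e1] := invariant_second_moment s1.1 s1.2;
have [e2|e2] := invariant_second_moment s2.1 s2.2;
have [e3|e3] := invariant_second_moment s3.1 s3.2.
- by apply: Or31; exact: low.
- by apply: Or31; exact: low.
- by apply: Or32; exact: low.
- by apply: Or33; exact: high.
- by apply: Or33; exact: low.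
- by apply: Or32; exact: high.
- by apply: Or31; exact: high.
- by apply: Or31; exact: high.
Qed.

End invariant_laws.

(** * The discrete solution *)

Section zero_one.
Context {R : realType}.

(** Multiplicativity makes the product idempotent, for finite and infinite [n] alike. *)
Lemma xprod_zero_one n (x : nat -> R) : (forall i, x i = 0 \/ x i = 1) ->
  xprod n x = 0 \/ xprod n x = 1.
Proof.
move=> x01; have x01' i : 0 <= x i <= 1 by case: (x01 i) => ->; rewrite ?lexx ler01.
have : xprod n x * xprod n x = xprod n x.
  rewrite -xprodM//; apply: eq_xprod => i _.
  by case: (x01 i) => ->; rewrite ?mulr0 ?mulr1.
move=> /eqP; rewrite -subr_eq0 -[X in _ - X]mulr1 -mulrBr mulf_eq0 subr_eq0.
by move=> /orP[/eqP ->|/eqP ->]; [left|right].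
Qed.

Lemma indic1_id (x : R) : x = 0 \/ x = 1 -> \1_[set 1] x = x :> R.
Proof.
move=> [->|->]; rewrite indicE; last by rewrite mem_set.
by rewrite memNset// => /esym /eqP; rewrite oner_eq0.
Qed.

Lemma indic01 (T : Type) (A : set T) w : (\1_A w : R) = 0 \/ (\1_A w : R) = 1.
Proof. by rewrite indicE; case: (_ \in _); [right|left]. Qed.

End zero_one.

Section discrete_limit.
Context {R : realType} d1 (T1 : measurableType d1) (P1 : probability T1 R).
Local Notation L := (xnat * R)%type.
Variable V : seq nat -> {RV P1 >-> L}.
Hypothesis iV : mutually_indep setT V.
Hypothesis lV : forall u v, same_law (V u) (V v).
Context d0 (T0 : measurableType d0) (P0 : probability T0 R) (N : {RV P0 >-> xnat}).
Local Notation nl := (fun l : L => l.1).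
Hypothesis lN : forall B, P1 (V [::] @^-1` (nl @^-1` B)) = P0 (N @^-1` B).
Variables (mup mum : R).
Hypothesis cyc : two_cycle (fun t => 1 - pgf N t) mup mum.
Local Notation tree := (fam (seq nat) L).
Local Notation bits := (fam nat bool).
Local Notation tau := (the_tree V).
Local Notation rde := (@rde R _ L nl).

(** Testing the real label against 1 makes the leaf 0-1 valued for every label, not only almost
    surely. *)
Definition leaf (t : tree) : R := \1_[set 1] (t [::]).2.

Hypothesis leaf_mean : em V leaf = mup.

Let mnl : measurable_fun setT nl. Proof. exact: measurable_fst. Qed.
Let mtau := measurable_tree V.

Lemma um_leaf : um leaf.
Proof.
change (um ((\1_[set (1 : R)] : R -> R) \o (fun t : tree => (t [::]).2))).
apply: um_comp.
  by apply: measurableT_comp measurable_snd _; exact: measurable_ev.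
by apply: um_indic; exact: measurable_set1.
Qed.

Lemma leaf01 t : leaf t = 0 \/ leaf t = 1.
Proof. by rewrite /leaf indicE; case: (_ \in _); [right|left]. Qed.

Lemma half_rde01 (g : tree -> R) : (forall t, g t = 0 \/ g t = 1) ->
  forall t, half_rde nl g t = 0 \/ half_rde nl g t = 1.
Proof. by move=> g01 t; apply: xprod_zero_one => i; exact: g01. Qed.

Lemma rde01 (g : tree -> R) : (forall t, g t = 0 \/ g t = 1) ->
  forall t, rde g t = 0 \/ rde g t = 1.
Proof.
have C (h : tree -> R) : (forall t, h t = 0 \/ h t = 1) ->
    forall t, 1 - h t = 0 \/ 1 - h t = 1.
  by move=> h01 t; case: (h01 t) => ->; rewrite ?subrr ?subr0; [right|left].
by move=> g01; apply: (C (half_rde nl _)); apply: half_rde01; apply: C; exact: half_rde01.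
Qed.

Lemma iter_rde01 n t : iter n rde leaf t = 0 \/ iter n rde leaf t = 1.
Proof. by elim: n t => [|n IH] t; [exact: leaf01|exact: rde01]. Qed.

(* The value at [u] of the solution started from the leaves at level [2 M] *)
Definition approx (M : nat) (u : seq nat) (t : tree) : R :=
  iter (M - (size u)./2) rde leaf (subtree u t).

Lemma um_approx M u : um (approx M u).
Proof.
apply: (@um_comp _ _ _ _ _ (iter (M - (size u)./2) rde leaf) (subtree u)).
  exact: measurable_subtree.
exact/um_iter_rde/um_leaf.
Qed.

Lemma approx_rde M u t : ((size u)./2 < M)%N ->
  approx M u t = rde_map (t u).1 (fun i => (t (rcons u i)).1)
    (fun i j => approx M (rcons (rcons u i) j) t).
Proof.
move=> uM; rewrite /approx.
have -> : (M - (size u)./2)%N = (M - (size u).+2./2).+1 by rewrite /= -subnSK.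
rewrite iterS rdeE; congr (rde_map _ _ _).
by apply/funext => i; apply/funext => j; rewrite !size_rcons.
Qed.

(* Bit (u, 0) is S_u and bit (u, j + 1) says whether N_u = j *)
Definition code (M : nat) (t : tree) : bits := fun i =>
  match (unpickle i : option (seq nat * nat)) with
  | Some (u, 0%N) => ~~ odd (size u) && (approx M u t == 1)
  | Some (u, j.+1) => (t u).1 == Some j
  | None => false
  end.

(** Stage M settles the solution up to level 2M but the sizes only before it: a stage-M value is
    computed from exactly these sizes and the leaves on level 2M. *)
Definition keep (M i : nat) : bool :=
  match (unpickle i : option (seq nat * nat)) with
  | Some (u, 0%N) => (size u <= M.*2)%N
  | Some (u, j.+1) => (size u < M.*2)%N
  | None => true
  end.

Lemma keepS M i : keep M i -> keep M.+1 i.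
Proof.
rewrite /keep; case: unpickle => [[u [|j]]|]// uM; rewrite doubleS.
  by rewrite (leq_trans uM)// -addn2 leq_addr.
by rewrite (leq_trans uM)// -addn2 leq_addr.
Qed.

Lemma keep_exists i : exists M, keep M i.
Proof.
rewrite /keep; case: unpickle => [[u [|j]]|]; last by exists 0%N.
  by exists (size u); rewrite -addnn leq_addr.
by exists (size u).+1; rewrite -addnn addSn ltnS leq_addr.
Qed.

Lemma measurable_code M : measurable_fun setT (code M).
Proof.
apply: measurable_fam => i; rewrite /code; case: unpickle => [[u [|j]]|] //.
  apply: measurable_and; first exact: measurable_cst.
  by apply: measurable_fun_eqr; [exact: (um_approx M u).1|exact: measurable_cst].
apply: (@measurableT_comp _ _ _ _ _ _ (fun n : xnat => n == Some j)) => //.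
by apply: measurableT_comp measurable_fst _; exact: measurable_ev.
Qed.

Lemma iter_rde_local M (g g' : tree -> R) (t t' : tree) :
  (forall u, (size u < M.*2)%N -> (t u).1 = (t' u).1) ->
  (forall u, size u = M.*2 -> g (subtree u t) = g' (subtree u t')) ->
  forall m u, (size u + m.*2 = M.*2)%N ->
    iter m rde g (subtree u t) = iter m rde g' (subtree u t').
Proof.
move=> tt' gg'; elim=> [|m IH] u uM; first by apply: gg'; rewrite -uM addn0.
have sm k : (k < m.+1.*2)%N -> (size u + k < M.*2)%N by rewrite -uM ltn_add2l.
rewrite !iterS !rdeE tt'; last by rewrite -[size u]addn0 sm// doubleS.
congr (1 - _); apply: eq_xprod => i _.
rewrite tt'; last by rewrite size_rcons -addn1 sm// doubleS.
congr (1 - _); apply: eq_xprod => j _; apply: IH.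
by rewrite !size_rcons -uM doubleS !addSn !addnS.
Qed.

(** The n extra iterations can be absorbed into the leaves: placing the computed values on level 2M
    leaves the settled bits unchanged. *)
Lemma mask_code M n (t t' : tree) :
  (forall u, (size u < M.*2)%N -> (t u).1 = (t' u).1) ->
  (forall u, size u = M.*2 -> iter n rde leaf (subtree u t) = leaf (subtree u t')) ->
  mask keep M (code (M + n) t) = mask keep M (code M t').
Proof.
move=> tt' ll'; apply/funext => i; rewrite /mask /keep /code.
case: unpickle => [[u [|j]]|] //=; last first.
  by case: ltnP => //= uM; rewrite tt'.
case: leqP => //= uM; case: (boolP (odd (size u))) => //= ou.
have uE : size u = (size u)./2.*2 by rewrite -[LHS]odd_double_half (negbTE ou).
have uM' : ((size u)./2 <= M)%N by rewrite -leq_double -uE.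
congr (_ == 1); rewrite /approx addnC -addnBA// addnC iterD.
apply: iter_rde_local tt' ll' _ _ _.
by rewrite {1}uE -doubleD subnKC.
Qed.

(** Keeps of a label what the settled bits of stage M read. [next] below differs from it on level 2M
    only, where the leaf is replaced by one RDE step from its subtree. *)
Let trunc (M : nat) (u : seq nat) (l : L) : L :=
  if (size u < M.*2)%N then (l.1, 0) else
  if size u == M.*2 then (None, \1_[set 1] l.2) else (None, 0).

Let mtrunc M u : measurable_fun setT (trunc M u).
Proof.
rewrite /trunc; case: (_ < _)%N; last case: (_ == _).
- by apply: measurable_fun_pair; [exact: measurable_fst|exact: measurable_cst].
- apply: measurable_fun_pair; first exact: measurable_cst.
  change (measurable_fun setT ((\1_[set (1 : R)] : R -> R) \o (fun l : L => l.2))).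
  apply: measurableT_comp; last exact: measurable_snd.
  by apply: measurable_indic; exact: measurable_set1.
- exact: measurable_cst.
Qed.

Let W M u : {RV P1 >-> L} := mkmfun (measurableT_comp (@mtrunc M u) (measurable_funPT (V u))).

Let W_indep M : mutually_indep setT (W M).
Proof.
move=> s A us _ mA.
apply: (iV (A := fun u => trunc M u @^-1` A u)) => // u us'.
by apply: measurable_preim => //; exact: mA.
Qed.

Let next (M : nat) (u : seq nat) (w : T1) : L :=
  if (size u < M.*2)%N then ((V u w).1, 0) else
  if size u == M.*2 then (None, rde leaf (subtree u (tau w))) else (None, 0).

Let um_next u : um (fun w => rde leaf (subtree u (tau w))).
Proof.
apply: (@um_comp _ _ _ _ _ (rde leaf) (subtree u \o tau)).
  exact: measurableT_comp (measurable_subtree u) mtau.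
exact/um_rde/um_leaf.
Qed.

Let mnext M u : measurable_fun setT (next M u).
Proof.
rewrite /next; case: (_ < _)%N; last case: (_ == _).
- apply: measurable_fun_pair; last exact: measurable_cst.
  by apply: measurableT_comp measurable_fst _; exact: measurable_funPT.
- by apply: measurable_fun_pair; [exact: measurable_cst|exact: (um_next u).1].
- exact: measurable_cst.
Qed.

Let W' M u : {RV P1 >-> L} := mkmfun (@mnext M u).

Let W'_indep M : mutually_indep setT (W' M).
Proof.
move=> s A us _ mA.
(* A value of [next] on level 2M uses the whole subtree of its vertex; earlier vertices use their
   own label, later ones nothing. *)
pose B (u : seq nat) : set (seq nat) := if (size u < M.*2)%N then [set u] else
  if size u == M.*2 then block u else set0.
have := @indep_many_blocks _ _ _ P1 _ _ _ (seq nat) setT set0 B V s setT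
  (fun u => W' M u @^-1` A u) iV.
rewrite setIT probability_setT mule1; apply => //.
- move=> u v x _ _; rewrite /B.
  case: ltnP => uM; last case: eqP => // uE; (case: ltnP => vM; last case: eqP => // vE).
  + by move=> -> ->.
  + by move=> -> [y xE]; move: uM; rewrite xE size_cat vE ltnNge leq_addr.
  + by move=> [y xE] xv; move: vM; rewrite -xv xE size_cat uE ltnNge leq_addr.
  + by apply: block_disj; rewrite uE.
- exact: (@measurableT _ (g_sigma_algebraType _)).
- move=> u us'; have mAu := mA u us'.
  rewrite /B /W' /= /next; case: ltnP => uM; last case: eqP => uE.
  + apply: sub_sigma_algebra; exists u => //.
    exists ((fun l : L => (l.1, 0)) @^-1` A u); last by rewrite setTI.
    apply: measurable_preim => //.
    by apply: measurable_fun_pair; [exact: measurable_fst|exact: measurable_cst].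
  + apply: (@subtree_event _ _ _ _ _ _ V (rde leaf) u ((fun x : R => ((None : xnat), x)) @^-1` A u)).
      exact: (um_rde mnl um_leaf).1.
    apply: measurable_preim => //.
    by apply: measurable_fun_pair; [exact: measurable_cst|exact: measurable_id].
  + have [h|h] := pselect (A u (None, 0)).
      rewrite (_ : _ @^-1` _ = setT); first exact: (@measurableT _ (g_sigma_algebraType _)).
      by apply/seteqP; split.
    rewrite (_ : _ @^-1` _ = set0); first exact: (@measurable0 _ (g_sigma_algebraType _)).
    by apply/seteqP; split => // w /=.
Qed.

Lemma leaf_law u (A : set R) : measurable A ->
  P1 ((leaf \o (subtree u \o tau)) @^-1` A) = (mup * \1_A 1 + (1 - mup) * \1_A 0)%:E.
Proof.
have ul : um (leaf \o (subtree u \o tau)).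
  by apply: um_comp um_leaf; exact: measurableT_comp (measurable_subtree u) mtau.
have e : ex P1 (leaf \o (subtree u \o tau)) = mup.
  by rewrite em_subtree//; exact/um_bm/um_leaf.
apply: distribution01 => //; rewrite -[RHS]e; apply: eq_ex => w /=.
by case: (leaf01 (subtree u (tau w))) => ->; rewrite ?expr0n ?expr1n.
Qed.

Let rde_leaf_law u (A : set R) : measurable A ->
  P1 ((fun w => rde leaf (subtree u (tau w))) @^-1` A) =
  (mup * \1_A 1 + (1 - mup) * \1_A 0)%:E.
Proof.
have e : ex P1 (fun w => rde leaf (subtree u (tau w))) = mup.
  rewrite -[RHS](em_rde mnl iV lV lN cyc um_leaf leaf_mean).
  by apply: em_subtree => //; exact/um_bm/um_rde/um_leaf.
apply: distribution01 => //; rewrite -[RHS]e; apply: eq_ex => w /=.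
by case: (iter_rde01 1 (subtree u (tau w))) => /= ->; rewrite ?expr0n ?expr1n.
Qed.

Let W_law M u : same_law (W' M u) (W M u).
Proof.
move=> A mA; change (P1 (next M u @^-1` A) = P1 ((trunc M u \o V u) @^-1` A)).
rewrite /next /trunc /comp; case: ltnP => // uM; case: eqP => // uE.
pose A' : set R := (fun x : R => ((None : xnat), x)) @^-1` A.
have mA' : measurable A'.
  apply: measurable_preim => //.
  by apply: measurable_fun_pair; [exact: measurable_cst|exact: measurable_id].
transitivity (P1 ((fun w => rde leaf (subtree u (tau w))) @^-1` A')); first by [].
rewrite rde_leaf_law// -(@leaf_law u)//; congr (P1 _).
by apply/seteqP; split=> w; rewrite /preimage/= /A' /preimage/= /leaf /subtree cats0.
Qed.

(** The settled bits of stages M + 1 and M are the same function of the families [W'] and [W]. Both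
    families are independent with equal marginals: on level 2M both are Bernoulli (mup), because a
    step of the RDE preserves the mean mup and the values 0 and 1. *)
Lemma code_consistent M (E : set bits) : measurable E ->
  P1 ((code M.+1 \o tau) @^-1` (mask keep M @^-1` E)) =
  P1 ((code M \o tau) @^-1` (mask keep M @^-1` E)).
Proof.
move=> mE.
pose F : set tree := (mask keep M \o code M) @^-1` E.
have mF : measurable F.
  apply: measurable_preim => //.
  by apply: measurableT_comp (measurable_code M); exact: measurable_mask.
have e1 w : mask keep M (code M.+1 (tau w)) = mask keep M (code M (fun u => W' M u w)).
  rewrite -addn1; apply: mask_code => u uM; first by rewrite /W' /= /next uM.
  rewrite [RHS]/leaf /subtree cats0 /W' /= /next uM ltnn eqxx /= indic1_id//.
  exact: (iter_rde01 1).
have e2 w : mask keep M (code M (tau w)) = mask keep M (code M (fun u => W M u w)).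
  rewrite -[in LHS](addn0 M) [M in mask keep M]addn0.
  apply: mask_code => u uM; first by rewrite /W /= /trunc uM.
  rewrite /leaf /subtree cats0 /W /= /trunc uM ltnn eqxx /= ?cats0 [RHS]indic1_id//.
  exact: indic01.
transitivity (P1 ((fun w u => W' M u w) @^-1` F)).
  by congr (P1 _); apply/seteqP; split=> w; rewrite /preimage/= e1.
transitivity (P1 ((fun w u => W M u w) @^-1` F)); last first.
  by congr (P1 _); apply/seteqP; split=> w; rewrite /preimage/= e2.
by apply: (indep_family_law (V1 := W' M) (V2 := W M)) => // u; exact: W_law.
Qed.

Definition read_N (u : seq nat) (b : bits) : xnat :=
  first_bit (fun j => b (pickle (u, j.+1))).

Definition read_S (u : seq nat) (b : bits) : R := (b (pickle (u, 0%N)))%:R.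

Lemma measurable_read_N u : measurable_fun setT (read_N u).
Proof.
apply: (measurableT_comp (f := first_bit)); first exact: measurable_first_bit.
by apply: measurable_fam => j; exact: measurable_ev.
Qed.

Lemma measurable_read_S u : measurable_fun setT (read_S u).
Proof.
change (measurable_fun setT ((fun c : bool => c%:R : R) \o (fun b : bits => b (pickle (u, 0%N))))).
by apply: measurableT_comp => //; exact: measurable_ev.
Qed.

Lemma read_N_code M u t : read_N u (code M t) = (t u).1.
Proof.
rewrite /read_N -[RHS]first_bit_unary; congr first_bit; apply/funext => j.
by rewrite /code pickleK.
Qed.

Lemma read_S_code M u t : ~~ odd (size u) -> read_S u (code M t) = approx M u t.
Proof.
move=> ou; rewrite /read_S /code pickleK ou /=.
by case: (iter_rde01 (M - (size u)./2) (subtree u t)); rewrite -/(approx M u t) => ->;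
  rewrite ?eqxx// eq_sym oner_eq0.
Qed.

Lemma read_N_mask M u b : (size u < M.*2)%N -> read_N u (mask keep M b) = read_N u b.
Proof.
by move=> uM; congr first_bit; apply/funext => j; rewrite /mask /keep pickleK uM.
Qed.

Lemma read_S_mask M u b : (size u <= M.*2)%N -> read_S u (mask keep M b) = read_S u b.
Proof. by move=> uM; rewrite /read_S /mask /keep pickleK uM. Qed.

Section limit.
Variable Q : probability bits R.
Hypothesis QE : forall M E, measurable E ->
  Q (mask keep M @^-1` E) = P1 ((code M \o tau) @^-1` (mask keep M @^-1` E)).

(** The second hypothesis says that E depends only on the bits settled at stage M. Properties of Q
    follow by choosing a stage that settles all bits involved. *)
Lemma limit_transfer M (E : set bits) : measurable E ->
  (forall b, E (mask keep M b) <-> E b) -> Q E = P1 ((code M \o tau) @^-1` E).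
Proof.
move=> mE EM; have EE : mask keep M @^-1` E = E.
  by apply/seteqP; split=> b /EM.
by rewrite -EE QE.
Qed.

Let Nu u : {RV Q >-> xnat} := mkmfun (measurable_read_N u).
Let S u : {RV Q >-> R} := mkmfun (measurable_read_S u).

Let mcode M : measurable_fun setT (code M \o tau).
Proof. by apply: measurableT_comp (measurable_code M) mtau. Qed.

Let NuE M u A : (code M \o tau) @^-1` (Nu u @^-1` A) = V u @^-1` (nl @^-1` A).
Proof. by apply/seteqP; split=> w; rewrite /preimage/= read_N_code. Qed.

Let SE u A : ~~ odd (size u) -> (code (size u)./2 \o tau) @^-1` (S u @^-1` A) =
  (leaf \o (subtree u \o tau)) @^-1` A.
Proof.
move=> ou; apply/seteqP; split=> w; rewrite /preimage/= read_S_code//.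
  by rewrite /approx subnn.
by rewrite /approx subnn.
Qed.

Lemma limit_iid : iid_copies N Nu.
Proof.
split=> [u A mA|s A us _ mA].
  rewrite /distribution /pushforward.
  transitivity (P1 ((code (size u).+1 \o tau) @^-1` (Nu u @^-1` A))).
    apply: limit_transfer; first exact: measurable_preim.
    move=> b; rewrite /preimage/= read_N_mask// -addnn addSn ltnS.
    by rewrite (leq_trans (leqnSn _)) ?leq_addl.
  rewrite NuE -[RHS]lN; apply: lV; exact: measurable_preim.
pose M := (\max_(u <- s) size u).+1.
have sM u : u \in s -> (size u < M.*2)%N.
  move=> us'; rewrite -addnn addSn ltnS.
  by rewrite (leq_trans (@leq_bigmax_seq _ s xpredT size u us' isT))// leq_addr.
have tr E : measurable E -> (forall b, E (mask keep M b) <-> E b) ->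
  Q E = P1 ((code M \o tau) @^-1` E) by exact: limit_transfer.
rewrite tr; last 2 first.
- apply: measurable_bigcap_seq => u us'; apply: measurable_preim => //; exact: mA.
- move=> b; split=> h u us'; have := h u us'; rewrite /preimage/= read_N_mask//; exact: sM.
rewrite preimage_bigcap.
rewrite (eq_bigcapr (fun u _ => NuE M u (A u))).
have := iV (A := fun u => nl @^-1` A u) us _ (fun u us' => measurable_preim mnl (mA u us')).
move=> ->//; rewrite !big_seq; apply: eq_bigr => u us'.
rewrite tr ?NuE//; first by apply: measurable_preim => //; exact: mA.
by move=> b; rewrite /preimage/= read_N_mask//; exact: sM.
Qed.

Lemma even_half (u : seq nat) : ~~ odd (size u) -> (size u)./2.*2 = size u.
Proof. by move=> ou; rewrite -[RHS]odd_double_half (negbTE ou). Qed.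

Lemma limit_law u (A : set R) : ~~ odd (size u) -> measurable A ->
  Q (S u @^-1` A) = (mup * \1_A 1 + (1 - mup) * \1_A 0)%:E.
Proof.
move=> ou mA; rewrite (@limit_transfer (size u)./2); last 2 first.
- exact: measurable_preim.
- by move=> b; rewrite /preimage/= read_S_mask// even_half.
by rewrite SE// leaf_law.
Qed.

(** Both conclusions go through the sigma-algebra together: the first allows [limit_transfer], the
    second the independence of the labels. *)
Lemma transfer_sigma d' (T' : measurableType d') (D B : set (seq nat))
    (X : seq nat -> {RV Q >-> T'}) M :
  (forall u, D u -> forall b, X u (mask keep M b) = X u b) ->
  (forall u A, D u -> measurable A ->
    sigma_family B V ((code M \o tau) @^-1` (X u @^-1` A))) ->
  forall E, sigma_family D X E ->
    (forall b, E (mask keep M b) <-> E b) /\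
    sigma_family B V ((code M \o tau) @^-1` E).
Proof.
move=> XM XB E.
rewrite -[_ /\ _]/([set E | (forall b, E (mask keep M b) <-> E b) /\
  sigma_family B V ((code M \o tau) @^-1` E)] E).
move: E; apply: smallest_sub.
  split.
  - split => //; rewrite preimage_set0; exact: sigma_algebra0.
  - move=> A [Am sA]; rewrite setTD; split.
      by move=> b; split=> nA /Am.
    rewrite preimage_setC; exact: sigma_algebraC.
  - move=> F sF; split.
      by move=> b; split=> -[n _ Fn]; exists n => //; exact/(sF n).1.
    by rewrite preimage_bigcup; apply: sigma_algebra_bigcup => n; exact: (sF n).2.
move=> _ [u Du [A mA <-]]; rewrite setTI; split; last exact: XB.
by move=> b; rewrite /preimage/= XM.
Qed.

Let mark : L -> R := fun l => \1_[set 1] l.2.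

Let mmark : measurable_fun setT mark.
Proof.
apply: (@measurableT_comp _ _ _ _ _ _ (\1_[set (1 : R)] : R -> R)); last exact: measurable_snd.
by apply: measurable_indic; exact: measurable_set1.
Qed.

Let SV n u A : size u = n.*2 ->
  (code n \o tau) @^-1` (S u @^-1` A) = V u @^-1` (mark @^-1` A).
Proof.
move=> un; have ou : ~~ odd (size u) by rewrite un odd_double.
have <- : (size u)./2 = n by rewrite un half_double.
by rewrite SE//; apply/seteqP; split=> w; rewrite /preimage/= /leaf /subtree cats0.
Qed.

Lemma limit_indep n : mutually_indep [set u | size u = n.*2] S.
Proof.
move=> s A us sn mA.
have sM u b : u \in s -> read_S u (mask keep n b) = read_S u b.
  by move=> us'; rewrite read_S_mask// (sn _ us').
have mS u : u \in s -> measurable (S u @^-1` A u).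
  by move=> us'; apply: measurable_preim => //; exact: mA.
rewrite (@limit_transfer n); last 2 first.
- exact: measurable_bigcap_seq.
- by move=> b; split=> h u us'; have := h u us'; rewrite /preimage/= sM.
rewrite preimage_bigcap (eq_bigcapr (fun u us' => SV (A u) (sn u us'))).
have mB u : u \in s -> measurable (mark @^-1` A u).
  by move=> us'; apply: measurable_preim => //; exact: mA.
rewrite (iV us _ mB)//; rewrite !big_seq; apply: eq_bigr => u us'.
rewrite -(SV (A u) (sn u us')) -limit_transfer//; first exact: mS.
by move=> b; rewrite /preimage/= sM.
Qed.

Lemma limit_indepN n : indep_systems Q (sigma_family [set u | size u = n.*2] S)
  (sigma_family [set v | (size v < n.*2)%N] Nu).
Proof.
move=> A B sA sB.
have mA : measurable A by exact: sigma_family_measurable sA.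
have mB : measurable B by exact: sigma_family_measurable sB.
have [Am sA'] : (forall b, A (mask keep n b) <-> A b) /\
    sigma_family [set u | (n.*2 <= size u)%N] V ((code n \o tau) @^-1` A).
  apply: (transfer_sigma (D := [set u | size u = n.*2]) (X := S)) sA => [u un b|u C un mC].
    by apply: read_S_mask; rewrite un.
  rewrite SV//; apply: sub_sigma_algebra; exists u; first by rewrite /= un.
  by exists (mark @^-1` C); [exact: measurable_preim|rewrite setTI].
have [Bm sB'] : (forall b, B (mask keep n b) <-> B b) /\
    sigma_family [set u | (size u < n.*2)%N] V ((code n \o tau) @^-1` B).
  apply: (transfer_sigma (D := [set u | (size u < n.*2)%N]) (X := Nu)) sB => [u un b|u C un mC].
    exact: read_N_mask.
  rewrite NuE; apply: sub_sigma_algebra; exists u => //.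
  by exists (nl @^-1` C); [exact: measurable_preim|rewrite setTI].
rewrite (limit_transfer mA Am) (limit_transfer mB Bm) (@limit_transfer n); last 2 first.
- exact: measurableI.
- by move=> b; split=> -[] /Am ? /Bm ?.
rewrite preimage_setI.
apply: (indep_blocks iV _ _ _ sA' sB') => // u /= nu; by rewrite ltnNge nu.
Qed.

Lemma limit_rde u : ~~ odd (size u) -> {ae Q, forall b, S u b =
  rde_map (Nu u b) (fun i => Nu (rcons u i) b)
    (fun i j => S (rcons (rcons u i) j) b)}.
Proof.
(* This stage settles the granddaughters of u, the sizes of u and those of its daughters. There the
   equation holds surely, as [approx] satisfies it before level 2M. *)
move=> ou; pose M := ((size u)./2).+1.
pose rhs (b : bits) := rde_map (Nu u b) (fun i => Nu (rcons u i) b)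
    (fun i j => S (rcons (rcons u i) j) b).
have uS v : um (S v).
  split; first exact: measurable_funPT.
  by move=> b; rewrite /= /read_S; case: (b _); rewrite lexx ler01.
have urhs : um rhs.
  apply/umC/um_xprod => [|i]; first exact: measurable_funPT.
  by apply/umC/um_xprod => [|j]; [exact: measurable_funPT|exact: uS].
pose E := [set b | S u b == rhs b].
have mE : measurable E.
  apply: (measurable_preim (X := fun b => S u b == rhs b) (A := [set true])) => //.
  by apply: measurable_fun_eqr; [exact: measurable_funPT|exact: urhs.1].
have u2 : (size u).+2 = M.*2 by rewrite doubleS even_half.
have QE1 : Q E = 1%E.
  rewrite (@limit_transfer M)//.
    rewrite (_ : _ @^-1` _ = setT) ?probability_setT//.
    apply/seteqP; split => // w _; rewrite /preimage/E/=; apply/eqP.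
    rewrite /rhs /= read_S_code// approx_rde//; congr rde_map; first by rewrite read_N_code.
      by apply/funext => i; rewrite read_N_code.
    by apply/funext => i; apply/funext => j; rewrite read_S_code// !size_rcons /= negbK.
  move=> b; rewrite /E/= /rhs /=.
  rewrite read_S_mask; last by rewrite -u2 ltnW// ltnW.
  rewrite read_N_mask; last by rewrite -u2.
  have -> : (fun i => read_N (rcons u i) (mask keep M b)) = (fun i => read_N (rcons u i) b).
    by apply/funext => i; rewrite read_N_mask// size_rcons -u2.
  have -> // : (fun i j => read_S (rcons (rcons u i) j) (mask keep M b)) =
      (fun i j => read_S (rcons (rcons u i) j) b).
    by apply/funext => i; apply/funext => j; rewrite read_S_mask// !size_rcons u2.
exists (~` E); split.
- exact: measurableC.
- by rewrite probability_setC// QE1 subee.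
- by move=> b /= nE /eqP.
Qed.

Lemma limit_discrete : discrete_solution Nu mup S.
Proof.
split; last 2 first.
- by move=> u b _; rewrite /= /read_S; case: (b _); [right|left].
- move=> u ou; rewrite limit_law//.
  by rewrite !indic1_id; [rewrite mulr1 mulr0 addr0|left|right].
split.
- by move=> u b _; rewrite /= /read_S; case: (b _); rewrite lexx ler01.
- move=> u v ou ov A mA.
  by change (Q (S u @^-1` A) = Q (S v @^-1` A)); rewrite !limit_law.
- exact: limit_indep.
- exact: limit_indepN.
- exact: limit_rde.
Qed.

Lemma limit_mean : ('E_Q[S [::]] = mup%:E)%E.
Proof.
have uS : um (S [::]).
  split; first exact: measurable_funPT.
  by move=> b; rewrite /= /read_S; case: (b _); rewrite lexx ler01.
rewrite expectation_ex; last exact: um_bm.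
have mS : measurable (S [::] @^-1` [set 1]) by exact: measurable_preim.
rewrite (@eq_ex _ _ _ _ _ (\1_(S [::] @^-1` [set 1]))); last first.
  move=> b; rewrite -[LHS]indic1_id//.
  by rewrite /= /read_S; case: (b _); [right|left].
rewrite -indic_fin// limit_law//.
by rewrite !indic1_id; [rewrite mulr1 mulr0 addr0|left|right].
Qed.

End limit.
End discrete_limit.

Section discrete_existence.
Context {R : realType} d0 (T0 : measurableType d0) (P0 : probability T0 R)
  (N : {RV P0 >-> xnat}) (mup mum : R).
Hypothesis cyc : two_cycle (fun t => 1 - pgf N t) mup mum.

Theorem discrete_solution_exists :
  exists (d : measure_display) (T : measurableType d)
    (P : probability T R) (Nu : seq nat -> {RV P >-> xnat})
    (S : seq nat -> {RV P >-> R}),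
    [/\ iid_copies N Nu, discrete_solution Nu mup S &
        ('E_P[S [::]] = mup%:E)%E].
Proof.
have /andP[p0 p1] := (cyc01 cyc).1.
have [phi mphi phiE] := coin_sample_xnat (distribution P0 N).
have u1 : (unif01 : probability R R) [set` `[0, 1]] = 1%E.
  apply/eqP; rewrite eq_le probability_le1//= -unif01_itv.
  by apply: le_measure; rewrite ?inE// => x /=; rewrite !in_itv/= => /andP[-> /ltW].
have [phi1 uphi1 phi1E] := coin_sample01 u1.
pose L := (xnat * R)%type.
pose J : set R := `]-oo, mup[%classic.
have mJ : measurable J by exact: measurable_itv.
(* The second label is Bernoulli (mup): it tells whether a uniform variable falls below mup. *)
pose f (b : fam nat bool) : L := (phi (row 0%N b), \1_J (phi1 (row 1%N b))).
have mr (k : nat) d' (T' : measurableType d') (h : fam nat bool -> T') :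
    measurable_fun setT h -> measurable_fun setT (fun b => h (row k b)).
  by move=> mh; apply: measurableT_comp mh _; exact: measurable_row.
have mJphi : measurable_fun setT ((\1_J : R -> R) \o phi1).
  by apply: measurableT_comp uphi1.1; exact: measurable_indic.
have mf : measurable_fun setT f.
  by apply: measurable_fun_pair; [exact: mr|exact: (mr 1%N _ _ ((\1_J : R -> R) \o phi1))].
pose V (u : seq nat) : {RV (@coin R) >-> L} := label mf u.
have iV : mutually_indep setT V by exact: label_indep.
have lV u v : same_law (V u) (V v) by exact: label_same.
have lN B : coin (V [::] @^-1` ((fun l : L => l.1) @^-1` B)) = P0 (N @^-1` B).
  transitivity (@coin R (phi @^-1` B)); last exact: phiE.
  rewrite label_law; last by apply: measurable_preim => //; exact: measurable_fst.
  by apply: (row_law 0%N (E := phi @^-1` B)); exact: measurable_preim.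
have mphiJ : measurable (phi1 @^-1` J) by apply: measurable_preim => //; exact: uphi1.1.
have mrJ : measurable (row 1%N @^-1` (phi1 @^-1` J)).
  by apply: measurable_preim => //; exact: measurable_row.
have uJ : (unif01 : probability R R) J = mup%:E.
  rewrite -unif01_cut// (_ : J `&` _ = `[0, mup[%classic); first by rewrite unif01_sub// subr0.
  apply/seteqP; split=> x; rewrite /J /= !in_itv/=; first by move=> [-> /andP[->]].
  by move=> /andP[-> xm]; rewrite xm (lt_le_trans xm).
have lm : em V (@leaf R) = mup.
  transitivity (ex (@coin R) \1_(row ([::] : seq nat) @^-1` (row 1%N @^-1` (phi1 @^-1` J)))).
    by apply: eq_ex => b; rewrite /= /leaf /= indic1_id//; exact: indic01.
  apply: EFin_inj; rewrite -indic_fin; last by apply: measurable_preim => //; exact: measurable_row.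
  by rewrite row_law// row_law// phi1E.
have mcode M : measurable_fun setT (code M \o the_tree V).
  by apply: (measurableT_comp (@measurable_code R M)); exact: measurable_tree.
have [Q QE] := projective_limit keepS keep_exists
  (Pm := fun M => distribution (@coin R) (mkmfun (mcode M)))
  (fun M E mE => code_consistent iV lV lN cyc lm M mE).
eexists; eexists; exists Q; eexists; eexists; split.
- exact: (limit_iid iV lV lN QE).
- exact: (limit_discrete iV lV lm QE).
- exact: (limit_mean iV lV lm QE).
Qed.

End discrete_existence.

Theorem theorem6p2 (R : realType) (d0 : measure_display)
    (T0 : measurableType d0) (P0 : probability T0 R) (N : {RV P0 >-> xnat})
    (mup mum : R) :
  let H : R -> R := pgf N in
  let f : R -> R := fun t => 1 - H t in
  (forall w, N w <> Some 0%N) ->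
  strictly_convex01 H ->
  two_cycle f mup mum ->
  [/\ (* at most two invariant laws with mean mup *)
      forall nu1 nu2 nu3 : probability R R,
        let solution (nu : probability R R) :=
          invariant_law N nu /\ (\int[nu]_x x%:E = mup%:E)%E in
        let same (nu nu' : probability R R) :=
          forall A : set R, measurable A -> nu A = nu' A in
        solution nu1 -> solution nu2 -> solution nu3 ->
        [\/ same nu1 nu2, same nu1 nu3 | same nu2 nu3],
      (* existence and uniqueness of the endogenous solution C with mean mup *)
      forall (d : measure_display) (T : measurableType d)
        (P : probability T R) (Nu : seq nat -> {RV P >-> xnat}),
        iid_copies N Nu ->
        (exists C : seq nat -> {RV P >-> R},
           endogenous_solution Nu C /\ ('E_P[C [::]] = mup%:E)%E) /\
        (forall C C' : seq nat -> {RV P >-> R},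
           endogenous_solution Nu C -> ('E_P[C [::]] = mup%:E)%E ->
           endogenous_solution Nu C' -> ('E_P[C' [::]] = mup%:E)%E ->
           forall u, ~~ odd (size u) -> {ae P, forall w, C u w = C' u w}),
      (* existence of the discrete solution S *)
      exists (d : measure_display) (T : measurableType d)
        (P : probability T R) (Nu : seq nat -> {RV P >-> xnat})
        (S : seq nat -> {RV P >-> R}),
        [/\ iid_copies N Nu, discrete_solution Nu mup S &
            ('E_P[S [::]] = mup%:E)%E] &
      (* C_u = P(S_u = 1 | N), and the criterion for C and S to be distinct;
         for the degenerate cycles (0, 1) and (1, 0) both C and S are constant,
         so that the criterion is only necessary *)
      forall (d : measure_display) (T : measurableType d)
        (P : probability T R) (Nu : seq nat -> {RV P >-> xnat})
        (C S : seq nat -> {RV P >-> R}),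
        iid_copies N Nu ->
        endogenous_solution Nu C -> ('E_P[C [::]] = mup%:E)%E ->
        discrete_solution Nu mup S ->
        let distinct := ~ same_law (C [::]) (S [::]) in
        let criterion := (1%:E < deriv01 H mum * deriv01 H mup)%E in
        [/\ forall u, ~~ odd (size u) ->
              is_cond_prob (sigma_family setT Nu) (S u @^-1` [set 1]) (C u),
            distinct ->
              [/\ criterion, unstable_fixpoint (f \o f) mup
                & unstable_fixpoint (f \o f) mum] &
            0 < mup < 1 ->
              [/\ criterion -> distinct,
                  unstable_fixpoint (f \o f) mup -> distinct &
                  unstable_fixpoint (f \o f) mum -> distinct]]].
Proof.
move=> H f N0 Hconvex cyc; split.
- exact: at_most_two_invariant_laws N0 Hconvex cyc.
- move=> d T P Nu iid; split.
    exists (endo cyc Nu); split; first exact: endo_endogenous.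
    by rewrite expectation_ex ?endo_mean//; exact/um_bm/um_endo.
  move=> C C' eC mC eC' mC' u ou.
  have := endogenous_solution_unique N0 Hconvex cyc iid eC mC ou.
  have := endogenous_solution_unique N0 Hconvex cyc iid eC' mC' ou.
  by apply: filterS2 => w -> ->.
- exact: discrete_solution_exists cyc.
- move=> d T P Nu C S iid eC mC dS distinct criterion.
  have dist := distinct_iff N0 Hconvex cyc iid eC mC dS.
  split.
  + by move=> u ou; exact: (discrete_solution_cond_prob cyc iid eC mC dS ou).
  (* Distinctness forces mup to be interior, since xoo = mup at the boundary. *)
  + move=> /dist lt; have int := moment_lim_lt_interior cyc lt.
    by have [c1 c2 c3] := instability_criterion N0 Hconvex cyc int; split;
      [apply/c1|apply/c2|apply/c3].
  + move=> int; have [c1 c2 c3] := instability_criterion N0 Hconvex cyc int.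
    by split=> [/c1|/c2|/c3] lt; apply/dist.
Qed.
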